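(* Consider the steady-state stochastic fountain (defined in the context) with birth rate $\lambda>0$, domain $\Omega$ with detectors $D_1,\dots,D_J\subset\partial\Omega$, admissible source distribution $\phi$, and particles moving as It\^o diffusions $\mathrm{d}X(t)=b(X(t))\,\mathrm{d}t+\sqrt{2\eta}\,\mathrm{d}W(t)$. Then, for each $j$, the exit process $\{N_j(T)\}_{T\ge 0}$, $$N_j(T)=\sum_{n=1}^\infty \mathbf{1}_{[0,T]}(\tau_n)\,\mathbf{1}_{D_j}(X_n(\tau_n)),$$ is a Poisson process with rate $\lambda p_j(\phi)$, where $p_j(\phi)=\mathbb{P}^\phi(X(\tau)\in D_j)$ is the probability that a single particle started at time $0$ with $X(0)\sim\phi$ exits $\Omega$ through $D_j$.
   Context: Domain: $\Omega\subset\mathbb{R}^d$ is an open domain with compact closure and smooth boundary $\partial\Omega$. For a diffusion $X$ started at time $T_0$, its exit time is $\tau:=\inf\{t>T_0: X(t)\notin\Omega\}$; with $T_0=0$ it is assumed that $\sup_{x\in\Omega}\mathbb{E}^x[\tau]<\infty$. Detectors: $D_1,\dots,D_J$ are pairwise disjoint connected subsets of $\partial\Omega$. It\^o diffusion: $b:\mathbb{R}^d\to\mathbb{R}^d$ is twice continuously differentiable, $\eta>0$ is constant, $W$ is a standard $d$-dimensional Brownian motion. Admissible source distribution: a probability density $\phi:\mathbb{R}^d\to\mathbb{R}_+$ compactly supported on a ball of radius $\beta>0$ centered at some $\theta\in\mathbb{R}^d$, radially symmetric about $\theta$, with the ball contained in $\Omega$. Steady-state stochastic fountain: let $A$ be a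 homogeneous Poisson point process on $\mathbb{R}$ with intensity $\lambda$ times Lebesgue measure (the birth process), and let $\{T_n\}_{n=1}^\infty$ be an enumeration of its points. For each $n$, $\{X_n(t)\}_{t\ge T_n}$ is an It\^o diffusion satisfying $\mathrm{d}X_n(t)=b(X_n(t))\,\mathrm{d}t+\sqrt{2\eta}\,\mathrm{d}W_n(t)$ for $t>T_n$, with $W_n$ a standard $d$-dimensional Brownian motion, and with initial condition $X_n(T_n)\sim\phi$; the initial conditions are i.i.d., the particles do not interact (they evolve independently of each other, and their displaced paths $t\mapsto X_n(T_n+t)$ are i.i.d. and independent of the birth process). $\tau_n$ is the exit time of $X_n$ from $\Omega$ (in absolute time). $\mathbb{P}^\phi$ denotes probability with initial distribution $X(0)\sim\phi$. $\mathbf{1}_A$ is the indicator function of $A$. *)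

(* Defs.v *)
From HB Require Import structures.
From mathcomp Require Import all_boot all_order all_algebra.
From mathcomp Require Import all_classical all_reals all_analysis.
From mathcomp Require Import measurable_realfun.

Set Implicit Arguments.
Unset Strict Implicit.
Unset Printing Implicit Defensive.

Import Order.TTheory GRing.Theory Num.Theory.
Import numFieldNormedType.Exports.

Local Open Scope classical_set_scope.
Local Open Scope ring_scope.

(* R^d is ['rV[R]_d.+1]: the dimension is d.+1 >= 1 throughout. *)

(* The norm [`|x|] of the library is the sup norm on row vectors (same topology
   as the Euclidean norm, but different balls and spheres). *)
Definition enorm (R : realType) (d : nat) (x : 'rV[R]_d) : R :=
  Num.sqrt (\sum_(i < d) x 0 i ^+ 2).

Definition borel (R : realType) (d : nat) : set (set 'rV[R]_d) :=
  <<s [set U : set 'rV[R]_d | open U] >>.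

(* Integral over R^n against n-dimensional Lebesgue measure, as an iterated
   integral (Tonelli); only used for nonnegative Borel integrands. *)
Fixpoint integral_rV (R : realType) (n : nat) :
    ('rV[R]_n -> \bar R) -> \bar R :=
  match n with
  | 0 => fun f => f 0
  | n'.+1 => fun f => (\int[@lebesgue_measure R]_x
      integral_rV (fun v : 'rV[R]_n' => f (row_mx (x%:M : 'rV[R]_1) v)))%E
  end.

Definition partial (R : realType) (d : nat) (i : 'I_d.+1)
    (f : 'rV[R]_d.+1 -> R) : 'rV[R]_d.+1 -> R :=
  fun x => 'D_(delta_mx 0 i) f x.

Fixpoint Ck (R : realType) (d k : nat) (f : 'rV[R]_d.+1 -> R) : Prop :=
  match k with
  | 0 => continuous f
  | k'.+1 => [/\ continuous f,
      forall i x, derivable f x (delta_mx 0 i) &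
      forall i, Ck k' (partial i f)]
  end.

Definition smooth (R : realType) (d : nat) (f : 'rV[R]_d.+1 -> R) : Prop :=
  forall k, Ck k f.

Definition boundary (V : topologicalType) (O : set V) : set V :=
  closure O `\` O°.

(* Near each boundary point, O is the sublevel set of a smooth function with
   non-vanishing gradient. *)
Definition smooth_boundary (R : realType) (d : nat)
    (O : set 'rV[R]_d.+1) : Prop :=
  forall p, boundary O p ->
    exists (U : set 'rV[R]_d.+1) (rho : 'rV[R]_d.+1 -> R),
      [/\ nbhs p U, smooth rho, exists i, partial i rho p != 0 &
          forall x, U x -> (O x <-> rho x < 0)].

Record smooth_bounded_domain (R : realType) (d : nat)
    (O : set 'rV[R]_d.+1) : Prop := {
  domain_open : open O ;
  domain_connected : connected O ;
  domain_compact_closure : compact (closure O) ;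
  domain_smooth_boundary : smooth_boundary O }.

(* Borel measurability is what makes "X(tau) is in D j" an event. *)
Record detectors (R : realType) (d J : nat) (O : set 'rV[R]_d.+1)
    (D : 'I_J -> set 'rV[R]_d.+1) : Prop := {
  detectors_boundary : forall j, D j `<=` boundary O ;
  detectors_connected : forall j, connected (D j) ;
  detectors_disjoint : trivIset [set: 'I_J] D ;
  detectors_borel : forall j, borel (D j) }.

Record probability_density (R : realType) (d : nat)
    (phi : 'rV[R]_d -> R) : Prop := {
  density_ge0 : forall x, 0 <= phi x ;
  density_borel : forall B, measurable B -> borel (phi @^-1` B) ;
  density_integral : integral_rV (fun x => (phi x)%:E) = 1%E }.

Definition admissible_source (R : realType) (d : nat) (O : set 'rV[R]_d.+1)
    (phi : 'rV[R]_d.+1 -> R) : Prop :=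
  probability_density phi /\
  exists (theta : 'rV[R]_d.+1) (beta : R),
    [/\ 0 < beta,
        forall x, phi x != 0 -> enorm (x - theta) <= beta,
        forall x y, enorm (x - theta) = enorm (y - theta) -> phi x = phi y &
        forall x, enorm (x - theta) <= beta -> O x].

Definition has_density (R : realType) (d : nat) (dT : measure_display)
    (T : measurableType dT) (P : probability T R) (Z : T -> 'rV[R]_d)
    (phi : 'rV[R]_d -> R) : Prop :=
  forall B, borel B ->
    P (Z @^-1` B) = integral_rV (fun x => (phi x * \1_B x)%:E).

(* sigma(Z t : t in I), where the state space carries the sigma-algebra G *)
Definition sigma_process (T K E : Type) (I : set K) (Z : K -> T -> E)
    (G : set (set E)) : set (set T) :=
  <<s \bigcup_(t in I) preimage_set_system setT (Z t) G >>.

Definition independent2 (R : realType) (dT : measure_display)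
    (T : measurableType dT) (P : probability T R) (F G : set (set T)) : Prop :=
  forall A B, F A -> G B -> P (A `&` B) = (P A * P B)%E.

(* Mutual independence: product rule over every finite subfamily. *)
Definition independent (R : realType) (dT : measure_display)
    (T : measurableType dT) (P : probability T R) (I : eqType)
    (F : I -> set (set T)) : Prop :=
  forall (s : seq I) (E : I -> set T), uniq s ->
    (forall i, i \in s -> F i (E i)) ->
    P (\bigcap_(i in [set` s]) E i) = (\prod_(i <- s) P (E i))%E.

Definition same_law (R : realType) (d : nat) (dT : measure_display)
    (T : measurableType dT) (P : probability T R)
    (Y Z : R -> T -> 'rV[R]_d) : Prop :=
  forall (k : nat) (t : 'I_k -> R) (B : 'I_k -> set 'rV[R]_d),
    (forall i, 0 <= t i) -> (forall i, borel (B i)) ->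
    P (\bigcap_i (Y (t i) @^-1` B i)) = P (\bigcap_i (Z (t i) @^-1` B i)).

Record brownian_motion1 (R : realType) (dT : measure_display)
    (T : measurableType dT) (P : probability T R) (B : R -> T -> R) : Prop := {
  bm_measurable : forall t, 0 <= t -> measurable_fun setT (B t) ;
  bm_continuous : forall w, {within `[0, +oo[, continuous (B ^~ w)} ;
  bm_start : {ae P, forall w, B 0 w = 0} ;
  bm_independent : forall (k : nat) (t : nat -> R), 0 <= t 0%N ->
    (forall i, t i <= t i.+1) ->
    independent P (fun i : 'I_k =>
      preimage_set_system setT (fun w => B (t i.+1) w - B (t i) w) measurable) ;
  (* [normal_prob] takes the mean and the standard deviation *)
  bm_normal : forall s t, 0 <= s -> s < t -> forall A, measurable A ->
    P [set w | A (B t w - B s w)] = normal_prob 0 (Num.sqrt (t - s)) A }.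

Definition brownian_motion (R : realType) (d : nat) (dT : measure_display)
    (T : measurableType dT) (P : probability T R)
    (B : R -> T -> 'rV[R]_d) : Prop :=
  (forall i, brownian_motion1 P (fun t w => B t w 0 i)) /\
  independent P (fun i : 'I_d =>
    sigma_process `[0, +oo[ (fun t w => B t w 0 i) measurable).

(* The path of X after its (random) starting time T0, on the clock t - T0. *)
Definition displaced (R : realType) (V T : Type) (T0 : T -> R)
    (X : R -> T -> V) : R -> T -> V :=
  fun t w => X (T0 w + t) w.

(* [X] is defined from the (possibly random) time [T0] on: the values [X t w]
   for [t < T0 w] are irrelevant.  The noise being additive, the SDE
     dX = b(X) dt + sqrt(2 eta) dW,   t > T0,
   is a pathwise integral equation and no stochastic integral is needed. *)
Definition ito_diffusion (R : realType) (d : nat) (dT : measure_display)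
    (T : measurableType dT) (P : probability T R)
    (b : 'rV[R]_d.+1 -> 'rV[R]_d.+1) (eta : R) (T0 : T -> R)
    (X : R -> T -> 'rV[R]_d.+1) : Prop :=
  [/\ forall t B, 0 <= t -> borel B -> measurable (displaced T0 X t @^-1` B),
      forall w, {within `[T0 w, +oo[, continuous (X ^~ w)} &
      exists W : R -> T -> 'rV[R]_d.+1,
      [/\ brownian_motion P (fun t w => W (T0 w + t) w - W (T0 w) w),
          independent2 P
            (preimage_set_system setT (displaced T0 X 0) (@borel R d.+1))
            (sigma_process `[0, +oo[
               (fun t w => W (T0 w + t) w - W (T0 w) w) (@borel R d.+1)) &
          {ae P, forall w, forall t, T0 w <= t -> forall i,
             X t w 0 i = X (T0 w) w 0 i
               + \int[@lebesgue_measure R]_(s in `[T0 w, t]) b (X s w) 0 i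
               + Num.sqrt (2 * eta) * (W t w 0 i - W (T0 w) w 0 i)}]].

(* inf {t > t0 : x(t) not in O}, equal to +oo when there is no exit *)
Definition exit_time (R : realType) (V : Type) (O : set V) (t0 : R)
    (x : R -> V) : \bar R :=
  ereal_inf [set t%:E | t in [set t : R | t0 < t /\ ~ O (x t)]].

(* sup_{x in O} E^x[tau] < oo.  E^x is the expectation for any diffusion started
   at x at time 0, on any probability space (they all have the same law). *)
Definition bounded_mean_exit_time (R : realType) (d : nat)
    (b : 'rV[R]_d.+1 -> 'rV[R]_d.+1) (eta : R) (O : set 'rV[R]_d.+1) : Prop :=
  exists C : R, forall (x : 'rV[R]_d.+1) (dT : measure_display)
    (T : measurableType dT) (P : probability T R) (X : R -> T -> 'rV[R]_d.+1),
    O x -> ito_diffusion P b eta (fun=> 0) X -> {ae P, forall w, X 0 w = x} ->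
    (\int[P]_w exit_time O 0 (X ^~ w) <= C%:E)%E.

(* P(X(tau) in D), for a particle started at time 0; X(tau) is only defined
   when tau < +oo. *)
Definition exit_probability (R : realType) (d : nat) (dT : measure_display)
    (T : measurableType dT) (P : probability T R) (O D : set 'rV[R]_d.+1)
    (X : R -> T -> 'rV[R]_d.+1) : R :=
  fine (P [set w | (exit_time O 0 (X ^~ w) < +oo)%E /\
                   D (X (fine (exit_time O 0 (X ^~ w))) w)]).

(* The second argument of [poisson_prob] is a dummy; [poisson_prob 0 _] is the
   Dirac mass at 0. *)
Definition poisson_law (R : realType) (r : R) (k : nat) : \bar R :=
  poisson_prob r 0 [set k].

Definition points_in (R : realType) (T : Type) (A : T -> set R) (B : set R) :
    T -> \bar R :=
  fun w => counting (A w `&` B).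

Record poisson_point_process (R : realType) (dT : measure_display)
    (T : measurableType dT) (P : probability T R) (A : T -> set R)
    (intensity : set R -> \bar R) : Prop := {
  ppp_measurable : forall B, measurable B ->
    measurable_fun setT (points_in A B) ;
  ppp_law : forall B, measurable B -> (intensity B < +oo)%E ->
    forall k : nat, P [set w | points_in A B w = k%:R%:E] =
      poisson_law (fine (intensity B)) k ;
  ppp_independent : forall (k : nat) (B : 'I_k -> set R),
    (forall i, measurable (B i)) -> trivIset [set: 'I_k] B ->
    independent P (fun i =>
      preimage_set_system setT (points_in A (B i)) measurable) }.

(* Index n stands for the particle numbered n+1.  "Independent of the birth
   process" means independent of the enumerated birth times (T_n)_n (the label
   n of a particle must carry no information on its path). *)
Record stochastic_fountain (R : realType) (d : nat) (dT : measure_display)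
    (T : measurableType dT) (P : probability T R) (lambda : R)
    (b : 'rV[R]_d.+1 -> 'rV[R]_d.+1) (eta : R) (phi : 'rV[R]_d.+1 -> R)
    (A : T -> set R) (birth : nat -> T -> R)
    (X : nat -> R -> T -> 'rV[R]_d.+1) : Prop := {
  fountain_births : poisson_point_process P A
    (fun B => (lambda%:E * @lebesgue_measure R B)%E) ;
  fountain_birth_measurable : forall n, measurable_fun setT (birth n) ;
  fountain_enumeration :
    {ae P, forall w, set_bij [set: nat] (A w) (birth ^~ w)} ;
  fountain_diffusion : forall n, ito_diffusion P b eta (birth n) (X n) ;
  fountain_initial : forall n, has_density P (displaced (birth n) (X n) 0) phi ;
  fountain_same_law : forall m n,
    same_law P (displaced (birth m) (X m)) (displaced (birth n) (X n)) ;
  fountain_independent : independent P (fun o : option nat =>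
    if o is Some n
    then sigma_process `[0, +oo[ (displaced (birth n) (X n)) (@borel R d.+1)
    else sigma_process [set: nat] birth measurable) }.

(* If [tau n] = +oo, [fine] returns 0 but the first indicator vanishes. *)
Definition exit_process (R : realType) (d : nat) (T : Type)
    (O D : set 'rV[R]_d.+1) (birth : nat -> T -> R)
    (X : nat -> R -> T -> 'rV[R]_d.+1) (t : R) (w : T) : \bar R :=
  (let tau n := exit_time O (birth n w) (X n ^~ w) in
   \sum_(0 <= n <oo)
     (\1_[set s : \bar R | (0 <= s <= t%:E)%E] (tau n)
      * \1_D (X n (fine (tau n)) w))%:E)%E.

Record poisson_process (R : realType) (dT : measure_display)
    (T : measurableType dT) (P : probability T R) (r : R)
    (N : R -> T -> \bar R) : Prop := {
  pp_measurable : forall t, 0 <= t -> measurable_fun setT (N t) ;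
  pp_start : {ae P, forall w, N 0 w = 0%E} ;
  pp_counting : {ae P, forall w, forall t, 0 <= t ->
    exists k : nat, N t w = k%:R%:E} ;
  pp_nondecreasing : {ae P, forall w, forall s t, 0 <= s -> s <= t ->
    (N s w <= N t w)%E} ;
  pp_right_continuous : {ae P, forall w, forall t, 0 <= t ->
    N s w @[s --> t^'+] --> N t w} ;
  pp_independent : forall (k : nat) (t : nat -> R), 0 <= t 0%N ->
    (forall i, t i <= t i.+1) ->
    independent P (fun i : 'I_k => preimage_set_system setT
      (fun w => N (t i.+1) w - N (t i) w)%E measurable) ;
  pp_law : forall s t, 0 <= s -> s <= t -> forall k : nat,
    P [set w | (N t w - N s w)%E = k%:R%:E] = poisson_law (r * (t - s)) k }.

(* Main.v *)
(* Attach to the n-th particle the mark s_n, the duration of its life in the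
   domain if it exits through the detector, and +oo otherwise.  The marks are
   i.i.d. and independent of the births.  Integrating them out of the Laplace
   functional of the Poisson process of births gives, for psi >= 0,
     E exp(- sum_n psi(T_n, s_n)) = exp(- lambda int (1 - E exp(- psi(t, s))) dt).
   For psi(t, s) = sum_i a_i 1_(W_i)(t + s) with disjoint windows W_i, translation
   invariance turns the integral into sum_i (1 - exp(- a_i)) p |W_i|, where
   p = P(s < +oo): the numbers of exits in the windows have the joint generating
   function of independent Poisson variables.
   That every s_n is distributed as the mark of a single particle started at time
   0 is weak uniqueness for the equation: the drift is locally Lipschitz, so the
   Euler schemes converge pathwise to the solution, which is therefore determined
   by its initial value and the dyadic increments of its noise, whose joint law
   is the same for the two particles. *)

Require Import Defs.
From HB Require Import structures.
From mathcomp Require Import all_boot all_order all_algebra.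
From mathcomp Require Import all_classical all_reals all_analysis.
From mathcomp Require Import measurable_realfun.
From mathcomp Require Import ring lra.

Set Implicit Arguments.
Unset Strict Implicit.
Unset Printing Implicit Defensive.

Import Order.TTheory GRing.Theory Num.Theory.
Import numFieldNormedType.Exports.

Local Open Scope classical_set_scope.
Local Open Scope ring_scope.

(** Nothing guarantees beforehand that the counts are finite. Hence everything is done with the
    bounded quantity exp(- a N), a > 0, which vanishes at N = +oo; almost sure finiteness then falls
    out of the Poisson weights summing to 1. Averaging the marks leaves a product of factors h(T_n),
    where h(t) is the mean of exp(- psi(t, s)). It is a Laplace functional of the births with
    exponent - ln h, which requires h > 0; this holds because psi is bounded. Infinite products are
    avoided by treating the first N particles and passing to the limit. The two particles compared
    at the end live on unrelated probability spaces. They are compared on the disjoint union of the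
    sample spaces: an event there states one property of both particles, and the events with equal
    probabilities on both sides form a Dynkin class. This is why measurability is relative to a
    collection of sets: the exit functional is shown measurable once, then used for the
    sigma-algebra of one particle (independence) and for that of the joined pair (equality of
    laws). *)

(* Measurability with respect to a plain collection of sets; [measurable_fun]
   would require [F] to be packed into the type of the domain. *)
Definition fmeas (T : Type) (F : set (set T)) d' (U : measurableType d')
  (f : T -> U) := forall B, measurable B -> F (f @^-1` B).

Lemma fmeas_comp (T : Type) (F : set (set T)) d1 (U : measurableType d1)
    d2 (V : measurableType d2) (f : T -> U) (g : U -> V) :
  fmeas F f -> measurable_fun setT g -> fmeas F (g \o f).
Proof.
move=> mf mg B mB; rewrite comp_preimage; apply: mf.
by rewrite -[_ @^-1` _]setTI; exact: mg.
Qed.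

Lemma fmeas_sub (T : Type) (F G : set (set T)) d1 (U : measurableType d1)
    (f : T -> U) : F `<=` G -> fmeas F f -> fmeas G f.
Proof. by move=> FG mf B mB; exact/FG/mf. Qed.

Lemma fmeasP (T : pointedType) (F : set (set T)) d1 (U : measurableType d1)
    (f : T -> U) : sigma_algebra setT F ->
  fmeas F f <-> measurable_fun (setT : set (g_sigma_algebraType F)) f.
Proof.
move=> sF; split=> [mf _ B mB|mf B mB].
  by rewrite setTI; apply: sub_sigma_algebra; exact: mf.
have : <<s F >> (f @^-1` B).
  by rewrite -[_ @^-1` _]setTI; apply: mf.
by rewrite sigma_algebra_id.
Qed.

Lemma fmeas_measurable d (T : measurableType d) d1 (U : measurableType d1)
    (f : T -> U) : fmeas measurable f <-> measurable_fun setT f.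
Proof.
split=> [mf _ B mB|mf B mB]; first by rewrite setTI; exact: mf.
by rewrite -[_ @^-1` _]setTI; apply: mf.
Qed.

Lemma fmeasW d (T : measurableType d) (F : set (set T)) d1
    (U : measurableType d1) (f : T -> U) :
  F `<=` measurable -> fmeas F f -> measurable_fun setT f.
Proof. by move=> Fm mf; apply/fmeas_measurable; exact: fmeas_sub mf. Qed.

Lemma fmeas_pair (T : pointedType) (F : set (set T)) d1 (U : measurableType d1)
    d2 (V : measurableType d2) (f : T -> U) (g : T -> V) :
  sigma_algebra setT F -> fmeas F f -> fmeas F g ->
  fmeas F (fun x => (f x, g x)).
Proof.
move=> sF /(fmeasP _ sF) mf /(fmeasP _ sF) mg; apply/(fmeasP _ sF).
exact: measurable_fun_pair.
Qed.

(** * Closure properties of a sigma-algebra given as a collection of sets *)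

Section sigma_algebra_lemmas.
Context (T : Type) (F : set (set T)).
Hypothesis sF : sigma_algebra setT F.

Lemma sigma_algebra_setC A : F A -> F (~` A).
Proof. by move=> FA; rewrite -setTD; case: sF => _ + _; apply. Qed.

Lemma sigma_algebra_setT : F setT.
Proof. by rewrite -setC0; apply: sigma_algebra_setC; case: sF. Qed.

Lemma sigma_algebra_bigcupT (A : nat -> set T) :
  (forall n, F (A n)) -> F (\bigcup_n A n).
Proof. by case: sF => _ _; apply. Qed.

Lemma sigma_algebra_bigcapT (A : nat -> set T) :
  (forall n, F (A n)) -> F (\bigcap_n A n).
Proof.
move=> FA; rewrite -[X in F X]setCK setC_bigcap.
by apply/sigma_algebra_setC/sigma_algebra_bigcupT => n; exact: sigma_algebra_setC.
Qed.

Lemma sigma_algebra_setI : setI_closed F.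
Proof.
have sub (X : set T) : F X -> X `<=` setT by [].
by have /(sigma_algebraP sub)[] := sF.
Qed.

Lemma sigma_algebra_setU A B : F A -> F B -> F (A `|` B).
Proof.
move=> FA FB; rewrite -[X in F X]setCK setCU.
by apply/sigma_algebra_setC/sigma_algebra_setI; exact: sigma_algebra_setC.
Qed.

Lemma sigma_algebra_bigcup_cond (D : set nat) (A : nat -> set T) :
  (forall n, D n -> F (A n)) -> F (\bigcup_(n in D) A n).
Proof.
move=> FA; rewrite bigcup_mkcond; apply: sigma_algebra_bigcupT => n.
by case: ifPn => [/set_mem/FA//|_]; case: sF.
Qed.

Lemma sigma_algebra_bigcap_cond (D : set nat) (A : nat -> set T) :
  (forall n, D n -> F (A n)) -> F (\bigcap_(n in D) A n).
Proof.
move=> FA; rewrite -[X in F X]setCK setC_bigcap; apply: sigma_algebra_setC.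
by apply: sigma_algebra_bigcup_cond => n /FA; exact: sigma_algebra_setC.
Qed.

End sigma_algebra_lemmas.

(** * Integrals against a probability measure *)

Lemma integral_prob_cst (R : realType) d (T : measurableType d)
    (P : probability T R) (c : \bar R) : (\int[P]_w c = c)%E.
Proof.
rewrite [LHS](integral_cst P measurableT c) -[RHS]mule1; congr *%E.
exact: probability_setT.
Qed.

Lemma measurable_comp_pair d (X : measurableType d) d1 (U : measurableType d1)
    d2 (V : measurableType d2) d3 (Z : measurableType d3) (g : U * V -> Z)
    (f1 : X -> U) (f2 : X -> V) :
  measurable_fun setT g -> measurable_fun setT f1 -> measurable_fun setT f2 ->
  measurable_fun setT (fun x => g (f1 x, f2 x)).
Proof.
by move=> mg m1 m2; exact: measurableT_comp mg (measurable_fun_pair m1 m2).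
Qed.

Section integrals.
Context (R : realType) (dT : measure_display) (T : measurableType dT)
  (P : probability T R).
Local Open Scope ereal_scope.

Lemma ae_eq_integral_fun (f g : T -> \bar R) :
  measurable_fun setT f -> measurable_fun setT g ->
  {ae P, forall w, f w = g w} -> \int[P]_w f w = \int[P]_w g w.
Proof.
by move=> mf mg fg; apply: ae_eq_integral => //; apply: filterS fg.
Qed.

Lemma ae_eq_measure (B C : set T) : measurable B -> measurable C ->
  {ae P, forall w, B w <-> C w} -> P B = P C.
Proof.
move=> mB mC BC.
rewrite -(setIT B) -(setIT C) -!integral_indic//.
apply: ae_eq_integral_fun.
- by apply/measurable_EFinP; exact: measurable_indic.
- by apply/measurable_EFinP; exact: measurable_indic.
apply: filterS BC => w BC; rewrite !indicE; congr (_%:R%:E); congr nat_of_bool.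
by apply/idP/idP => /set_mem/BC/mem_set.
Qed.

Lemma integral01 (f : T -> R) : measurable_fun setT f ->
  (forall w, (0 <= f w <= 1)%R) -> 0 <= \int[P]_w (f w)%:E <= 1.
Proof.
move=> mf f01; apply/andP; split.
  by apply: integral_ge0 => w _; rewrite lee_fin; have /andP[] := f01 w.
apply: (@le_trans _ _ (\int[P]_w 1)).
  apply: ge0_le_integral => //.
  - by move=> w _; rewrite lee_fin; have /andP[] := f01 w.
  - exact/measurable_EFinP.
  - by move=> w _; rewrite lee_fin; have /andP[] := f01 w.
by rewrite integral_prob_cst.
Qed.

End integrals.

(** * Independence and product formulas for expectations *)

Section independence.
Context (R : realType) (dT : measure_display) (T : measurableType dT)
  (P : probability T R).
Local Open Scope ereal_scope.

(** Both sides are finite measures in [A], a restriction and a multiple of [P]; agreeing on the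
    pi-system [G], they agree on the sigma-algebra it generates. *)
Lemma independent2_generated (G : set (set T)) (B : set T) :
  G setT -> setI_closed G -> G `<=` measurable -> measurable B ->
  (forall A, G A -> P (A `&` B) = P A * P B) ->
  forall A, <<s G >> A -> P (A `&` B) = P A * P B.
Proof.
move=> GT GI Gm mB GB A GA.
have PBfin : P B \is a fin_num by exact: fin_num_measure.
have PB0 : (0 <= fine (P B))%R by exact: fine_ge0.
pose m1 := mrestr P mB.
pose m2 := mscale (NngNum PB0) P.
have : m1 A = m2 A.
  apply: (g_sigma_algebra_measure_unique G Gm (fun=> setT)) => //.
  - by rewrite bigcup_const.
  - by move=> C GC; rewrite /m1 /m2 /= /mrestr GB// /mscale/= fineK// muleC.
  - by move=> _; rewrite /m1/= /mrestr setTI ltey_eq PBfin.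
by rewrite /m1 /m2/= /mrestr /mscale/= fineK// muleC.
Qed.

(** The finite intersections of events of the [F j] form a pi-system that generates the grouped
    sigma-algebra, and mutual independence gives the product rule on it. *)
Lemma independent_grouping (I : eqType) (F : I -> set (set T)) (s : seq I)
    (i : I) :
  independent P F -> (forall j, F j `<=` measurable) ->
  (forall j, F j setT) -> (forall j, setI_closed (F j)) ->
  uniq s -> i \notin s ->
  independent2 P <<s \bigcup_(j in [set` s]) F j >> (F i).
Proof.
move=> indF Fm FT FI us nis.
pose G := [set A | exists2 E : I -> set T, (forall j, j \in s -> F j (E j)) &
  A = \bigcap_(j in [set` s]) E j].
have GE : <<s \bigcup_(j in [set` s]) F j >> `<=` <<s G >>.
  apply: sub_sigma_algebra2 => A [j /= js FjA].
  exists (fun k => if k == j then A else setT).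
    by move=> k _; case: eqP => [->|].
  apply/seteqP; split=> [x Ax k /= _|x /(_ j js)]; last by rewrite eqxx.
  by case: ifP.
move=> A B sA FB; apply: (@independent2_generated G); last exact: GE.
- exists (fun=> setT) => //; apply/seteqP; split=> //.
- move=> C D [E1 FE1 ->] [E2 FE2 ->]; exists (fun j => E1 j `&` E2 j).
    by move=> j js; apply: FI; [exact: FE1|exact: FE2].
  by rewrite bigcapI.
- move=> C [E FE ->]; apply: fin_bigcap_measurable => // j /= js.
  exact/Fm/FE.
- exact/Fm/FB.
- move=> C [E FE ->].
  pose E' j := if j == i then B else E j.
  have E'E j : j \in s -> E' j = E j.
    by move=> js; rewrite /E'; case: eqP => // ji; rewrite -ji js in nis.
  have FE' j : j \in i :: s -> F j (E' j).
    rewrite inE /E'; case: eqP => [-> //|_ /= js]; exact: FE.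
  have := indF (i :: s) E' _ FE'; rewrite /= nis us => /(_ erefl).
  rewrite big_cons {2}/E' eqxx.
  have -> : \bigcap_(i0 in [set` i :: s]) E' i0 =
      \bigcap_(j in [set` s]) E j `&` B.
    apply/seteqP; split=> [x /= Ex|x [Ex Bx] j /=].
      split=> [j /= js|]; first by rewrite -E'E//; apply: Ex; rewrite /= inE js orbT.
      by have := Ex i; rewrite /E' eqxx /= inE eqxx; exact.
    by rewrite inE => /predU1P[->|js]; [rewrite /E' eqxx|rewrite E'E//; exact: Ex].
  move=> ->; rewrite muleC; congr (_ * _).
  rewrite (indF s E)//; rewrite big_seq [RHS]big_seq.
  by apply: eq_bigr => j js; rewrite E'E.
Qed.

(** Independence says that the joint law of [f] and [g] is the product of their laws; the rest is
    Tonelli. *)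
Lemma integral_independent2 (F G : set (set T)) d1 (U : measurableType d1)
    d2 (V : measurableType d2) (f : T -> U) (g : T -> V)
    (h : U * V -> \bar R) :
  F `<=` measurable -> G `<=` measurable ->
  independent2 P F G -> fmeas F f -> fmeas G g ->
  measurable_fun setT h -> (forall x, 0 <= h x) ->
  \int[P]_w h (f w, g w) = \int[P]_w \int[P]_v h (f w, g v).
Proof.
move=> Fm Gm ind mf mg mh h0.
have mf' : measurable_fun setT f := fmeasW Fm mf.
have mg' : measurable_fun setT g := fmeasW Gm mg.
pose X : {mfun T >-> U} := HB.pack f (isMeasurableFun.Build _ _ _ _ _ mf').
pose Y : {mfun T >-> V} := HB.pack g (isMeasurableFun.Build _ _ _ _ _ mg').
pose XY : {mfun T >-> (U * V)%type} := HB.pack (fun w => (f w, g w))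
  (isMeasurableFun.Build _ _ _ _ _ (measurable_fun_pair mf' mg')).
have XYE A : measurable A ->
    (distribution P X \x distribution P Y) A = distribution P XY A.
  apply: product_measure_unique => B C mB mC.
  rewrite /distribution /pushforward/=.
  rewrite -(ind _ _ (mf _ mB) (mg _ mC)); congr (P _).
transitivity (\int[distribution P XY]_z h z).
  by rewrite ge0_integral_distribution.
transitivity (\int[distribution P X \x distribution P Y]_z h z).
  by apply: eq_measure_integral => A mA _; exact/esym/XYE.
rewrite fubini_tonelli1//.
rewrite (@ge0_integral_distribution _ _ _ _ _ P X (fubini_F (distribution P Y) h)).
- apply: eq_integral => w _ /=; rewrite /fubini_F/=.
  rewrite (@ge0_integral_distribution _ _ _ _ _ P Y (fun v => h (f w, v)))//.
  exact: measurableT_comp mh (pair1_measurable _).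
- exact: measurable_fun_fubini_tonelli_F.
- by move=> y; apply: integral_ge0.
Qed.

Lemma integral_prod_independent (I : eqType) (F : I -> set (set T)) (s : seq I)
    (f : I -> T -> R) :
  independent P F -> (forall j, F j `<=` measurable) ->
  (forall j, sigma_algebra setT (F j)) -> uniq s ->
  (forall j, j \in s -> fmeas (F j) (f j)) -> (forall j x, 0 <= f j x)%R ->
  \int[P]_w (\prod_(j <- s) f j w)%:E = \prod_(j <- s) \int[P]_w (f j w)%:E.
Proof.
move=> ind Fm sF.
elim: s => [|i s IH] us mf f0.
  rewrite big_nil; under eq_integral do rewrite big_nil.
  by rewrite integral_prob_cst.
have /andP[nis us'] : (i \notin s) && uniq s by [].
have mf' j : j \in s -> fmeas (F j) (f j).
  by move=> js; apply: mf; rewrite inE js orbT.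
rewrite big_cons -(IH us' mf' f0).
have ind2 := independent_grouping ind Fm
  (fun j => sigma_algebra_setT (sF j)) (fun j => sigma_algebra_setI (sF j)) us' nis.
pose G := <<s \bigcup_(j in [set` s]) F j >>.
have sG : sigma_algebra setT G by exact: smallest_sigma_algebra.
have Gm : G `<=` measurable.
  apply: smallest_sub; first exact: sigma_algebra_measurable.
  by move=> A [j _]; exact: Fm.
have mg : fmeas G (fun w => (\prod_(j <- s) f j w)%R).
  apply/(fmeasP _ sG); apply: measurable_prod => j js; apply/(fmeasP _ sG).
  move=> B mB; apply: sub_sigma_algebra; exists j => //; exact: mf'.
have mi : fmeas (F i) (f i) by apply: mf; rewrite inE eqxx.
have p0 w : (0 <= \prod_(j <- s) f j w)%R by exact: prodr_ge0.
(* The integrand passed to [integral_independent2] has to be nonnegative on the whole plane; the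
   absolute value changes nothing at the values taken. *)
transitivity (\int[P]_w (`|(\prod_(j <- s) f j w) * f i w|%:E)).
  by apply: eq_integral => w _; rewrite big_cons mulrC ger0_norm// mulr_ge0.
rewrite (@integral_independent2 _ _ _ _ _ _ _ _
  (fun z : R * R => (`|z.1 * z.2|%R)%:E) Gm (Fm i) ind2 mg mi)//; last first.
  by apply/measurable_EFinP; apply: measurableT_comp => //;
    apply: measurable_funM => //.
under eq_integral => w _.
  under eq_integral => v _ do rewrite /= ger0_norm ?mulr_ge0// EFinM.
  rewrite ge0_integralZl//; last 3 first.
  - exact/measurable_EFinP/(fmeasW (Fm i) mi).
  - by move=> v _; rewrite lee_fin.
  - by rewrite lee_fin.
  over.
rewrite ge0_integralZr//.
- by rewrite muleC.
- exact/measurable_EFinP/(fmeasW Gm mg).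
- by move=> v _; rewrite lee_fin.
- by apply: integral_ge0 => v _; rewrite lee_fin.
Qed.

End independence.

(** * Laplace functional of a Poisson process *)

Section poisson_series.
Context (R : realType).
Local Open Scope ereal_scope.

(** The rate 0 is a separate case, the law being a Dirac mass there; the formula persists because 0
    to the power 0 is 1. *)
Lemma poisson_lawE (r : R) (k : nat) : (0 <= r)%R ->
  poisson_law r k = (r ^+ k * k`!%:R^-1 * expR (- r))%:E.
Proof.
rewrite le_eqVlt => /predU1P[<-|r0].
  rewrite /poisson_law /poisson_prob ltxx oppr0 expR0 mulr1 diracE expr0n.
  case: k => [|k] /=; first by rewrite mem_set// fact0 invr1 mulr1.
  by rewrite mul0r memNset.
by rewrite /poisson_law /poisson_prob r0 esum_set1 ?lee_fin ?poisson_pmf_ge0//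
  /poisson_pmf r0.
Qed.

Lemma poisson_law_ge0 (r : R) (k : nat) : 0 <= poisson_law r k.
Proof. exact: measure_ge0. Qed.

Lemma poisson_law_pgf (r z : R) : (0 <= r)%R -> (0 <= z)%R ->
  \sum_(k <oo) (z ^+ k)%:E * poisson_law r k = (expR (- (r * (1 - z))))%:E.
Proof.
move=> r0 z0.
have -> : expR (- (r * (1 - z))) = (expR (- r) * expR (r * z))%R.
  by rewrite -expRD; congr expR; ring.
under eq_eseriesr => k _.
  rewrite poisson_lawE// -EFinM (_ : z ^+ k * _ = expR (- r) * ((r * z) ^+ k / k`!%:R))%R; last first.
    by rewrite exprMn; ring.
  rewrite EFinM; over.
rewrite nneseriesZl/=; last first.
  by move=> n _; rewrite lee_fin divr_ge0// exprn_ge0// mulr_ge0.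
rewrite EFinM; congr *%E; rewrite expRE -EFin_lim; last first.
  rewrite /pseries/=; under eq_fun do rewrite mulrC.
  exact: is_cvg_series_exp_coeff.
apply/congr_lim/funext => n/=; rewrite /pseries/= /series/= -sumEFin//.
by under eq_bigr do rewrite mulrC.
Qed.

Lemma poisson_law_sum (r : R) : (0 <= r)%R ->
  \sum_(k <oo) poisson_law r k = 1.
Proof.
move=> r0; have := poisson_law_pgf r0 (@ler01 R).
rewrite subrr mulr0 oppr0 expR0 => <-.
by apply: eq_eseriesr => k _; rewrite expr1n mul1e.
Qed.

(** The remainder estimate behind the comparison of coefficients: the tail from rank [n] is of order
    [z ^+ n] as z tends to 0. *)
Lemma nneseries_pow_le (a : nat -> \bar R) (C z : R) (n : nat) :
  (forall k, 0 <= a k) -> (0 <= z <= 1)%R -> \sum_(k <oo) a k <= C%:E ->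
  \sum_(n <= k <oo) (z ^+ k)%:E * a k <= (z ^+ n * C)%:E.
Proof.
move=> a0 /andP[z0 z1] aC.
apply: (@le_trans _ _ (\sum_(n <= k <oo) (z ^+ n)%:E * a k)).
  rewrite [leLHS]eseries_cond [leRHS]eseries_cond.
  apply: lee_nneseries => [k _ _|k /andP[_ nk]].
    by rewrite mule_ge0// lee_fin exprn_ge0.
  by rewrite lee_pmul// ?lee_fin ?exprn_ge0// ler_wiXn2l.
rewrite nneseriesZl//= EFinM lee_wpmul2l// ?lee_fin ?exprn_ge0//.
apply: le_trans aC; rewrite [leRHS](nneseries_split 0 n)//.
by rewrite add0n leeDr// sume_ge0.
Qed.

(** Cancel the common terms below [n], divide by [z ^+ n] and let z tend to 0: what is left beyond
    rank [n] is at most [z * C]. Only z in ]0, 1[ matters, which is what z = exp(- a) with a > 0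
    provides. *)
Lemma pgf_coef_le (a b : nat -> \bar R) (C : R) (n : nat) :
  (forall k, 0 <= a k) -> (forall k, 0 <= b k) ->
  \sum_(k <oo) a k <= C%:E -> \sum_(k <oo) b k <= C%:E ->
  (forall z : R, (0 < z < 1)%R -> \sum_(k <oo) (z ^+ k)%:E * a k =
                      \sum_(k <oo) (z ^+ k)%:E * b k) ->
  (forall k, (k < n)%N -> a k = b k) -> a n <= b n.
Proof.
move=> a0 b0 aC bC ab abn.
have fin (c : nat -> \bar R) k : (forall k, 0 <= c k) ->
    \sum_(k <oo) c k <= C%:E -> c k \is a fin_num.
  move=> c0 cC; rewrite ge0_fin_numE//; apply: le_lt_trans (ltry C).
  apply: le_trans cC; rewrite (nneseries_split 0 k)//.
  rewrite add0n (nneseries_split k 1)//= addn1 big_nat1.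
  rewrite addeCA leeDl// adde_ge0 ?sume_ge0//; exact: nneseries_ge0.
have C0 : (0 <= C)%R.
  by rewrite -lee_fin; apply: le_trans aC; exact: nneseries_ge0.
apply/lee_addgt0Pr => e e0.
(* Small enough for [z * C <= e]; the bound 1/2 keeps z below 1, and [C + 1] avoids a division by
   0. *)
pose z := Num.min (2^-1)%R (e / (C + 1))%R.
have C1 : (0 < C + 1)%R by rewrite ltr_wpDl.
have z0 : (0 < z)%R by rewrite lt_min invr_gt0 ltr0n/= divr_gt0.
have z1 : (z < 1)%R by rewrite gt_min invf_lt1// ltr1n.
have ze : (z * C <= e)%R.
  apply: (@le_trans _ _ (e / (C + 1) * C)%R).
    by rewrite ler_wpM2r// ge_min lexx orbT.
  by rewrite mulrAC ler_pdivrMr// ler_pM2l// lerDl.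
have := ab z; rewrite z0 z1 => /(_ isT).
have zk k : (0 <= z ^+ k)%R by rewrite exprn_ge0// ltW.
have za k : 0 <= (z ^+ k)%:E * a k by rewrite mule_ge0// lee_fin.
have zb k : 0 <= (z ^+ k)%:E * b k by rewrite mule_ge0// lee_fin.
rewrite (nneseries_split 0 n)// [RHS](nneseries_split 0 n)// add0n.
rewrite (nneseries_split n 1)// [X in _ = _ + X](nneseries_split n 1)//.
rewrite addn1 !big_nat1.
have -> : \sum_(0 <= k < n) (z ^+ k)%:E * a k = \sum_(0 <= k < n) (z ^+ k)%:E * b k.
  by apply: eq_big_nat => k /andP[_ kn]; rewrite abn.
have Sfin : \sum_(0 <= k < n) (z ^+ k)%:E * b k \is a fin_num.
  by rewrite sum_fin_num; apply/allP => x /mapP[k _ ->] /=; rewrite fin_numM// fin.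
move=> /(congr1 (fun x => x - \sum_(0 <= k < n) (z ^+ k)%:E * b k)).
rewrite ![\sum_(_ <= _ < _) _ + _]addeC !addeK// => E.
have : (z ^+ n)%:E * a n <= (z ^+ n)%:E * b n + (z ^+ n.+1 * C)%:E.
  apply: (@le_trans _ _ ((z ^+ n)%:E * a n + \sum_(n.+1 <= k <oo) (z ^+ k)%:E * a k)).
    by rewrite leeDl// nneseries_ge0.
  rewrite E leeD2l// nneseries_pow_le// (ltW z0) ltW//.
have -> : a n = (fine (a n))%:E by rewrite fineK// fin.
have -> : b n = (fine (b n))%:E by rewrite fineK// fin.
rewrite -!EFinM -!EFinD !lee_fin exprSr -mulrA -mulrDr ler_pM2l ?exprn_gt0//.
by move=> /le_trans; apply; rewrite lerD2l.
Qed.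

Lemma pgf_coef_eq (a b : nat -> \bar R) (C : R) :
  (forall k, 0 <= a k) -> (forall k, 0 <= b k) ->
  \sum_(k <oo) a k <= C%:E -> \sum_(k <oo) b k <= C%:E ->
  (forall z : R, (0 < z < 1)%R -> \sum_(k <oo) (z ^+ k)%:E * a k =
                      \sum_(k <oo) (z ^+ k)%:E * b k) ->
  forall n, a n = b n.
Proof.
move=> a0 b0 aC bC ab n; have [m] := ubnP n; elim: m n => // m IH n.
rewrite ltnS => nm; apply/eqP; rewrite eq_le; apply/andP; split.
  apply: (@pgf_coef_le a b C) => // k kn; apply: IH; exact: leq_trans nm.
apply: (@pgf_coef_le b a C) => // [z z01|k kn]; first by rewrite ab.
by apply/esym/IH; exact: leq_trans nm.
Qed.

End poisson_series.

(** * The function exp(- x) on the extended half-line *)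

Section expN_theory.
Context (R : realType).
Local Open Scope ereal_scope.

(* [exp (- x)], with [exp (- +oo) = 0]; only used for [0 <= x]. *)
Definition expN (x : \bar R) : R := fine (er_map expR (- x)).

Lemma measurable_expN : measurable_fun [set: \bar R] expN.
Proof.
apply: measurableT_comp => //; apply: measurableT_comp => //.
apply: (@measurable_er_map _ (measurableTypeR R)); exact: measurable_expR.
Qed.

Lemma expNr (r : R) : expN r%:E = expR (- r). Proof. by []. Qed.

Lemma expNy : expN +oo = 0%R. Proof. by []. Qed.

Lemma expN_ge0 x : (0 <= expN x)%R.
Proof. by case: x => [r||]//=; rewrite expNr expR_ge0. Qed.

Lemma expN_le1 x : 0 <= x -> (expN x <= 1)%R.
Proof. by case: x => [r||]//= r0; rewrite expNr -expR0 ler_expR oppr_le0. Qed.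

Lemma expN0 : expN 0 = 1%R. Proof. by rewrite expNr oppr0 expR0. Qed.

Lemma expND x y : 0 <= x -> 0 <= y -> expN (x + y) = (expN x * expN y)%R.
Proof.
case: x y => [x||] [y||]//= _ _; rewrite ?expNy ?mul0r ?mulr0//.
by rewrite -EFinD !expNr opprD expRD.
Qed.

Lemma expN_sum (I : Type) (s : seq I) (f : I -> \bar R) :
  (forall i, 0 <= f i) ->
  expN (\sum_(i <- s) f i) = (\prod_(i <- s) expN (f i))%R.
Proof.
move=> f0; elim: s => [|i s IH]; first by rewrite !big_nil expN0.
by rewrite !big_cons expND ?IH// sume_ge0.
Qed.

Lemma cvg_expN (u : nat -> \bar R) (l : \bar R) :
  (forall n, 0 <= u n) -> u @ \oo --> l -> expN (u n) @[n --> \oo] --> expN l.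
Proof.
move=> u0; case: l => [r| |] ul.
- rewrite expNr.
  have fu : fine (u n) @[n --> \oo] --> r by exact: fine_cvg.
  have : expR (- fine (u n)) @[n --> \oo] --> expR (- r).
    apply: (@cvg_comp _ _ _ (fun n => - fine (u n))%R expR); last exact: continuous_expR.
    exact: cvgN.
  apply: cvg_trans; apply: near_eq_cvg; near=> n.
  have : u n \is a fin_num.
    near: n; have [] := (fine_cvgP _ _).1 ul => //.
  by case: (u n) => [x||].
- rewrite expNy; apply/cvgrPdist_lt => e e0; near=> n.
  rewrite sub0r normrN ger0_norm ?expN_ge0//.
  (* The threshold beyond which exp(- x) is at most [e / 2]. *)
  have : (- ln (e / 2))%:E <= u n by near: n; exact: cvgey_ge.
  have e2 : (0 < e / 2)%R by rewrite divr_gt0.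
  case: (u n) (u0 n) => [x||]//= _; rewrite ?expNy// expNr lee_fin lerNl => xe.
  apply: (@le_lt_trans _ _ (expR (ln (e / 2)))); first by rewrite ler_expR.
  by rewrite lnK// ltr_pdivrMr// ltr_pMr// ltr1n.
- have /cvgeNyPle/(_ (-1)%R)[N _ /(_ N)] := ul.
  by rewrite /= leqnn => /(_ isT) /(le_trans (u0 N)); rewrite lee_fin ler0N1.
Unshelve. all: by end_near. Qed.

End expN_theory.

(** * Integer-valued counts, possibly infinite *)

Section counts.
Context (R : realType).
Local Open Scope ereal_scope.

Definition is_count (x : \bar R) := x = +oo \/ exists k : nat, x = k%:R%:E.

Lemma is_count_counting (T : choiceType) (E : set T) :
  is_count (counting E).
Proof.
by rewrite /counting; case: ifPn => _; [right; eexists|left].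
Qed.

Lemma nneseries_indic (E : set nat) :
  \sum_(n <oo) (\1_E n : R)%:E = counting E.
Proof. by rewrite counting_dirac. Qed.

Lemma counting_image (T U : choiceType) (f : T -> U) (E : set T) :
  set_inj E f -> counting (f @` E) = counting E :> \bar R.
Proof.
move=> fi; rewrite /counting.
have fE : (f @` E #= E)%card by apply: inj_card_eq.
rewrite (eq_finite_set fE); case: ifPn => // /asboolP fin; congr (_%:R%:E).
by apply/(fcard_eq _ fin) => //; exact: finite_image.
Qed.

End counts.

Section count_variables.
Context (R : realType) (dT : measure_display) (T : measurableType dT)
  (P : probability T R).
Local Open Scope ereal_scope.

Lemma nneseries_single (f : nat -> \bar R) (k : nat) :
  (forall j, j != k -> f j = 0) -> 0 <= f k -> \sum_(j <oo) f j = f k.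
Proof.
move=> f0 fk; rewrite (nneseriesD1 (n := k))//; last first.
  by move=> j _; have [->|/f0->] := eqVneq j k.
by rewrite eseries0 ?adde0// => j _ jk; exact: f0.
Qed.

Variables (Y : T -> R) (N : T -> \bar R).
Hypotheses (mY : measurable_fun setT Y) (Y0 : forall w, (0 <= Y w)%R)
  (Y1 : forall w, (Y w <= 1)%R).
Hypotheses (mN : measurable_fun setT N) (NC : forall w, is_count (N w)).

Let level (k : nat) := N @^-1` [set k%:R%:E].

Let mlevel k : measurable (level k).
Proof. by rewrite -[level k]setTI; apply: mN. Qed.

Let mYl k : measurable_fun setT (fun w => (Y w * \1_(level k) w)%:E).
Proof.
by apply/measurable_EFinP; apply: measurable_funM => //; exact: measurable_indic.
Qed.

Let levelE k w j : N w = k%:R%:E -> \1_(level j) w = (j == k)%:R :> R.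
Proof.
move=> Nk; rewrite indicE; congr (_%:R); congr nat_of_bool.
apply/idP/eqP => [/set_mem|->]; last exact/mem_set.
by rewrite /level /= Nk => -[] /eqP; rewrite eqr_nat => /eqP.
Qed.

Let levely w j : N w = +oo -> \1_(level j) w = 0%R :> R.
Proof. by move=> Ny; rewrite indicE memNset// /level /= Ny. Qed.

(** The weight [Y] will carry the factors of the other coordinates. The event [N = +oo] contributes
    nothing to either side because a > 0. *)
Lemma integral_expN_count (a : R) : (0 < a)%R ->
  \int[P]_w (Y w * expN (a%:E * N w))%:E =
  \sum_(k <oo) (expR (- a) ^+ k)%:E * \int[P]_w (Y w * \1_(level k) w)%:E.
Proof.
move=> a0.
under eq_eseriesr => k _.
  rewrite -ge0_integralZl_EFin//; last first.
    by move=> w _; rewrite lee_fin mulr_ge0.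
  over.
rewrite -integral_nneseries//; last 2 first.
- by move=> k; apply: measurable_funeM.
- by move=> k w _; rewrite mule_ge0// lee_fin ?exprn_ge0 ?expR_ge0// mulr_ge0.
apply: eq_integral => w _; have [Ny|[k Nk]] := NC w.
  rewrite Ny gt0_muley ?lte_fin// expNy mulr0 eseries0// => j _ _.
  by rewrite levely// mulr0 mule0.
rewrite Nk -EFinM expNr (nneseries_single (k := k)).
- by rewrite (levelE _ Nk) eqxx mulr1 -EFinM mulrC -expRM_natr mulNr.
- by move=> j jk; rewrite (levelE _ Nk) (negbTE jk) mulr0 mule0.
- by rewrite mule_ge0// lee_fin ?exprn_ge0 ?expR_ge0// mulr_ge0.
Qed.

Lemma sum_level : \sum_(k <oo) \int[P]_w (Y w * \1_(level k) w)%:E <= 1.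
Proof.
rewrite -integral_nneseries//; last by move=> k w _; rewrite lee_fin mulr_ge0.
apply: (@le_trans _ _ (\int[P]_w 1)).
  apply: ge0_le_integral => //.
  - by move=> w _; apply: nneseries_ge0 => k _ _; rewrite lee_fin mulr_ge0.
  - by apply: ge0_emeasurable_sum => // k w _ _; rewrite lee_fin mulr_ge0.
  move=> w _; have [Ny|[k Nk]] := NC w.
    by rewrite eseries0// => j _ _; rewrite levely// mulr0.
  rewrite (nneseries_single (k := k)).
  - by rewrite (levelE _ Nk) eqxx mulr1 lee_fin.
  - by move=> j jk; rewrite (levelE _ Nk) (negbTE jk) mulr0.
  - by rewrite lee_fin mulr_ge0.
by rewrite integral_prob_cst.
Qed.

(** As [a] runs through the positive reals, exp(- a) runs through ]0, 1[, so the hypothesis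
    identifies two generating functions and hence their coefficients. *)
Lemma integral_level_poisson (c m : R) : (0 <= c <= 1)%R -> (0 <= m)%R ->
  (forall a, (0 < a)%R -> \int[P]_w (Y w * expN (a%:E * N w))%:E =
                   c%:E * (expR (- (m * (1 - expR (- a)))))%:E) ->
  forall k, \int[P]_w (Y w * \1_(level k) w)%:E = c%:E * poisson_law m k.
Proof.
move=> /andP[c0 c1] m0 H; apply: (@pgf_coef_eq _ _ _ 1%R).
- by move=> k; apply: integral_ge0 => w _; rewrite lee_fin mulr_ge0.
- by move=> k; rewrite mule_ge0// poisson_law_ge0.
- exact: sum_level.
- rewrite nneseriesZl; last by move=> *; rewrite poisson_law_ge0.
  by rewrite poisson_law_sum// mule1 lee_fin.
- move=> z /andP[z0 z1].
  have a0 : (0 < - ln z)%R by rewrite oppr_gt0 ln_lt0// z0.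
  have := H _ a0; rewrite integral_expN_count// opprK lnK// => ->.
  rewrite -poisson_law_pgf ?(ltW z0)// -nneseriesZl//; last first.
    by move=> k _; rewrite mule_ge0 ?poisson_law_ge0// lee_fin exprn_ge0// ltW.
  by apply: eq_eseriesr => k _; rewrite muleCA.
Qed.

(** The set [B] may contain [+oo], which no finite level sees: hence the assumption of almost sure
    finiteness. *)
Lemma integral_count_decomp (B : set (\bar R)) : measurable B ->
  {ae P, forall w, N w != +oo} ->
  \int[P]_w (Y w * \1_(N @^-1` B) w)%:E =
  \sum_(k <oo) (\1_B (k%:R%:E : \bar R))%:E * \int[P]_w (Y w * \1_(level k) w)%:E.
Proof.
move=> mB Nfin.
under eq_eseriesr => k _.
  rewrite -ge0_integralZl_EFin//; last by move=> w _; rewrite lee_fin mulr_ge0.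
  over.
rewrite -integral_nneseries//; last 2 first.
- by move=> k; apply: measurable_funeM.
- by move=> k w _; rewrite mule_ge0// lee_fin// mulr_ge0.
have mNB : measurable (N @^-1` B) by rewrite -[_ @^-1` _]setTI; exact: mN.
apply: ae_eq_integral => //.
- apply/measurable_EFinP; apply: measurable_funM => //; exact: measurable_indic.
- apply: ge0_emeasurable_sum.
    by move=> k w _ _; rewrite mule_ge0// lee_fin// mulr_ge0.
  by move=> k _; apply: measurable_funeM.
apply: filterS Nfin => w Nfin _; have [Ny|[k Nk]] := NC w.
  by rewrite Ny eqxx in Nfin.
rewrite (nneseries_single (k := k)).
- rewrite (levelE _ Nk) eqxx mulr1 -EFinM mulrC !indicE.
  by congr ((_%:R * _)%:E); congr nat_of_bool; apply/idP/idP => /set_mem;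
    rewrite /= ?Nk => ?; apply/mem_set; rewrite /= ?Nk.
- by move=> j jk; rewrite (levelE _ Nk) (negbTE jk) mulr0 mule0.
- by rewrite mule_ge0// lee_fin// mulr_ge0.
Qed.

End count_variables.

(** * Joint law of counts from their joint Laplace transform *)

Section joint_poisson.
Context (R : realType) (dT : measure_display) (T : measurableType dT)
  (P : probability T R).
Local Open Scope ereal_scope.

Variables (I : eqType) (N : I -> T -> \bar R) (m : I -> R).
Hypotheses (mN : forall i, measurable_fun setT (N i))
  (NC : forall i w, is_count (N i w)) (m0 : forall i, (0 <= m i)%R).
Hypothesis laplaceN : forall (s : seq I) (a : I -> R), uniq s ->
  (forall i, (0 < a i)%R) ->
  \int[P]_w (\prod_(i <- s) expN ((a i)%:E * N i w))%:E =
  (\prod_(i <- s) expR (- (m i * (1 - expR (- a i)))))%:E.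

Let mNB i B : measurable B -> measurable (N i @^-1` B).
Proof. by move=> mB; rewrite -[_ @^-1` _]setTI; exact: mN. Qed.

Let N0 i w : 0 <= N i w.
Proof. by have [->|[k ->]] := NC i w; rewrite ?lee_fin. Qed.

Lemma count_poisson_law i k : P (N i @^-1` [set k%:R%:E]) = poisson_law (m i) k.
Proof.
have := @integral_level_poisson _ _ _ P (fun=> 1%R) (N i) _ _ _ (mN i) (NC i)
  1%R (m i) _ (m0 i).
rewrite lexx ler01 => /(_ _ _ _ isT) H.
transitivity (\int[P]_w (1 * \1_(N i @^-1` [set k%:R%:E]) w)%:E).
  by under eq_integral do rewrite mul1r; rewrite integral_indic ?setIT//; exact: mNB.
rewrite -[RHS]mul1e; apply: H => // a a0.
have := @laplaceN [:: i] (fun=> a) isT (fun=> a0); rewrite big_seq1 mul1e => <-.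
by apply: eq_integral => w _; rewrite mul1r big_seq1.
Qed.

(** The Poisson weights of the finite levels already sum to 1 and leave no mass for [+oo]. *)
Lemma count_fin i : {ae P, forall w, N i w != +oo}.
Proof.
exists (~` \bigcup_k (N i @^-1` [set k%:R%:E])); split.
- by apply/measurableC/bigcup_measurable => k _; exact: mNB.
- rewrite probability_setC; last by apply: bigcup_measurable => k _; exact: mNB.
  rewrite measure_bigcup//; last 2 first.
  - by move=> k _; exact: mNB.
  - move=> j k _ _ [w [/= -> [] /eqP]]; rewrite eqr_nat => /eqP //.
  rewrite (eq_eseriesl (Q := xpredT)); last by move=> n; rewrite in_setT.
  rewrite (eq_eseriesr (g := poisson_law (m i))); last first.
    by move=> k _; exact: count_poisson_law.
  by rewrite poisson_law_sum// subee.
- move=> w /= /negP; rewrite negbK => /eqP Ny [k _ /=]; by rewrite Ny.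
Qed.

Let expN01 (a : R) x : (0 < a)%R -> 0 <= x -> (0 <= expN (a%:E * x) <= 1)%R.
Proof.
by move=> a0 x0; rewrite expN_ge0 expN_le1// mule_ge0// lee_fin ltW.
Qed.

(** This replaces a multivariate uniqueness theorem: exponential factors are turned into indicators
    one coordinate at a time. Coordinate [i] moves from [s2] to [s1], while all the other factors
    form the weight [Y] of the one-variable result. *)
Lemma joint_laplace_indic (B : I -> set (\bar R)) (s1 s2 : seq I) (a : I -> R) :
  (forall i, measurable (B i)) -> uniq (s1 ++ s2) -> (forall i, (0 < a i)%R) ->
  \int[P]_w (\prod_(i <- s1) \1_(N i @^-1` B i) w *
             \prod_(i <- s2) expN ((a i)%:E * N i w))%:E =
  (\prod_(i <- s1) fine (P (N i @^-1` B i)) *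
   \prod_(i <- s2) expR (- (m i * (1 - expR (- a i)))))%:E.
Proof.
move=> mB; elim: s1 s2 a => [|i s1 IH] s2 a us a0.
  rewrite big_nil mul1r -laplaceN//.
  by apply: eq_integral => w _; rewrite big_nil mul1r.
pose Y w := (\prod_(j <- s1) \1_(N j @^-1` B j) w *
             \prod_(j <- s2) expN ((a j)%:E * N j w))%R.
pose c := (\prod_(j <- s1) fine (P (N j @^-1` B j)) *
   \prod_(j <- s2) expR (- (m j * (1 - expR (- a j)))))%R.
have mY : measurable_fun setT Y.
  apply: measurable_funM; apply: measurable_prod => j _.
    by apply: measurable_indic; exact: mNB.
  apply: measurableT_comp; first exact: measurable_expN.
  exact: measurable_funeM.
have prod01 (s : seq I) (f : I -> R) :
    (forall j, (0 <= f j <= 1)%R) -> (0 <= \prod_(j <- s) f j <= 1)%R.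
  move=> f01; elim: s => [|j s /andP[q0 q1]].
    by rewrite big_nil ler01 lexx.
  have /andP[f0 f1] := f01 j.
  by rewrite big_cons mulr_ge0//= mulr_ile1.
have Y01 w : (0 <= Y w <= 1)%R.
  have /andP[p0 p1] : (0 <= \prod_(j <- s1) (\1_(N j @^-1` B j) w : R) <= 1)%R.
    by apply: prod01 => j; rewrite indicE; case: (_ \in _); rewrite lexx ler01.
  have /andP[q0 q1] : (0 <= \prod_(j <- s2) expN ((a j)%:E * N j w) <= 1)%R.
    by apply: prod01 => j; exact: expN01.
  by rewrite mulr_ge0//= mulr_ile1.
have c01 : (0 <= c <= 1)%R.
  have /andP[p0 p1] : (0 <= \prod_(j <- s1) fine (P (N j @^-1` B j)) <= 1)%R.
    apply: prod01 => j; rewrite fine_ge0//= -lee_fin fineK ?fin_num_measure//.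
      by rewrite probability_le1//; exact: mNB.
    exact: mNB.
  have /andP[q0 q1] : (0 <= \prod_(j <- s2) expR (- (m j * (1 - expR (- a j)))) <= 1)%R.
    apply: prod01 => j; rewrite expR_ge0/= -expR0 ler_expR oppr_le0 mulr_ge0//.
    by rewrite subr_ge0 ler_expR oppr_le0 ltW.
  by rewrite mulr_ge0//= mulr_ile1.
have Y0 w : (0 <= Y w)%R by have /andP[] := Y01 w.
have Y1 w : (Y w <= 1)%R by have /andP[] := Y01 w.
have us' : uniq (s1 ++ i :: s2) by rewrite -(perm_uniq (permEl (perm_catCA [:: i] s1 s2))).
have level k : \int[P]_w (Y w * \1_(N i @^-1` [set k%:R%:E]) w)%:E =
    c%:E * poisson_law (m i) k.
  apply: integral_level_poisson => // b b0.
  (* The parameter of coordinate [i] has to range over all positive [b] while the others stay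
     fixed. *)
  pose a' j := if j == i then b else a j.
  have a'E j : j \in s2 -> a' j = a j.
    move=> js; rewrite /a'; case: eqP => // ji; move: us => /=.
    by rewrite -ji mem_cat js orbT.
  have a'i : a' i = b by rewrite /a' eqxx.
  have a'0 j : (0 < a' j)%R by rewrite /a'; case: ifP.
  have E (f : I -> R -> R) :
      (\prod_(j <- i :: s2) f j (a' j) = (\prod_(j <- s2) f j (a j)) * f i b)%R.
    rewrite big_cons a'i mulrC; congr (_ * _)%R.
    by rewrite big_seq [RHS]big_seq; apply: eq_bigr => j js; rewrite a'E.
  have := IH (i :: s2) a' us' a'0.
  rewrite (E (fun j x => expR (- (m j * (1 - expR (- x)))))) mulrA EFinM => <-.
  apply: eq_integral => w _.
  by rewrite (E (fun j x => expN (x%:E * N j w))) mulrA.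
transitivity (\int[P]_w (Y w * \1_(N i @^-1` B i) w)%:E).
  by apply: eq_integral => w _; rewrite big_cons /Y; congr (_%:E); ring.
have PB : P (N i @^-1` B i) =
    \sum_(k <oo) (\1_(B i) (k%:R%:E : \bar R))%:E * poisson_law (m i) k.
  have := @integral_count_decomp _ _ _ P (fun=> 1%R) (N i) _ _ (mN i) (NC i)
    (B i) (mB i) (count_fin i).
  under eq_integral do rewrite mul1r.
  rewrite integral_indic ?setIT//; last exact: mNB.
  move=> ->//; apply: eq_eseriesr => k _; rewrite -count_poisson_law; congr *%E.
  under eq_integral do rewrite mul1r.
  by rewrite integral_indic ?setIT//; exact: mNB.
rewrite integral_count_decomp//; last exact: count_fin.
under eq_eseriesr do rewrite level muleCA.
rewrite nneseriesZl//; last first.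
  by move=> k _; rewrite mule_ge0 ?poisson_law_ge0.
rewrite big_cons -mulrA [RHS]EFinM -/c [RHS]muleC fineK ?fin_num_measure//; last exact: mNB.
by congr *%E; rewrite PB.
Qed.

Lemma joint_count_independent (B : I -> set (\bar R)) (s : seq I) :
  (forall i, measurable (B i)) -> uniq s ->
  P (\bigcap_(i in [set` s]) N i @^-1` B i) = \prod_(i <- s) P (N i @^-1` B i).
Proof.
move=> mB us.
have := @joint_laplace_indic B s [::] (fun=> 1%R) mB.
rewrite cats0 => /(_ us (fun=> ltr01)).
under eq_integral do rewrite big_nil mulr1.
rewrite big_nil mulr1 => H.
transitivity (\int[P]_w (\prod_(i <- s) \1_(N i @^-1` B i) w)%:E).
  rewrite -[X in P X]setIT -integral_indic//; last first.
    by apply: fin_bigcap_measurable => // i _; exact: mNB.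
  apply: eq_integral => w _; congr (_%:E).
  elim: (s) => [|i t IH]; first by rewrite set_nil bigcap_set0 big_nil indicT.
  rewrite big_cons -IH.
  transitivity (\1_(N i @^-1` B i `&` \bigcap_(j in [set` t]) N j @^-1` B j) w : R);
    last by rewrite indicI.
  congr (\1__ w).
  apply/seteqP; split=> [x /= Nx|x [Nx tx] j].
    split=> [|j /= jt]; apply: Nx; rewrite /= inE ?eqxx// jt orbT//.
  by rewrite /= inE => /predU1P[->|]//; exact: tx.
rewrite H -prodEFin; apply: eq_bigr => i _; rewrite fineK// fin_num_measure//.
exact: mNB.
Qed.

End joint_poisson.

(** * The Laplace functional of the birth process, from simple to measurable functions *)

Section poisson_laplace.
Context (R : realType) (dT : measure_display) (T : measurableType dT)
  (P : probability T R).
Local Open Scope ereal_scope.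

(** On nonnegative arguments [expN] is at most 1, so dominated convergence applies without any
    integrability of [u]. *)
Lemma cvg_integral_expN (u : nat -> T -> \bar R) (l : T -> \bar R) :
  (forall n, measurable_fun setT (u n)) -> measurable_fun setT l ->
  (forall n w, 0 <= u n w) -> (forall w, u n w @[n --> \oo] --> l w) ->
  \int[P]_w (expN (u n w))%:E @[n --> \oo] --> \int[P]_w (expN (l w))%:E.
Proof.
move=> mu ml u0 ul.
have [] := @dominated_convergence _ _ _ P setT measurableT
  (fun n w => (expN (u n w))%:E) (fun w => (expN (l w))%:E) (cst 1).
- by move=> n; apply/measurable_EFinP; exact: measurableT_comp (@measurable_expN R) (mu n).
- by apply/measurable_EFinP; exact: measurableT_comp (@measurable_expN R) ml.
- by apply: aeW => w _; apply: cvg_EFin; [exact: nearW|exact: cvg_expN].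
- by apply/finite_measure_integrable_cst.
- apply: aeW => w n _ /=.
  by rewrite ger0_norm ?expN_ge0// lee_fin expN_le1.
- by [].
Qed.

Variables (A : T -> set R) (birth : nat -> T -> R) (lambda : R).
Hypothesis lambda0 : (0 < lambda)%R.
Local Notation mu := (@lebesgue_measure R).
Hypothesis ppp : poisson_point_process P A (fun B => lambda%:E * mu B).
Hypothesis mbirth : forall n, measurable_fun setT (birth n).
Hypothesis enumA : {ae P, forall w, set_bij [set: nat] (A w) (birth ^~ w)}.

Definition birth_count (B : set R) (w : T) : \bar R :=
  \sum_(n <oo) (\1_B (birth n w))%:E.

(** The enumeration is a bijection outside one null event, and this event does not depend on [B]:
    the identity holds for all [B] at once. *)
Lemma points_inE : {ae P, forall w, forall B, points_in A B w = birth_count B w}.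
Proof.
apply: filterS enumA => w [Aw iw sw] B; rewrite /points_in /birth_count.
pose E := [set n | B (birth n w)].
have -> : A w `&` B = (birth ^~ w) @` E.
  apply/seteqP; split=> [x [/sw[n _ <-] Bn]|_ [n En <-]]; first by exists n.
  by split => //; exact: Aw.
rewrite counting_image; last by move=> m n _ _; apply: iw; rewrite in_setT.
by rewrite -nneseries_indic; apply: eq_eseriesr => n _; rewrite !indicE.
Qed.

Lemma laplace_points (B : set R) (y : R) : measurable B -> mu B < +oo ->
  (0 < y)%R ->
  \int[P]_w (expN (y%:E * points_in A B w))%:E =
  (expR (- (lambda * fine (mu B) * (1 - expR (- y)))))%:E.
Proof.
move=> mB Bfin y0.
have mp := ppp_measurable ppp mB.
have muB : mu B \is a fin_num by rewrite ge0_fin_numE.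
rewrite -poisson_law_pgf ?expR_ge0//; last first.
  by rewrite mulr_ge0 ?fine_ge0// ltW.
have := @integral_expN_count _ _ _ P (fun=> 1%R) (points_in A B) _ _ mp
   (fun w => is_count_counting R _) y y0.
under eq_integral do rewrite mul1r.
move=> ->//; apply: eq_eseriesr => k _; congr *%E.
under eq_integral do rewrite mul1r.
rewrite integral_indic// ?setIT; last by rewrite -[_ @^-1` _]setTI; exact: mp.
have := ppp_law ppp mB _ k.
rewrite fineM// => <- //.
by rewrite lte_mul_pinfty// lee_fin ltW.
Qed.

(** Shaped for the level sets of a simple function: the value [y] is both the index of the set and
    its coefficient. The independence of the point process is indexed by ordinals, hence the passage
    through positions in [s]. *)
Lemma laplace_disjoint (s : seq R) (B : R -> set R) :
  uniq s -> (forall y, y \in s -> (0 < y)%R) ->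
  (forall y, measurable (B y)) -> (forall y, y \in s -> mu (B y) < +oo) ->
  trivIset setT B ->
  \int[P]_w (\prod_(y <- s) expN (y%:E * points_in A (B y) w))%:E =
  (\prod_(y <- s) expR (- (lambda * fine (mu (B y)) * (1 - expR (- y)))))%:E.
Proof.
move=> us s0 mB Bfin tB.
pose k := size s.
have sk (i : 'I_k) : s`_i \in s by exact: mem_nth.
have ind := @ppp_independent _ _ _ _ _ _ ppp k (fun i : 'I_k => B s`_i)
  (fun i => mB _).
have tB' : trivIset [set: 'I_k] (fun i : 'I_k => B s`_i).
  move=> i j _ _ ne; apply: val_inj; apply/eqP; rewrite -(nth_uniq 0%R (ltn_ord i) (ltn_ord j) us).
  by apply/eqP; apply: tB.
have {}ind := ind tB'.
rewrite -prodEFin.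
transitivity (\int[P]_w (\prod_(i < k) expN ((s`_i)%:E * points_in A (B s`_i) w))%:E).
  by apply: eq_integral => w _; rewrite (big_nth 0%R) big_mkord.
rewrite (integral_prod_independent ind).
- rewrite [RHS](big_nth 0%R) big_mkord; apply: eq_bigr => i _.
  by apply: laplace_points => //; [exact: Bfin|exact: s0].
- move=> i C [D mD <-]; have mp := ppp_measurable ppp (mB s`_i).
  exact: mp.
- move=> i; apply: sigma_algebra_preimage; exact: sigma_algebra_measurable.
- exact: index_enum_uniq.
- move=> i _; apply: (@fmeas_comp _ _ _ _ _ _ _ (fun x => expN ((s`_i)%:E * x))).
    by move=> C mC; exists C => //; rewrite setTI.
  by apply: measurableT_comp; [exact: measurable_expN|exact: measurable_funeM].
- by move=> i w; exact: expN_ge0.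
Qed.

Import HBNNSimple.

Section simple.
Variable f : {nnsfun (measurableTypeR R) >-> R}.
Let s := [seq y <- finmap.enum_fset (fset_set (range f)) | (0 < y)%R].

Let us : uniq s. Proof. exact/filter_uniq/finmap.fset_uniq. Qed.

(** The value 0 is left out of [s], since its level set may have infinite measure; the condition on
    [g 0] makes this harmless. *)
Lemma nnsfun_sum (g : R -> R) x : g 0%R = 0%R ->
  g (f x) = (\sum_(y <- s) g y * \1_(f @^-1` [set y]) x)%R.
Proof.
move=> g0; have [fx0|fx0] := eqVneq (f x) 0%R.
  rewrite fx0 g0 big_seq big1// => y; rewrite mem_filter => /andP[y0 _].
  rewrite indicE memNset ?mulr0// /= fx0 => e; by rewrite -e ltxx in y0.
have fs : f x \in s.
  by rewrite mem_filter lt_neqAle eq_sym fx0 fun_ge0/= in_fset_set// inE; exists x.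
rewrite (bigD1_seq (f x))//= indicE mem_set// mulr1 big1 ?addr0// => y yf.
by rewrite indicE memNset ?mulr0// => /= /esym/eqP; rewrite (negbTE yf).
Qed.

Lemma laplace_nnsfun :
  (forall y, (0 < y)%R -> mu (f @^-1` [set y]) < +oo) ->
  \int[P]_w (expN (\sum_(n <oo) (f (birth n w))%:E))%:E =
  (expN (lambda%:E * \int[mu]_t (1 - expR (- f t))%:E))%:E.
Proof.
move=> ffin.
have mB y : measurable (f @^-1` [set y]) by [].
have sgt0 y : y \in s -> (0 < y)%R by rewrite mem_filter => /andP[].
transitivity (\int[P]_w (\prod_(y <- s)
    expN (y%:E * points_in A (f @^-1` [set y]) w))%:E).
  apply: ae_eq_integral_fun.
  - apply/measurable_EFinP; apply: measurableT_comp (@measurable_expN R) _.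
    apply: ge0_emeasurable_sum => [n w _ _|n _]; first by rewrite lee_fin fun_ge0.
    have mf : measurable_fun setT f by [].
    by apply/measurable_EFinP; exact: measurableT_comp mf (mbirth n).
  - apply/measurable_EFinP; apply: measurable_prod => y _.
    apply: measurableT_comp (@measurable_expN R) _; apply: measurable_funeM.
    by have := ppp_measurable ppp (mB y).
  - apply: filterS points_inE => w pE; congr (_%:E).
    under eq_eseriesr => n _.
      rewrite (@nnsfun_sum id)// big_seq -sumEFin; over.
    rewrite nneseries_sum; last first.
      by move=> y n ys; rewrite lee_fin mulr_ge0// ltW// sgt0.
    rewrite -big_seq; rewrite big_seq [in RHS]big_seq.
    (* Set to 0 outside [s], because [expN_sum] asks for nonnegative terms at every index. *)
    pose F y := if y \in s then y%:E * birth_count (f @^-1` [set y]) w else 0.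
    transitivity (expN (\sum_(y <- s) F y)).
      congr expN; rewrite [RHS]big_seq; apply: eq_bigr => y ys; rewrite /F ys.
      rewrite /birth_count -nneseriesZl; last by move=> n _; rewrite lee_fin.
      by apply: eq_eseriesr => n _; rewrite EFinM.
    rewrite expN_sum; last first.
      move=> y; rewrite /F; case: ifP => // ys; rewrite mule_ge0//.
        by rewrite lee_fin ltW// sgt0.
      by apply: nneseries_ge0 => n _ _; rewrite lee_fin.
    by rewrite big_seq; apply: eq_bigr => y ys; rewrite /F ys pE.
rewrite laplace_disjoint//; last 2 first.
- by move=> y ys; apply: ffin; exact: sgt0.
- by move=> y z _ _ [x [/= <- <-]].
congr (_%:E).
(* The absolute value makes [g] nonnegative at negative arguments too, as the exchange of sum and
   integral requires. *)
pose g (y : R) : R := `|1 - expR (- y)|%R.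
have gs (y : R) : (0 <= y)%R -> g y = (1 - expR (- y))%R.
  by move=> y0; rewrite /g ger0_norm// subr_ge0 -[leRHS]expR0 ler_expR oppr_le0.
have -> : \int[mu]_t (1 - expR (- f t))%:E =
    (\sum_(y <- s) g y * fine (mu (f @^-1` [set y])))%:E.
  under eq_integral => t _.
    rewrite -gs ?fun_ge0// (@nnsfun_sum g) ?/g ?oppr0 ?expR0 ?subrr ?normr0//.
    rewrite -sumEFin; over.
  rewrite ge0_integral_sum//; last first.
    by move=> y; apply/measurable_EFinP; exact: measurable_funM.
  rewrite -sumEFin big_seq [RHS]big_seq; apply: eq_bigr => y ys.
  under eq_integral do rewrite EFinM.
  rewrite ge0_integralZl//; last first.
    by apply/measurable_EFinP; exact: measurable_indic.
  rewrite integral_indic// setIT EFinM fineK// ge0_fin_numE//.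
  exact/ffin/sgt0.
rewrite [X in expN X](_ : _ =
  (lambda * \sum_(y <- s) g y * fine (mu (f @^-1` [set y])))%:E)//.
rewrite expNr mulr_sumr -sumrN expR_sum big_seq [RHS]big_seq.
by apply: eq_bigr => y ys; rewrite gs ?ltW ?sgt0//; congr expR; ring.
Qed.
End simple.

(** Monotone convergence for the counting measure on the indices. *)
Lemma cvg_nneseries_monotone (u : nat -> nat -> \bar R) (l : nat -> \bar R) :
  (forall m n, 0 <= u m n) ->
  (forall n, nondecreasing_seq (u ^~ n)) ->
  (forall n, u m n @[m --> \oo] --> l n) ->
  \sum_(n <oo) u m n @[m --> \oo] --> \sum_(n <oo) l n.
Proof.
move=> u0 ndu ul.
have l0 n : 0 <= l n.
  rewrite -(cvg_lim _ (ul n))//; apply: lime_ge; last exact: nearW.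
  by apply/cvg_ex; exists (l n).
rewrite -ge0_integral_count//.
rewrite (_ : (fun m => _) = fun m => \int[counting]_n u m n); last first.
  by apply/funext => m; rewrite ge0_integral_count.
rewrite (_ : \int[counting]_t l t = \int[counting]_t limn (u ^~ t)).
  by apply: cvg_monotone_convergence => // n _ a b ab; exact: ndu.
by apply: eq_integral => n _; apply/esym/cvg_lim.
Qed.

(** Simple functions increase to [phi]. Inside both [expN] the convergence is monotone, and the left
    side then passes to the limit by domination. *)
Lemma laplace_poisson (phi : R -> R) : measurable_fun setT phi ->
  (forall t, (0 <= phi t)%R) -> \int[mu]_t (1 - expR (- phi t))%:E < +oo ->
  \int[P]_w (expN (\sum_(n <oo) (phi (birth n w))%:E))%:E =
  (expN (lambda%:E * \int[mu]_t (1 - expR (- phi t))%:E))%:E.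
Proof.
move=> mphi phi0 phifin.
have mphi' : measurable_fun (setT : set (measurableTypeR R)) (EFin \o phi).
  exact/measurable_EFinP.
pose f := nnsfun_approx (@measurableT _ (measurableTypeR R)) mphi'.
have ndf t : nondecreasing_seq (fun m => f m t).
  by move=> m n mn; apply/lefP; exact: nd_nnsfun_approx.
have cvgf t : (f m t)%:E @[m --> \oo] --> (phi t)%:E.
  by apply: (cvg_nnsfun_approx _ mphi') => // x _; rewrite lee_fin.
have fphi m t : (f m t <= phi t)%R.
  rewrite -lee_fin -(cvg_lim _ (cvgf t))//; apply: lime_ge.
    by apply/cvg_ex; exists (phi t)%:E.
  by near=> n; rewrite lee_fin; apply: ndf; near: n; exact: nbhs_infty_ge.
have exp_ge0 (x : R) : (0 <= x)%R -> (0 <= 1 - expR (- x))%R.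
  by move=> x0; rewrite subr_ge0 -[leRHS]expR0 ler_expR oppr_le0.
have mexp (h : R -> R) : measurable_fun setT h ->
    measurable_fun setT (fun t => (1 - expR (- h t))%:E).
  move=> mh; apply/measurable_EFinP; apply: measurable_funB => //.
  by apply: measurableT_comp => //; apply: measurableT_comp.
(* A Markov inequality: on the level set of [y] the integrand [1 - expR (- phi t)] is at least
   [1 - expR (- y)], which is positive. *)
have ffin m y : (0 < y)%R -> mu (f m @^-1` [set y]) < +oo.
  move=> y0; have c0 : (0 < 1 - expR (- y))%R.
    by rewrite subr_gt0 -[ltRHS]expR0 ltr_expR oppr_lt0.
  have mB : measurable (f m @^-1` [set y]) by [].
  have : (1 - expR (- y))%:E * mu (f m @^-1` [set y]) <=
      \int[mu]_t (1 - expR (- phi t))%:E.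
    rewrite -[X in mu X]setIT -integral_indic// -ge0_integralZl//; last 2 first.
    - by apply/measurable_EFinP; exact: measurable_indic.
    - by rewrite lee_fin ltW.
    apply: ge0_le_integral => //.
    - by move=> t _; rewrite mule_ge0// lee_fin ltW.
    - by apply: measurable_funeM; apply/measurable_EFinP; exact: measurable_indic.
    - exact: mexp.
    move=> t _; rewrite indicE; have [/set_mem/= fy|_] := boolP (t \in _).
      by rewrite mule1 lee_fin lerD2l lerN2 ler_expR lerN2 -fy.
    by rewrite mule0 lee_fin exp_ge0.
  move=> /le_lt_trans/(_ phifin); case: (mu _) => [r||]//; rewrite ?ltry//.
  by rewrite gt0_muley ?lte_fin.
have cL : \int[P]_w (expN (\sum_(n <oo) (f m (birth n w))%:E))%:E @[m --> \oo] -->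
    \int[P]_w (expN (\sum_(n <oo) (phi (birth n w))%:E))%:E.
  have msum (h : R -> R) : measurable_fun setT h -> (forall t, (0 <= h t)%R) ->
      measurable_fun setT (fun w => \sum_(n <oo) (h (birth n w))%:E).
    move=> mh h0; apply: ge0_emeasurable_sum => [n w _ _|n _].
      by rewrite lee_fin.
    by apply/measurable_EFinP; exact: measurableT_comp mh (mbirth n).
  apply: cvg_integral_expN.
  - move=> m; apply: msum => [|t]; last exact: fun_ge0.
    by have : measurable_fun setT (f m) by [].
  - exact: msum.
  - by move=> m w; apply: nneseries_ge0 => n _ _; rewrite lee_fin fun_ge0.
  - move=> w; apply: cvg_nneseries_monotone.
    + by move=> m n; rewrite lee_fin fun_ge0.
    + by move=> n a b ab; rewrite lee_fin ndf.
    + by move=> n; exact: cvgf.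
have cR : (expN (lambda%:E * \int[mu]_t (1 - expR (- f m t))%:E))%:E @[m --> \oo]
   --> (expN (lambda%:E * \int[mu]_t (1 - expR (- phi t))%:E))%:E.
  apply: cvg_EFin; first exact: nearW.
  apply: cvg_expN.
    move=> m; apply: mule_ge0; first by rewrite lee_fin ltW.
    by apply: integral_ge0 => t _; rewrite lee_fin exp_ge0// fun_ge0.
  apply: cvgeZl => //.
  rewrite (_ : \int[mu]_t (1 - expR (- phi t))%:E =
     \int[mu]_t limn (fun m => (1 - expR (- f m t))%:E)); last first.
    apply: eq_integral => t _; apply/esym/cvg_lim => //.
    apply: cvg_EFin; first exact: nearW.
    apply: cvgB; first exact: cvg_cst.
    apply: (@cvg_expN R (fun m => (f m t)%:E) (phi t)%:E) => // m.
    by rewrite lee_fin fun_ge0.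
  apply: cvg_monotone_convergence => //.
  - by move=> m; apply: mexp; have : measurable_fun setT (f m) by [].
  - by move=> m t _; rewrite lee_fin exp_ge0// fun_ge0.
  - by move=> t _ a b ab; rewrite lee_fin lerD2l lerN2 ler_expR lerN2 ndf.
rewrite -(cvg_lim _ cL)// -(cvg_lim _ cR)//; congr (lim _).
congr (_ @ \oo); apply/funext => m.
by apply: laplace_nnsfun => y; exact: ffin.
Unshelve. all: by end_near. Qed.

End poisson_laplace.

(** * Marked Poisson processes *)

Section marking.
Context (R : realType) (dT : measure_display) (T : measurableType dT)
  (P : probability T R) (dS : measure_display) (S : measurableType dS)
  (Q : probability S R).
Local Open Scope ereal_scope.

Lemma ge0_integral_same_law (f : T -> \bar R) (g : S -> \bar R)
    (h : \bar R -> \bar R) :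
  measurable_fun setT f -> measurable_fun setT g ->
  measurable_fun setT h -> (forall x, 0 <= h x) ->
  (forall B, measurable B -> P (f @^-1` B) = Q (g @^-1` B)) ->
  \int[P]_w h (f w) = \int[Q]_v h (g v).
Proof.
move=> mf mg mh h0 fg.
pose X : {mfun T >-> \bar R} := HB.pack f (isMeasurableFun.Build _ _ _ _ _ mf).
pose Y : {mfun S >-> \bar R} := HB.pack g (isMeasurableFun.Build _ _ _ _ _ mg).
transitivity (\int[distribution P X]_x h x).
  by rewrite ge0_integral_distribution.
transitivity (\int[distribution Q Y]_x h x).
  by apply: eq_measure_integral => A mA _; exact: fg.
by rewrite ge0_integral_distribution.
Qed.

Variables (birth : nat -> T -> R) (mark : nat -> T -> \bar R)
  (F : option nat -> set (set T)) (mark0 : S -> \bar R).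
Hypotheses (indF : independent P F) (sF : forall o, sigma_algebra setT (F o))
  (Fm : forall o, F o `<=` measurable)
  (mbirth : forall n, fmeas (F None) (birth n))
  (mmark : forall n, fmeas (F (Some n)) (mark n))
  (mmark0 : measurable_fun setT mark0)
  (law_mark : forall n B, measurable B ->
     P (mark n @^-1` B) = Q (mark0 @^-1` B)).

Lemma integral_prod_marks (e : R * \bar R -> R) (N : nat) :
  measurable_fun setT e -> (forall x, (0 <= e x <= 1)%R) ->
  \int[P]_w (\prod_(0 <= n < N) e (birth n w, mark n w))%:E =
  \int[P]_w (\prod_(0 <= n < N) fine (\int[Q]_v (e (birth n w, mark0 v))%:E))%:E.
Proof.
move=> me e01.
pose h t := fine (\int[Q]_v (e (t, mark0 v))%:E).
have e0 x : (0 <= e x)%R by have /andP[] := e01 x.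
have me1 t : measurable_fun setT (fun v => e (t, v)).
  exact: measurableT_comp me (pair1_measurable _).
have h01 t : 0 <= \int[Q]_v (e (t, mark0 v))%:E <= 1.
  by apply: integral01 => //; exact: measurableT_comp (me1 t) mmark0.
have hE t : (h t)%:E = \int[Q]_v (e (t, mark0 v))%:E.
  rewrite /h fineK//; have /andP[i0 i1] := h01 t.
  by rewrite ge0_fin_numE// (le_lt_trans i1) ?ltry.
have mh : measurable_fun setT h.
  apply: measurableT_comp => //.
  have := @measurable_fun_fubini_tonelli_F _ _ R S R Q
    (fun z => (e (z.1, mark0 z.2))%:E).
  apply; last by move=> z; rewrite lee_fin.
  apply/measurable_EFinP; apply: measurableT_comp => //.
  apply: measurable_fun_pair => //; exact: measurableT_comp mmark0 _.
have h0 t : (0 <= h t)%R by rewrite fine_ge0//; have /andP[] := h01 t.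
have mbirth' n : measurable_fun setT (birth n) := fmeasW (@Fm None) (mbirth n).
have mmark' n : measurable_fun setT (mark n) := fmeasW (@Fm (Some n)) (mmark n).
(* Hybrid products: the first [m] factors keep their own marks, the remaining ones have theirs
   already averaged. *)
suff H m : (m <= N)%N -> \int[P]_w (\prod_(0 <= n < m) e (birth n w, mark n w) *
      \prod_(m <= n < N) h (birth n w))%:E =
    \int[P]_w (\prod_(0 <= n < N) h (birth n w))%:E.
  have := H N (leqnn _) => {H} <-.
  by apply: eq_integral => w _; rewrite [X in (_ * X)%R]big_geq// mulr1.
(* integrate out the marks one at a time: the [m]-th one is independent of the
   births and of the previous marks *)
elim: m => [_|m IH mN].
  by apply: eq_integral => w _; rewrite big_geq// mul1r.
rewrite -IH; last exact: ltnW.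
pose Z w := (\prod_(0 <= n < m) e (birth n w, mark n w) *
  \prod_(m.+1 <= n < N) h (birth n w))%R.
have Z0 w : (0 <= Z w)%R by rewrite mulr_ge0// prodr_ge0.
pose s := None :: [seq Some n | n <- iota 0 m].
pose G := <<s \bigcup_(j in [set` s]) F j >>.
have us : uniq s.
  rewrite /= map_inj_uniq ?iota_uniq ?andbT; last by move=> ? ? [].
  by apply/mapP => -[].
have mns : Some m \notin s.
  by rewrite inE/=; apply/mapP => -[k + [mk]]; rewrite -mk mem_iota add0n ltnn andbF.
have ind2 := independent_grouping indF (@Fm) (fun j => sigma_algebra_setT (sF j))
  (fun j => sigma_algebra_setI (sF j)) us mns.
have sG : sigma_algebra setT G by exact: smallest_sigma_algebra.
have Gm : G `<=` measurable.
  apply: smallest_sub; first exact: sigma_algebra_measurable.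
  by move=> B [j _]; exact: Fm.
have GN n : fmeas G (birth n).
  by move=> B mB; apply: sub_sigma_algebra; exists None => //; exact: mbirth.
have GS n : (n < m)%N -> fmeas G (mark n).
  move=> nm B mB; apply: sub_sigma_algebra; exists (Some n); last exact: mmark.
  by rewrite /= inE/=; apply/mapP; exists n => //; rewrite mem_iota.
have mZ : fmeas G Z.
  apply/(fmeasP _ sG); apply: measurable_funM.
    rewrite (_ : (fun _ => _) = fun w =>
      (\prod_(n <- iota 0 m) e (birth n w, mark n w))%R); last first.
      by apply/funext => w; rewrite /index_iota subn0.
    apply: measurable_prod => n; rewrite mem_iota => /andP[_ nm].
    apply/(fmeasP _ sG); apply: (fmeas_comp (g := e)) => //.
    by apply: fmeas_pair => //; exact: GS.
  apply: measurable_prod => n _; apply/(fmeasP _ sG).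
  exact: (fmeas_comp (g := h)).
transitivity (\int[P]_w (`|Z w| * e (birth m w, mark m w))%:E).
  apply: eq_integral => w _; rewrite ger0_norm// big_nat_recr//= /Z.
  by congr (_%:E); ring.
have mU : fmeas G (fun w => (Z w, birth m w)) by exact: fmeas_pair.
rewrite (@integral_independent2 _ _ _ P _ _ _ _ _ _ _ _
  (fun z : (R * R) * \bar R => (`|z.1.1| * e (z.1.2, z.2))%:E)
  Gm (@Fm (Some m)) ind2 mU (mmark m))/=; last 2 first.
- apply/measurable_EFinP; apply: measurable_funM.
    apply: measurableT_comp => //; apply: measurableT_comp => //.
  apply: measurableT_comp me _; apply: measurable_fun_pair => //.
  by apply: measurableT_comp.
- by move=> z; rewrite lee_fin mulr_ge0.
apply: eq_integral => w _.
under eq_integral do rewrite EFinM.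
rewrite ge0_integralZl//; last 2 first.
- by apply/measurable_EFinP; exact: measurableT_comp (me1 _) (mmark' m).
- by move=> v _; rewrite lee_fin.
rewrite (ge0_integral_same_law (h := fun x => (e (birth m w, x))%:E) _ mmark0)//.
- rewrite -hE -EFinM ger0_norm// /Z (big_ltn mN); congr (_%:E); ring.
- exact/measurable_EFinP.
- by move=> x; rewrite lee_fin.
- exact: law_mark.
Qed.

End marking.

(** * Laplace transform of the numbers of exits in disjoint windows *)

Section marked_counts.
Context (R : realType) (dT : measure_display) (T : measurableType dT)
  (P : probability T R) (dS : measure_display) (S : measurableType dS)
  (Q : probability S R).
Local Open Scope ereal_scope.
Local Notation mu := (@lebesgue_measure R).

Variables (A : T -> set R) (birth : nat -> T -> R) (lambda : R).
Hypothesis lambda0 : (0 < lambda)%R.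
Hypothesis ppp : poisson_point_process P A (fun B => lambda%:E * mu B).
Hypothesis enumA : {ae P, forall w, set_bij [set: nat] (A w) (birth ^~ w)}.

Variables (mark : nat -> T -> \bar R)
  (F : option nat -> set (set T)) (mark0 : S -> \bar R).
Hypotheses (indF : independent P F) (sF : forall o, sigma_algebra setT (F o))
  (Fm : forall o, F o `<=` measurable)
  (mbirth : forall n, fmeas (F None) (birth n))
  (mmark : forall n, fmeas (F (Some n)) (mark n))
  (mmark0 : measurable_fun setT mark0)
  (law_mark : forall n B, measurable B ->
     P (mark n @^-1` B) = Q (mark0 @^-1` B)).

Variables (I : eqType) (W : I -> set R) (len : I -> R).
Hypotheses (mW : forall i, measurable (W i)) (tW : trivIset setT W)
  (lenW : forall i x, mu [set t | W i (t + x)%R] = (len i)%:E).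

(** A mark [+oo] sends the particle to [+oo], outside the image of [EFin], so that it is never
    counted. *)
Definition marked_count (i : I) (w : T) : \bar R :=
  \sum_(n <oo) (\1_(EFin @` W i) ((birth n w)%:E + mark n w))%:E.

Let mbirth' n : measurable_fun setT (birth n) := fmeasW (@Fm None) (@mbirth n).
Let mmark' n : measurable_fun setT (mark n) := fmeasW (@Fm (Some n)) (@mmark n).

Let mEW i : measurable (EFin @` W i).
Proof. by apply: measurable_image_EFin; exact: mW. Qed.

Let hit i (z : R * \bar R) : R := \1_(EFin @` W i) (z.1%:E + z.2).

Let mhit i : measurable_fun setT (hit i).
Proof.
have mI : measurable_fun setT (\1_(EFin @` W i) : \bar R -> R) :=
  measurable_indic (mEW i).
apply: (measurableT_comp mI); apply: emeasurable_funD => //.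
by apply/measurable_EFinP.
Qed.

Let hit01 i z : hit i z = 0%R \/ hit i z = 1%R.
Proof. by rewrite /hit indicE; case: (_ \in _); [right|left]. Qed.

Let hit0 i z : (0 <= hit i z)%R.
Proof. by have [->|->] := hit01 i z. Qed.

Let hit_disjoint i j z : hit i z = 1%R -> hit j z = 1%R -> i = j.
Proof.
rewrite /hit !indicE.
case: (boolP (_ \in EFin @` W i)) => [/set_mem[r Wi <-] _|_ /eqP]; last first.
  by rewrite eq_sym oner_eq0.
case: (boolP (_ \in EFin @` W j)) => [/set_mem[r' Wj [rr']] _|_ /eqP]; last first.
  by rewrite eq_sym oner_eq0.
by apply: tW => //; exists r; split => //; rewrite -rr'.
Qed.

Let len0 i : (0 <= len i)%R.
Proof. by rewrite -lee_fin -(lenW i 0%R). Qed.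

Lemma measurable_marked_count i : measurable_fun setT (marked_count i).
Proof.
apply: ge0_emeasurable_sum => [n w _ _|n _]; first by rewrite lee_fin.
by apply/measurable_EFinP; exact: measurable_comp_pair (@mhit i) _ _.
Qed.

Lemma is_count_marked i w : is_count (marked_count i w).
Proof.
rewrite /marked_count.
pose E := [set n | (EFin @` W i) ((birth n w)%:E + mark n w)].
rewrite (_ : \sum_(_ <oo) _ = \sum_(n <oo) (\1_E n : R)%:E); last first.
  by apply: eq_eseriesr => n _; rewrite !indicE.
by rewrite nneseries_indic; exact: is_count_counting.
Qed.

(** For the exit mark, the probability of leaving the domain through the detector. *)
Definition mark_prob : R := fine (Q [set v | mark0 v \is a fin_num]).

Lemma mark_prob_ge0 : (0 <= mark_prob)%R.
Proof. by rewrite fine_ge0. Qed.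

Let mfin : measurable [set v | mark0 v \is a fin_num].
Proof.
rewrite (_ : [set _ | _] = mark0 @^-1` [set x | x \is a fin_num])//.
rewrite -[X in measurable X]setTI; apply: mmark0 => //.
by have := @emeasurable_fin_num _ _ R setT id; rewrite setTI; apply.
Qed.

Section laplace.
Variables (s : seq I) (a : I -> R).
Hypotheses (us : uniq s) (a0 : forall i, (0 < a i)%R).

Let e (z : R * \bar R) : R := (\prod_(i <- s) expR (- (a i * hit i z)))%R.

Let me : measurable_fun setT e.
Proof.
apply: measurable_prod => i _; apply: measurableT_comp => //.
by apply: measurableT_comp => //; exact: measurable_funM.
Qed.

Let e01 z : (0 <= e z <= 1)%R.
Proof.
rewrite prodr_ge0//= /e; elim: (s) => [|i t IH]; rewrite ?big_nil// big_cons mulr_ile1 ?expR_ge0//.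
  by apply: prodr_ge0 => j _; exact: expR_ge0.
by rewrite -expR0 ler_expR oppr_le0 mulr_ge0// ltW.
Qed.

(** The windows are disjoint, so at most one factor of the product differs from 1 and its expansion
    is linear in the indicators. *)
Let one_sub_e z : (1 - e z = \sum_(i <- s) (1 - expR (- a i)) * hit i z)%R.
Proof.
have [[i is1 hi]|nh] := pselect (exists2 i, i \in s & hit i z = 1%R).
  have hj j : j != i -> hit j z = 0%R.
    move=> ji; have [//|hj] := hit01 j z.
    by rewrite (hit_disjoint hj hi) eqxx in ji.
  rewrite /e (bigD1_seq i)//= (bigD1_seq i)//= hi !mulr1 big1 ?mulr1; last first.
    by move=> j ji; rewrite hj// mulr0 oppr0 expR0.
  by rewrite big1 ?addr0// => j ji; rewrite hj// mulr0.
have hj j : j \in s -> hit j z = 0%R.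
  by move=> js; have [//|hj] := hit01 j z; exfalso; apply: nh; exists j.
rewrite /e big_seq big1 ?subrr; last by move=> j js; rewrite hj// mulr0 oppr0 expR0.
by rewrite big_seq big1// => j js; rewrite hj// mulr0.
Qed.

Let h t : R := fine (\int[Q]_v (e (t, mark0 v))%:E).

Let met t : measurable_fun setT (fun v => e (t, mark0 v)).
Proof.
exact: measurable_comp_pair me _ _.
Qed.

Let h01 t : 0 <= \int[Q]_v (e (t, mark0 v))%:E <= 1.
Proof. by apply: integral01 => //; exact: met. Qed.

Let hE t : (h t)%:E = \int[Q]_v (e (t, mark0 v))%:E.
Proof.
rewrite /h fineK//; have /andP[i0 i1] := h01 t.
by rewrite ge0_fin_numE// (le_lt_trans i1) ?ltry.
Qed.

Let mh : measurable_fun setT h.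
Proof.
apply: measurableT_comp => //.
have := @measurable_fun_fubini_tonelli_F _ _ R S R Q
  (fun z => (e (z.1, mark0 z.2))%:E).
apply; last by move=> z; rewrite lee_fin; have /andP[] := e01 (z.1, mark0 z.2).
apply/measurable_EFinP; apply: measurable_comp_pair me _ _ => //.
exact: measurableT_comp mmark0 _.
Qed.

(** Positivity allows [h] to be written as exp(- phi) with a finite [phi]. The lower bound comes
    from indicators being at most 1. *)
Let h_gt0 t : (0 < h t)%R.
Proof.
pose c := expR (- \sum_(i <- s) a i).
apply: (@lt_le_trans _ _ c); first exact: expR_gt0.
rewrite -lee_fin hE.
apply: (@le_trans _ _ (\int[Q]_v c%:E)).
  by rewrite integral_prob_cst.
apply: ge0_le_integral => //.
- by move=> v _; rewrite lee_fin expR_ge0.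
- exact/measurable_EFinP.
move=> v _; rewrite lee_fin /c -sumrN expR_sum /e; apply: ler_prod => i _.
rewrite expR_ge0 ler_expR lerN2/=.
by have [->|->] := hit01 i (t, mark0 v); rewrite ?mulr1 ?mulr0 ?lexx// ltW.
Qed.

Let h_le1 t : (h t <= 1)%R.
Proof. by rewrite -lee_fin hE; have /andP[] := h01 t. Qed.

Let phi t := (- ln (h t))%R.

Let phi0 t : (0 <= phi t)%R.
Proof. by rewrite oppr_ge0 ln_le0. Qed.

Let mphi : measurable_fun setT phi.
Proof. by apply: measurableT_comp => //; apply: measurableT_comp. Qed.

Let hphi t : h t = expR (- phi t).
Proof. by rewrite opprK lnK// posrE. Qed.

(** After Tonelli, the inner integral over the birth time is the measure of a translated window:
    [len i] whatever the finite mark, and 0 for an infinite one. The mark therefore enters only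
    through the probability that it is finite. *)
Lemma integral_one_sub : \int[mu]_t (1 - expR (- phi t))%:E =
  (\sum_(i <- s) (1 - expR (- a i)) * (mark_prob * len i))%:E.
Proof.
have ca i : (0 <= 1 - expR (- a i))%R.
  by rewrite subr_ge0 -[leRHS]expR0 ler_expR oppr_le0 ltW.
transitivity (\int[mu]_t \int[Q]_v (1 - e (t, mark0 v))%:E).
  apply: eq_integral => t _; rewrite -hphi.
  under eq_integral do rewrite EFinB.
  rewrite integralB_EFin//=; last 2 first.
  - exact: finite_measure_integrable_cst.
  - apply: measurable_bounded_integrable => //.
      by rewrite (le_lt_trans (probability_le1 _ _))// ltry.
    exists 1%R; split => // M M1 v _ /=.
    have /andP[v0 v1] := e01 (t, mark0 v).
    by rewrite ger0_norm// (le_trans v1)// ltW.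
  by rewrite integral_prob_cst -hE.
under eq_integral => t _.
  under eq_integral => v _ do rewrite one_sub_e -sumEFin.
  rewrite ge0_integral_sum//; last 2 first.
  - move=> i; apply/measurable_EFinP; apply: measurable_funM => //.
    exact: measurable_comp_pair (@mhit i) _ _.
  - by move=> i v _; rewrite lee_fin mulr_ge0.
  under eq_bigr => i _.
    under eq_integral => v _ do rewrite EFinM.
    rewrite ge0_integralZl//; last 3 first.
    - by apply/measurable_EFinP; exact: measurable_comp_pair (@mhit i) _ _.
    - by move=> v _; rewrite lee_fin.
    - by rewrite lee_fin.
    over.
  over.
have mhi i : measurable_fun setT (fun z : measurableTypeR R * S =>
    (hit i (z.1, mark0 z.2))%:E).
  apply/measurable_EFinP; apply: measurable_comp_pair (@mhit i) _ _ => //.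
  exact: measurableT_comp mmark0 _.
have hi0 i (z : measurableTypeR R * S) : 0 <= (hit i (z.1, mark0 z.2))%:E.
  by rewrite lee_fin.
rewrite ge0_integral_sum//; last 2 first.
- move=> i; apply: measurable_funeM.
  exact: (@measurable_fun_fubini_tonelli_F _ _ _ _ _ Q _ (mhi i) (hi0 i)).
- move=> i t _; rewrite mule_ge0 ?lee_fin//; apply: integral_ge0 => v _.
  by rewrite lee_fin.
rewrite -sumEFin; apply: eq_bigr => i _.
rewrite ge0_integralZl//; last 3 first.
- exact: (@measurable_fun_fubini_tonelli_F _ _ _ _ _ Q _ (mhi i) (hi0 i)).
- by move=> t _; apply: integral_ge0 => v _; rewrite lee_fin.
- by rewrite lee_fin.
rewrite EFinM; congr *%E.
have := @fubini_tonelli _ _ _ _ _ mu Q _ (mhi i) (hi0 i).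
rewrite /fubini_F /fubini_G /= => ->.
transitivity (\int[Q]_v ((len i)%:E *
    (\1_[set v | mark0 v \is a fin_num] v)%:E)).
  apply: eq_integral => v _.
  rewrite indicE; have [/set_mem/= vfin|/negP vfin] := boolP (_ \in _).
    rewrite mule1 -(lenW i (fine (mark0 v))) -[X in _ = mu X]setIT.
    rewrite -integral_indic//; last first.
      have mt : measurable_fun setT (fun t : R => (t + fine (mark0 v))%R).
        exact: measurable_funD.
      by rewrite -[X in measurable X]setTI; apply: mt.
    apply: eq_integral => t _; rewrite /hit/= !indicE -(fineK vfin) -EFinD.
    congr (_%:R%:E); congr nat_of_bool; apply/idP/idP => /set_mem.
      by move=> [r Wr [rE]]; apply/mem_set; rewrite /= -rE.
    by move=> /= Wt; apply/mem_set; eexists; [exact: Wt|].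
  have {}vfin : mark0 v \isn't a fin_num.
    by apply/negP => fv; apply: vfin; exact/mem_set.
  rewrite mule0 integral0_eq// => t _; rewrite /hit indicE memNset//=.
  by move=> [r _]; case: (mark0 v) vfin.
rewrite ge0_integralZl//; last 2 first.
- by apply/measurable_EFinP; exact: measurable_indic.
- by rewrite lee_fin.
rewrite integral_indic// setIT muleC EFinM /mark_prob fineK// fin_num_measure//.
Qed.

(** For finitely many particles, averaging the marks replaces the functional [u] of marked births by
    the functional [v] of the births alone, with exponent [phi]. Both sides pass to the limit, and
    the Laplace functional of the births applies to [phi]. *)
Lemma laplace_marked_count :
  \int[P]_w (\prod_(i <- s) expN ((a i)%:E * marked_count i w))%:E =
  (\prod_(i <- s) expR (- (lambda * mark_prob * len i * (1 - expR (- a i)))))%:E.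
Proof.
pose u N w := \sum_(0 <= n < N) \sum_(i <- s) (a i * hit i (birth n w, mark n w))%:E.
pose v N w := \sum_(0 <= n < N) (phi (birth n w))%:E.
have ah0 i z : 0 <= (a i * hit i z)%:E by rewrite lee_fin mulr_ge0// ltW.
have uv N : \int[P]_w (expN (u N w))%:E = \int[P]_w (expN (v N w))%:E.
  transitivity (\int[P]_w (\prod_(0 <= n < N) e (birth n w, mark n w))%:E).
    apply: eq_integral => w _; rewrite expN_sum; last by move=> n; rewrite sume_ge0.
    by congr (_%:E); apply: eq_bigr => n _; rewrite expN_sum.
  rewrite (integral_prod_marks indF sF Fm mbirth mmark mmark0 law_mark)//.
  apply: eq_integral => w _; rewrite expN_sum; last by move=> n; rewrite lee_fin.
  by congr (_%:E); apply: eq_bigr => n _; rewrite expNr -hphi.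
have mahit n i : measurable_fun setT
    (fun w => (a i * hit i (birth n w, mark n w))%:E).
  apply/measurable_EFinP; apply: measurable_funM => //.
  exact: measurable_comp_pair (@mhit i) _ _.
have mphin n : measurable_fun setT (fun w => (phi (birth n w))%:E).
  by apply/measurable_EFinP; exact: measurableT_comp mphi (mbirth' n).
have cu : \int[P]_w (expN (u N w))%:E @[N --> \oo] --> \int[P]_w (expN
    (\sum_(n <oo) \sum_(i <- s) (a i * hit i (birth n w, mark n w))%:E))%:E.
  apply: cvg_integral_expN.
  - by move=> N; apply: emeasurable_sum => n; exact: emeasurable_sum.
  - apply: ge0_emeasurable_sum => [n w _ _|n _]; first by rewrite sume_ge0.
    exact: emeasurable_sum.
  - by move=> N w; rewrite sume_ge0// => n _; rewrite sume_ge0.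
  - by move=> w; apply: is_cvg_nneseries => n _ _; rewrite sume_ge0.
have cv : \int[P]_w (expN (v N w))%:E @[N --> \oo] -->
    \int[P]_w (expN (\sum_(n <oo) (phi (birth n w))%:E))%:E.
  apply: cvg_integral_expN.
  - by move=> N; exact: emeasurable_sum.
  - by apply: ge0_emeasurable_sum => [n w _ _|n _]; rewrite ?lee_fin.
  - by move=> N w; rewrite sume_ge0// => n _; rewrite lee_fin.
  - by move=> w; apply: is_cvg_nneseries => n _ _; rewrite lee_fin.
transitivity (\int[P]_w (expN
    (\sum_(n <oo) \sum_(i <- s) (a i * hit i (birth n w, mark n w))%:E))%:E).
  apply: eq_integral => w _; congr (_%:E); rewrite nneseries_sum//.
  rewrite expN_sum; last by move=> i; exact: nneseries_ge0.
  apply: eq_bigr => i _; congr expN; by rewrite /marked_count -nneseriesZl.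
rewrite -(cvg_lim _ cu)//; under eq_fun do rewrite uv.
rewrite (cvg_lim _ cv)// (laplace_poisson lambda0 ppp mbirth' enumA mphi phi0);
  rewrite integral_one_sub ?ltry//; congr (_%:E).
rewrite -EFinM expNr mulr_sumr -sumrN expR_sum; apply: eq_bigr => i _.
by congr expR; ring.
Qed.

End laplace.

End marked_counts.

(** * The Poisson process axioms for the counts of marked births *)

Section poisson_of_marks.
Context (R : realType) (dT : measure_display) (T : measurableType dT)
  (P : probability T R) (dS : measure_display) (S : measurableType dS)
  (Q : probability S R).
Local Open Scope ereal_scope.
Local Notation mu := (@lebesgue_measure R).

Variables (A : T -> set R) (birth : nat -> T -> R) (lambda : R).
Hypothesis lambda0 : (0 < lambda)%R.
Hypothesis ppp : poisson_point_process P A (fun B => lambda%:E * mu B).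
Hypothesis enumA : {ae P, forall w, set_bij [set: nat] (A w) (birth ^~ w)}.

Variables (mark : nat -> T -> \bar R)
  (F : option nat -> set (set T)) (mark0 : S -> \bar R).
Hypotheses (indF : independent P F) (sF : forall o, sigma_algebra setT (F o))
  (Fm : forall o, F o `<=` measurable)
  (mbirth : forall n, fmeas (F None) (birth n))
  (mmark : forall n, fmeas (F (Some n)) (mark n))
  (mmark0 : measurable_fun setT mark0)
  (law_mark : forall n B, measurable B ->
     P (mark n @^-1` B) = Q (mark0 @^-1` B)).

Let rate := (lambda * mark_prob Q mark0)%R.

Let rate0 : (0 <= rate)%R.
Proof. by rewrite mulr_ge0 ?mark_prob_ge0// ltW. Qed.

Section windows.
Variables (I : eqType) (W : I -> set R) (len : I -> R).
Hypotheses (mW : forall i, measurable (W i)) (tW : trivIset setT W)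
  (lenW : forall i x, mu [set t | W i (t + x)%R] = (len i)%:E).

Let len_ge0 i : (0 <= rate * len i)%R.
Proof. by rewrite mulr_ge0// -lee_fin -(lenW i 0%R). Qed.

Let laplace_windows (s : seq I) (a : I -> R) : uniq s ->
  (forall i, (0 < a i)%R) ->
  \int[P]_w (\prod_(i <- s) expN ((a i)%:E * marked_count birth mark W i w))%:E =
  (\prod_(i <- s) expR (- (rate * len i * (1 - expR (- a i)))))%:E.
Proof.
move=> us a0.
exact: (laplace_marked_count lambda0 ppp enumA indF sF Fm mbirth mmark mmark0
  law_mark mW tW lenW us a0).
Qed.

Let mcount i : measurable_fun setT (marked_count birth mark W i).
Proof. exact: (measurable_marked_count Fm mbirth mmark mW). Qed.

Let ccount i w : is_count (marked_count birth mark W i w).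
Proof. exact: is_count_marked. Qed.

Lemma window_law i k :
  P (marked_count birth mark W i @^-1` [set k%:R%:E]) =
  poisson_law (rate * len i) k.
Proof.
exact: (@count_poisson_law _ _ _ P _ _ _ mcount ccount len_ge0 laplace_windows).
Qed.

Lemma window_fin i : {ae P, forall w, marked_count birth mark W i w != +oo}.
Proof.
exact: (@count_fin _ _ _ P _ _ _ mcount ccount len_ge0 laplace_windows).
Qed.

Lemma window_independent (B : I -> set (\bar R)) (s : seq I) :
  (forall i, measurable (B i)) -> uniq s ->
  P (\bigcap_(i in [set` s]) marked_count birth mark W i @^-1` B i) =
  \prod_(i <- s) P (marked_count birth mark W i @^-1` B i).
Proof.
exact: (@joint_count_independent _ _ _ P _ _ _ mcount ccount len_ge0
  laplace_windows).
Qed.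

End windows.

Let tau n w := (birth n w)%:E + mark n w.

(** The exit process once the detector has been absorbed into the marks. *)
Definition exit_count (t : R) (w : T) : \bar R :=
  \sum_(n <oo) (\1_[set s : \bar R | (0 <= s <= t%:E)%E] (tau n w))%:E.

Let icc (t : R) : set R := [set x | (0 <= x <= t)%R].

Let ioc (s t : R) : set R := [set x | (s < x <= t)%R].

Let micc t : measurable (icc t).
Proof.
by rewrite (_ : icc t = `[0%R, t]%classic)//; apply/seteqP; split => x;
  rewrite /icc /= in_itv.
Qed.

Let mioc s t : measurable (ioc s t).
Proof.
by rewrite (_ : ioc s t = `]s, t]%classic)//; apply/seteqP; split => x;
  rewrite /ioc /= in_itv.
Qed.

Let icc_len t x : (0 <= t)%R -> mu [set u | icc t (u + x)%R] = t%:E.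
Proof.
move=> t0; rewrite (_ : [set _ | _] = `[(- x)%R, (t - x)%R]%classic).
  rewrite lebesgue_measure_itv/= lte_fin; case: ltP => [_|].
    by rewrite -EFinB opprK subrK.
  by rewrite lerBlDr addNr => t0'; congr (_%:E); apply/eqP; rewrite eq_le t0 t0'.
by apply/seteqP; split => u; rewrite /icc /= in_itv/= lerBrDr -lerBlDr sub0r.
Qed.

Let ioc_len s t x : (s <= t)%R -> mu [set u | ioc s t (u + x)%R] = (t - s)%:E.
Proof.
move=> st; rewrite (_ : [set _ | _] = `](s - x)%R, (t - x)%R]%classic).
  rewrite lebesgue_measure_itv/= lte_fin; case: ltP => [_|].
    by rewrite -EFinB opprB addrA subrK.
  rewrite lerD2r => ts; congr (_%:E); apply/esym/eqP; rewrite subr_eq0.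
  by rewrite eq_le st ts.
by apply/seteqP; split => u; rewrite /ioc /= in_itv/= lerBrDr ltrBlDr.
Qed.

Let exit_countE t w :
  exit_count t w = marked_count birth mark (fun _ : unit => icc t) tt w.
Proof.
apply: eq_eseriesr => n _; rewrite !indicE -/(tau n w); congr (_%:R%:E).
congr nat_of_bool; apply/idP/idP => /set_mem H; apply/mem_set; move: H => /=.
  by case: (tau n w) => [r||]//=; rewrite ?lee_fin// => H; [exists r|rewrite andbF in H].
by move=> [r rt <-]; rewrite !lee_fin.
Qed.

Let trivU (B : set R) : trivIset setT (fun _ : unit => B).
Proof. by move=> [] []. Qed.

(** The window [0, t] is the disjoint union of [0, s] and ]s, t]; half-open windows are what makes
    successive increments disjoint. *)
Let countI s t w : (0 <= s)%R -> (s <= t)%R ->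
  exit_count t w = exit_count s w +
    marked_count birth mark (fun _ : unit => ioc s t) tt w.
Proof.
move=> s0 st; rewrite /exit_count /marked_count -nneseriesD//.
apply: eq_eseriesr => n _; rewrite -/(tau n w) -EFinD !indicE; congr (_%:E).
have iocE : (tau n w \in EFin @` ioc s t) = (s%:E < tau n w <= t%:E).
  apply/idP/idP => [/set_mem[r rst <-]|]; first by rewrite lte_fin lee_fin.
  case: (tau n w) => [r||]; rewrite ?andbF//= lte_fin lee_fin => rst.
  by apply/mem_set; exists r.
have iccE u : (tau n w \in [set s0 : \bar R | (0 <= s0 <= u%:E)%E]) = (0 <= tau n w <= u%:E).
  by apply/idP/idP => [/set_mem|H]//; exact/mem_set.
rewrite !iccE iocE; case: (leP (tau n w) s%:E) => [ts|ts] /=.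
  by rewrite (le_trans ts) ?lee_fin// addr0.
by rewrite andbF add0r (le_trans _ (ltW ts)) ?lee_fin.
Qed.

Lemma exit_count_increasing s t w : (s <= t)%R -> exit_count s w <= exit_count t w.
Proof.
move=> st; apply: lee_nneseries => [n _ _|n _]; first by rewrite lee_fin.
rewrite lee_fin !indicE ler_nat; case: (boolP (_ \in [set _ | _])) => // /set_mem/=.
by move=> /andP[t0 ts]; rewrite mem_set//= t0 (le_trans ts)// lee_fin.
Qed.

Let mexit t : measurable_fun setT (exit_count t).
Proof.
rewrite (_ : exit_count t = marked_count birth mark (fun _ : unit => icc t) tt).
  exact: (measurable_marked_count Fm mbirth mmark).
by apply/funext => w; exact: exit_countE.
Qed.

Let exit_fin t : (0 <= t)%R -> {ae P, forall w, exit_count t w != +oo}.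
Proof.
move=> t0.
have := @window_fin unit (fun _ => icc t) (fun _ => t) (fun _ => micc t)
  (@trivU (icc t)) (fun _ x => @icc_len t x t0) tt.
by apply: filterS => w; rewrite exit_countE.
Qed.

Let exit_count_is_count t w : is_count (exit_count t w).
Proof. by rewrite exit_countE; exact: is_count_marked. Qed.

(** The null event must not depend on [t]: finiteness at integer times suffices, by monotonicity. *)
Let exit_finite : {ae P, forall w, forall t, (0 <= t)%R -> exit_count t w != +oo}.
Proof.
have : {ae P, forall w, forall m : nat, exit_count m%:R w != +oo}.
  by apply/ae_foralln => m; exact: exit_fin.
apply: filterS => w H t t0.
have tm : (t <= (Num.truncn t).+1%:R)%R by exact/ltW/truncnS_gt.
have := exit_count_increasing w tm.
by move: (H (Num.truncn t).+1); case: (exit_count t w) => //; rewrite leye_eq => /negbTE ->.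
Qed.

(** Only almost sure, since cancelling in the extended reals needs a finite count at time [s]. *)
Let incrE s t : (0 <= s)%R -> (s <= t)%R -> {ae P, forall w,
  exit_count t w - exit_count s w =
  marked_count birth mark (fun _ : unit => ioc s t) tt w}.
Proof.
move=> s0 st; apply: filterS exit_finite => w /(_ s s0) sfin.
rewrite (countI w s0 st) addeAC subee ?add0e//.
by have [sy|[k ->]] := exit_count_is_count s w; first by rewrite sy eqxx in sfin.
Qed.

(** Only finitely many particles are counted up to [t + 1]. Each of them with exit time beyond [t]
    is missed by all [s] close enough to [t] on the right, so the count is constant there. *)
Lemma exit_count_right_continuous w t : (0 <= t)%R ->
  (forall t, (0 <= t)%R -> exit_count t w != +oo) ->
  exit_count s w @[s --> t^'+] --> exit_count t w.
Proof.
move=> t0 fin.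
pose E (u : R) := [set n | (0 <= tau n w <= u%:E)%E].
have cE u : exit_count u w = counting (E u).
  rewrite -nneseries_indic; apply: eq_eseriesr => n _; rewrite !indicE.
  by congr (_%:R%:E); congr nat_of_bool; apply/idP/idP => /set_mem/mem_set.
have t1 : (0 <= t + 1)%R by rewrite addr_ge0.
have finE : finite_set (E (t + 1)%R).
  have := fin _ t1; rewrite cE /counting; case: ifPn => [/asboolP//|_].
  by rewrite eqxx.
have nearE n : \forall s \near t^'+, tau n w <= s%:E -> tau n w <= t%:E.
  case: (leP (tau n w) t%:E) => [le_t|]; first exact: nearW.
  case: (tau n w) => [r||]//; last by move=> _; exact: nearW.
  rewrite lte_fin => tr; near=> s; rewrite lee_fin => rs; exfalso.
  have : (s < r)%R by near: s; exact: nbhs_right_lt.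
  by rewrite ltNge rs.
have nearA : \forall s \near t^'+, (\bigcap_(n in E (t + 1)%R)
    [set s | tau n w <= s%:E -> tau n w <= t%:E]) s.
  rewrite -(fset_setK finE); apply: filter_bigI => n _; exact: nearE.
apply: cvg_near_cst; near=> s.
have ts : (t <= s)%R by near: s; exact: nbhs_right_ge.
have st1 : (s <= t + 1)%R by near: s; apply: nbhs_right_le; rewrite ltrDl.
rewrite !cE; congr counting; apply/seteqP; split => n /= /andP[n0 ns]; rewrite /E /= n0/=.
  have En : E (t + 1)%R n by rewrite /E /= n0 (le_trans ns)// lee_fin.
  suff : (\bigcap_(n in E (t + 1)%R)
    [set s | tau n w <= s%:E -> tau n w <= t%:E]) s by move/(_ n En); exact.
  by near: s.
by rewrite (le_trans ns)// lee_fin.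
Unshelve. all: by end_near. Qed.

Theorem poisson_process_exit_count : poisson_process P rate exit_count.
Proof.
split.
- by move=> t _; exact: mexit.
(* At time 0 the window is [0, 0], of length 0, and the Poisson law of mean 0 puts all its mass on
   the count 0. *)
- have := @window_law unit (fun _ => icc 0%R) (fun _ => 0%R) (fun _ => micc 0%R)
    (@trivU (icc 0%R)) (fun _ x => @icc_len 0%R x (lexx 0%R)) tt 0%N.
  rewrite mulr0 poisson_lawE// expr0 fact0 invr1 mulr1 oppr0 expR0 mul1r => P0.
  have m0 : measurable (exit_count 0%R @^-1` [set 0%:E]).
    by rewrite -[_ @^-1` _]setTI; exact: mexit.
  exists (~` (exit_count 0%R @^-1` [set 0%:E])); split.
  + exact: measurableC.
  + rewrite probability_setC// (_ : P _ = 1) ?subee//.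
    rewrite -[RHS]P0; congr (P _); apply/seteqP; split => w /=.
      by rewrite exit_countE.
    by rewrite exit_countE.
  + by move=> w /=.
- apply: filterS exit_finite => w H t /H.
  by have [->|] := exit_count_is_count t w; first by rewrite eqxx.
- by apply: aeW => w s t _ st; exact: exit_count_increasing.
- by apply: filterS exit_finite => w H t t0; exact: exit_count_right_continuous.
- move=> k t t0 ti s E us FE.
  have tge0 i : (0 <= t i)%R.
    by elim: i => // i /le_trans; apply; exact: ti.
  have tmono i j : (i <= j)%N -> (t i <= t j)%R.
    by apply: (@homo_leq _ t (fun x y => x <= y)%R) => // y x z; exact: le_trans.
  pose W (i : 'I_k) := ioc (t i) (t i.+1).
  have tW : trivIset setT W.
    move=> i j _ _ [x [/= /andP[tix xti] /andP[tjx xtj]]].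
    apply/val_inj/eqP; rewrite eqn_leq; apply/andP; split; rewrite leqNgt; apply/negP => ij.
      by have := lt_le_trans tix (le_trans xtj (tmono _ _ ij)); rewrite ltxx.
    by have := lt_le_trans tjx (le_trans xti (tmono _ _ ij)); rewrite ltxx.
  have lenW i x : mu [set u | W i (u + x)%R] = (t (val i).+1 - t (val i))%:E.
    exact: ioc_len.
  pose N i := marked_count birth mark W i.
  have mN i : measurable_fun setT (N i).
    by apply: (measurable_marked_count Fm mbirth mmark) => j; exact: mioc.
  (* The product rule for windows wants a measurable set at every index, hence [setT] outside
     [s]. *)
  have /choice[B HB] : forall i : 'I_k, exists B : set (\bar R), measurable B /\
      (i \in s -> (fun w => exit_count (t i.+1) w - exit_count (t i) w) @^-1` B = E i).
    move=> i.
    have [is_|nis] := boolP (i \in s); last by exists setT; split.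
    have [B mB BE] := FE i is_.
    by exists B; split => // _; rewrite -BE setTI.
  have mB (i : 'I_k) : measurable (B i) by have [] := HB i.
  have BE (i : 'I_k) : i \in s -> (fun w => exit_count (t i.+1) w - exit_count (t i) w) @^-1` B i = E i.
    by have [] := HB i.
  have mD (i : 'I_k) : measurable_fun setT (fun w => exit_count (t i.+1) w - exit_count (t i) w).
    exact: emeasurable_funB.
  have mDB (i : 'I_k) : measurable ((fun w => exit_count (t i.+1) w - exit_count (t i) w) @^-1` B i).
    by rewrite -[_ @^-1` _]setTI; exact: mD.
  have mNB (i : 'I_k) : measurable (N i @^-1` B i) by rewrite -[_ @^-1` _]setTI; exact: mN.
  have DN (i : 'I_k) : {ae P, forall w, exit_count (t i.+1) w - exit_count (t i) w = N i w}.
    exact: incrE.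
  transitivity (P (\bigcap_(i in [set` s]) N i @^-1` B i)).
    apply: ae_eq_measure.
    + by apply: fin_bigcap_measurable => // i /= is_; rewrite -BE.
    + by apply: fin_bigcap_measurable.
    (* Almost sure statements are combined over [nat], so the ordinal is quantified through its
       value. *)
    have : {ae P, forall w, forall n : nat, forall i : 'I_k, val i = n ->
        exit_count (t i.+1) w - exit_count (t i) w = N i w}.
      apply/ae_foralln => n; have [nk|kn] := ltnP n k; last first.
        by apply: aeW => w i iE; have := ltn_ord i; rewrite iE ltnNge kn.
      have := DN (Ordinal nk); apply: filterS => w H i iE.
      by rewrite (_ : i = Ordinal nk)//; exact: val_inj.
    apply: filterS => w H; split => HB' i /= is_.
      by have := HB' i is_; rewrite -BE//= (H i i).
    by have := HB' i is_; rewrite -BE//= (H i i).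
  rewrite (window_independent _ tW lenW)//; last by move=> i; exact: mioc.
  rewrite big_seq [RHS]big_seq; apply: eq_bigr => i is_.
  apply: ae_eq_measure => //; first by rewrite -BE.
  by apply: filterS (DN i) => w H; rewrite -BE//= H.
- move=> s t s0 st k.
  have := @window_law unit (fun _ => ioc s t) (fun _ => (t - s)%R) (fun _ => mioc s t)
    (@trivU (ioc s t)) (fun _ x => @ioc_len s t x st) tt k.
  move=> <-.
  apply: ae_eq_measure.
  + have mD : measurable_fun setT (fun w => exit_count t w - exit_count s w).
      exact: emeasurable_funB.
    by have := mD measurableT _ (emeasurable_set1 k%:R%:E); rewrite setTI.
  + have mN : measurable_fun setT (marked_count birth mark (fun _ : unit => ioc s t) tt).
      exact: (measurable_marked_count Fm mbirth mmark).
    by have := mN measurableT _ (emeasurable_set1 k%:R%:E); rewrite setTI.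
  + by apply: filterS (incrE s0 st) => w /= ->.
Qed.

End poisson_of_marks.

(** * Measurability of the exit mark *)

Section sigma_algebra_countable.
Context (T : Type) (F : set (set T)).
Hypothesis sF : sigma_algebra setT F.

Lemma sigma_algebra_bigcup_countable (I : countType) (A : I -> set T) :
  (forall i, F (A i)) -> F (\bigcup_i A i).
Proof.
move=> FA.
pose B n := if unpickle n is Some i then A i else set0.
rewrite (_ : \bigcup_i A i = \bigcup_n B n).
  apply: sigma_algebra_bigcupT => // n; rewrite /B.
  by case: unpickle => [i|] //; case: sF.
apply/seteqP; split=> [x [i _ Aix]|x [n _]].
  by exists (pickle i) => //; rewrite /B pickleK.
by rewrite /B; case: unpickle => [i|]// Aix; exists i.
Qed.

Lemma sigma_algebra_if (c : Prop) (A : set T) : F A -> F [set x | c /\ A x].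
Proof.
move=> FA; have [hc|nc] := pselect c.
  by rewrite (_ : [set _ | _] = A)//; apply/seteqP; split => [x []|x].
rewrite (_ : [set _ | _] = set0); first by case: sF.
by apply/seteqP; split => [x []|].
Qed.

Lemma fmeas_ereal (R : realType) (f : T -> \bar R) :
  (forall r : R, F [set x | (f x < r%:E)%E]) -> fmeas F f.
Proof.
move=> Ff.
have sI := sigma_algebra_image f sF.
suff H : (@measurable _ (\bar R)) `<=` image_set_system setT f F.
  by move=> B /H; rewrite /image_set_system /= setTI.
have -> : @measurable _ (\bar R) = <<s @ErealGenInftyO.G R >>.
  exact: ErealGenInftyO.measurableE.
apply: smallest_sub => // _ [r ->]; rewrite /image_set_system /= setTI.
exact: Ff.
Qed.

Lemma fmeas_real (R : realType) (f : T -> R) :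
  (forall U : set R, open U -> F (f @^-1` U)) -> fmeas F f.
Proof.
move=> Ff.
have sI := sigma_algebra_image f sF.
suff H : (@measurable _ R) `<=` image_set_system setT f F.
  by move=> B /H; rewrite /image_set_system /= setTI.
have -> : @measurable _ R = <<s @RGenOpens.G R >>.
  exact: RGenOpens.measurableE.
apply: smallest_sub => // _ [x [y ->]]; rewrite /image_set_system /= setTI.
by apply: Ff; exact: interval_open.
Qed.

End sigma_algebra_countable.

(** * Borel sets of R^d through coordinates *)

Section borel_rV.
Context (R : realType) (d : nat) (T : Type) (F : set (set T)).
Hypothesis sF : sigma_algebra setT F.

Lemma borel_sub (v : T -> 'rV[R]_d) :
  (forall U, open U -> F (v @^-1` U)) -> forall B, borel B -> F (v @^-1` B).
Proof.
move=> FU.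
have sI := sigma_algebra_image v sF.
suff H : @borel R d `<=` image_set_system setT v F.
  by move=> B /H; rewrite /image_set_system /= setTI.
apply: smallest_sub => // U oU; rewrite /image_set_system /= setTI.
exact: FU.
Qed.

Lemma open_borel (U : set 'rV[R]_d) : open U -> borel U.
Proof. by move=> oU; exact: sub_sigma_algebra. Qed.

Lemma fmeas_continuous_borel (v : T -> 'rV[R]_d) (g : 'rV[R]_d -> R) :
  (forall B, borel B -> F (v @^-1` B)) -> continuous g -> fmeas F (g \o v).
Proof.
move=> Fv cg; apply: fmeas_real => // U oU; rewrite comp_preimage.
by apply: Fv; apply: open_borel; apply: (continuousP _).1 => //.
Qed.

(** An open set is the countable union of the rational boxes it contains, and a box is a finite
    condition on coordinates. *)
Lemma borel_coord (v : T -> 'rV[R]_d) :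
  (forall i, fmeas F (fun x => v x 0 i)) -> forall B, borel B -> F (v @^-1` B).
Proof.
move=> Fv; apply: borel_sub => U oU.
pose box (qr : 'rV[rat]_d * rat) : set 'rV[R]_d :=
  [set x | forall i, `|x 0 i - ratr (qr.1 0 i)| < ratr qr.2].
rewrite (_ : v @^-1` U = \bigcup_qr
    [set x | box qr `<=` U /\ (v @^-1` box qr) x]); last first.
  apply/seteqP; split => [x Ux|x [qr _ [qU qx]]]; last exact: qU.
  have /nbhs_ballP[e /= e0 eU] : nbhs (v x) U by exact: open_nbhs_nbhs.
  have /rat_in_itvoo[r] : 0 < e / 2 by rewrite divr_gt0.
  rewrite in_itv/= => /andP[r0 re].
  have /choice[q Hq] : forall i, exists q : rat, `|v x 0 i - ratr q| < ratr r.
    move=> i; have /rat_in_itvoo[q] : v x 0 i - ratr r < v x 0 i + ratr r.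
      by rewrite ltrD2l gtrN.
    by rewrite in_itv/= => qi; exists q; rewrite distrC ltr_distl.
  exists (\row_i q i, r) => //; split; last by move=> i /=; rewrite mxE.
  move=> y yb; apply: eU; split => // i j; rewrite ord1 /ball/=.
  have := yb j; rewrite /= mxE => yj.
  rewrite (splitr e) -(subrKA (ratr (q j))) (le_lt_trans (ler_normD _ _))//.
  by rewrite ltrD ?(lt_trans (Hq j))// distrC (lt_trans yj).
apply: sigma_algebra_bigcup_countable => // qr; apply: sigma_algebra_if => //.
rewrite (_ : v @^-1` box qr = ~` \bigcup_(i : 'I_d)
   ((fun x => v x 0 i) @^-1` ~` [set y | `|y - ratr (qr.1 0 i)| < ratr qr.2])).
  apply: sigma_algebra_setC => //; apply: sigma_algebra_bigcup_countable => // i.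
  apply: Fv; apply: measurableC; apply: open_measurable.
  rewrite (_ : [set _ | _] = ball (ratr (qr.1 0 i) : R) (ratr qr.2)); first exact: ball_open.
  by apply/seteqP; split => y; rewrite /ball/= distrC.
apply/seteqP; split => [x bx [i _ /=]|x nx i]; first by apply; exact: bx.
by apply: contrapT => ni; apply: nx; exists i.
Qed.

End borel_rV.

(** * Compactness and continuity of paths in epsilon form *)

Section path_lemmas.
Context (R : realType).

Lemma segment_cluster (a b : R) (u : nat -> R) : (forall n, a <= u n <= b) ->
  exists2 x, a <= x <= b & forall e, 0 < e -> forall N,
    exists2 n, (N <= n)%N & `|x - u n| < e.
Proof.
move=> uab; have := @segment_compact R a b.
move=> /(_ (u @ \oo) _ _)[].
  by exists 0%N => // n _ /=; rewrite in_itv/= uab.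
move=> x [/=]; rewrite in_itv/= => xab clx; exists x => // e e0 N.
have [||y [[n /= Nn <-] xy]] := clx (u @` [set n | (N <= n)%N]) (ball x e).
- by exists N => // n /= Nn; exists n.
- exact: nbhsx_ballx.
by exists n.
Qed.

Lemma within_continuousP (V : normedModType R) (z : R -> V) (x : R) :
  {within `[0, +oo[, continuous z} -> 0 <= x -> forall e, 0 < e ->
  exists2 del, 0 < del & forall y, 0 <= y -> `|x - y| < del -> `|z x - z y| < e.
Proof.
move=> /subspace_continuousP cz x0 e e0.
have xin : `[0, +oo[%classic x by rewrite /= in_itv/= x0.
have /cvgrPdist_lt/(_ e e0) := cz x xin.
rewrite /prop_near1 /within/= => /nbhs_ballP[del /= del0 H].
exists del => // y y0 xy; apply: H => //; by rewrite in_itv/= y0.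
Qed.

Lemma eps_nat (e : R) : 0 < e -> exists n : nat, (n.+1%:R)^-1 < e.
Proof.
move=> e0; exists (Num.truncn e^-1); rewrite invf_plt ?posrE//.
exact: truncnS_gt.
Qed.

End path_lemmas.

Section enlargement.
Context (R : realType) (d : nat).
Implicit Types C : set 'rV[R]_d.+1.

(** Membership of a limit in a closed set is tested on approximating points, which need not lie in
    the set themselves but do enter its open neighbourhoods. *)
Definition enlarge C (l : nat) : set 'rV[R]_d.+1 :=
  [set x | exists2 y, C y & `|x - y| < l.+1%:R^-1].

Lemma enlarge_open C l : open (enlarge C l).
Proof.
rewrite (_ : enlarge C l = \bigcup_(y in C) ball y l.+1%:R^-1).
  by apply: bigcup_open => y _; exact: ball_open.
apply/seteqP; split => x [y Cy xy]; exists y => //; move: xy;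
  by rewrite -ball_normE /ball_/= distrC.
Qed.

Lemma enlargeP C x : closed C ->
  (forall e, 0 < e -> exists x', `|x - x'| < e /\
     exists l, l.+1%:R^-1 < e /\ enlarge C l x') -> C x.
Proof.
move=> cC H; apply: contrapT => nCx.
have /nbhs_ballP[e /= e0 eC] : nbhs x (~` C).
  by apply: open_nbhs_nbhs; split => //; exact: closed_openC.
have e20 : 0 < e / 2 by rewrite divr_gt0.
have [x' [xx' [l [le [y Cy x'y]]]]] := H _ e20.
apply: (eC y) Cy; rewrite -ball_normE /ball_/= (splitr e) -(subrKA x').
by rewrite (le_lt_trans (ler_normD _ _))// ltrD// (lt_trans x'y).
Qed.

End enlargement.

(** * The exit time and the exit location as measurable functionals of the path *)

Section exit_mark.
Context (R : realType) (d : nat).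
Variables (O D : set 'rV[R]_d.+1).
Implicit Types z : R -> 'rV[R]_d.+1.

(* Time and location of the exit of a path starting at time 0 in one number:
   the exit time if the exit is through [D], [+oo] otherwise. *)
Definition exit_mark z : \bar R :=
  let s := exit_time O 0 z in
  if (s < +oo)%E && `[< D (z (fine s)) >] then s else +oo%E.

Lemma exit_time_ge0 z : (0 <= exit_time O 0 z)%E.
Proof.
by apply: le_ereal_inf_tmp => _ [t [t0 _] <-]; rewrite lee_fin ltW.
Qed.

Lemma exit_time_ltP z (t : R) :
  (exit_time O 0 z < t%:E)%E <-> exists u, [/\ 0 < u, u < t & ~ O (z u)].
Proof.
split=> [/ereal_inf_lt[_ [u [u0 nO] <-]]|[u [u0 ut nO]]].
  by rewrite lte_fin => ut; exists u.
rewrite (@le_lt_trans _ _ u%:E) ?lte_fin//.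
by apply: ereal_inf_lbound; exists u.
Qed.

Lemma exit_mark_fin z : exit_mark z \is a fin_num =
  ((exit_time O 0 z < +oo)%E && `[< D (z (fine (exit_time O 0 z))) >]).
Proof.
rewrite /exit_mark; case: ifP => // /andP[s _].
by rewrite ge0_fin_numE ?exit_time_ge0.
Qed.

Lemma exit_time_shift (t0 : R) z :
  exit_time O t0 z = (t0%:E + exit_time O 0 (fun t => z (t0 + t)%R))%E.
Proof.
apply/eqP; rewrite eq_le; apply/andP; split.
  rewrite -leeBlDl//; apply: le_ereal_inf_tmp => _ [t [t_gt0 nO] <-].
  rewrite leeBlDl// -EFinD; apply: ereal_inf_lbound; exists (t0 + t) => //.
  by split => //; rewrite ltrDl.
apply: le_ereal_inf_tmp => _ [t [t_gt0 nO] <-].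
rewrite -leeBrDl// -EFinB; apply: ereal_inf_lbound; exists (t - t0) => //.
by split; [rewrite subr_gt0|rewrite subrKC].
Qed.

(** The test on the location is absorbed into the mark: no exit, or an exit elsewhere, puts the sum
    at [+oo], beyond every [t]. *)
Lemma exit_mark_indic (t0 t : R) z :
  \1_[set s : \bar R | (0 <= s <= t%:E)%E] (exit_time O t0 z) *
    \1_D (z (fine (exit_time O t0 z))) =
  \1_[set s : \bar R | (0 <= s <= t%:E)%E]
    (t0%:E + exit_mark (fun u => z (t0 + u)%R))%E :> R.
Proof.
rewrite exit_time_shift /exit_mark.
have := exit_time_ge0 (fun u => z (t0 + u)).
case: (exit_time O 0 _) => [s||]//= s0.
  rewrite ltry/=; case: asboolP => [Ds|nDs]; rewrite [X in _ * X]indicE.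
    by rewrite mem_set ?mulr1.
  by rewrite memNset// mulr0 addey// indicE memNset//= leye_eq andbF.
by rewrite addey// indicE memNset ?mul0r//= leye_eq andbF.
Qed.

Section measurability.
Context (T : Type) (F : set (set T)) (Z : R -> T -> 'rV[R]_d.+1).
Hypotheses (sF : sigma_algebra setT F) (oO : open O) (bD : borel D)
  (cZ : forall w, {within `[0, +oo[, continuous (Z ^~ w)})
  (FZ : forall t B, 0 <= t -> borel B -> F (Z t @^-1` B)).

Let tau w := exit_time O 0 (Z ^~ w).

Lemma fmeas_exit_time : fmeas F tau.
Proof.
apply: fmeas_ereal => // t.
(* By compactness, the path leaves the open set [O] at a time of a rational
   interval [p.1, p.2] iff it comes arbitrarily close to its complement at
   rational times of this interval. *)
rewrite (_ : [set _ | _] = \bigcup_(p : rat * rat)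
  [set w | (0 < ratr p.1 :> R /\ ratr p.1 < ratr p.2 :> R /\ ratr p.2 < t) /\
     (\bigcap_l \bigcup_(q : rat)
       [set w | (ratr p.1 <= (ratr q : R) <= ratr p.2) /\
          (Z (ratr q) @^-1` enlarge (~` O) l) w]) w]); last first.
  apply/seteqP; split => [w /exit_time_ltP[u [u0 ut nO]]|w].
    have /rat_in_itvoo[p1] := u0; rewrite in_itv/= => /andP[p10 p1u].
    have /rat_in_itvoo[p2] := ut; rewrite in_itv/= => /andP[p2u p2t].
    exists (p1, p2) => //; split; first by rewrite p10 (lt_trans p1u p2u).
    move=> l _; have l0 : 0 < l.+1%:R^-1 :> R by rewrite invr_gt0.
    have [del del0 Hd] := within_continuousP (@cZ w) (ltW u0) l0.
    have /rat_in_itvoo[q] : Num.max (ratr p1) (u - del) < u.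
      by rewrite gt_max p1u ltrBlDr ltrDl.
    rewrite in_itv/= gt_max => /andP[/andP[p1q uq] qu].
    exists q => //; split; first by rewrite (ltW p1q) ltW// (lt_trans qu).
    exists (Z u w) => //; rewrite distrC; apply: Hd.
      by rewrite (le_trans (ltW p10)) ?ltW.
    by rewrite ger0_norm ?subr_ge0 ?(ltW qu)// ltrBlDr addrC -ltrBlDr.
  move=> [[p1 p2] _ [/= [p10 [p12 p2t]] H]]; apply/exit_time_ltP.
  have /choice[q Hq] : forall l, exists q : rat, (ratr p1 <= (ratr q : R) <= ratr p2) /\
      enlarge (~` O) l (Z (ratr q) w).
    by move=> l; have [q _ Hq] := H l I; exists q.
  have [|u /andP[p1u up2] clu] := @segment_cluster R (ratr p1) (ratr p2) (ratr \o q).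
    by move=> n; have [] := Hq n.
  have u0 : 0 < u by rewrite (lt_le_trans p10).
  exists u; split => //; first by rewrite (le_lt_trans up2).
  suff : (~` O) (Z u w) by [].
  apply: enlargeP; first exact: open_closedC.
  move=> e e0; have [del del0 Hd] := within_continuousP (@cZ w) (ltW u0) e0.
  have [N Ne] := eps_nat e0.
  have [n Nn un] := clu _ del0 N.
  exists (Z (ratr (q n)) w); split.
    apply: Hd => //; have [/andP[+ _] _] := Hq n; apply: le_trans; exact: ltW.
  exists n; split; last by have [] := Hq n.
  by rewrite (le_lt_trans _ Ne)// lef_pV2 ?posrE// ler_nat.
(* Measurability of [Z] is known at nonnegative times only; negative rationals contribute the empty
   set. *)
apply: sigma_algebra_bigcup_countable => // p; have [p0|p0] := leP 0 (ratr p.1 : R).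
  apply: sigma_algebra_if => //; apply: sigma_algebra_bigcapT => // l.
  apply: sigma_algebra_bigcup_countable => // q.
  have [q0|q0] := leP 0 (ratr q : R).
    apply: sigma_algebra_if => //; apply: FZ => //.
    by apply: open_borel; exact: enlarge_open.
  rewrite (_ : [set _ | _] = set0); first by case: sF.
  apply/seteqP; split => // w [/andP[pq _] _].
  by have := le_lt_trans (le_trans p0 pq) q0; rewrite ltxx.
rewrite (_ : [set _ | _] = set0); first by case: sF.
by apply/seteqP; split => // w [[+ _] _]; rewrite ltNge (ltW p0).
Qed.

Let exits : set T := [set w | (tau w < +oo)%E].

Let Fexits : F exits.
Proof.
rewrite (_ : exits = ~` (tau @^-1` [set +oo%E])).
  by apply: sigma_algebra_setC => //; apply: fmeas_exit_time; exact: emeasurable_set1.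
by apply/seteqP; split => w; rewrite /exits /= ltey => /eqP.
Qed.

Let Flocation_closed C : closed C ->
  F (exits `&` [set w | C (Z (fine (tau w)) w)]).
Proof.
(* The exit location is the limit of the positions at the first time after
   [tau] on the grid of step 1/(m+1). *)
move=> cC; pose g (m k : nat) : R := k%:R / m.+1%:R.
have g0 m k : 0 <= g m k by rewrite divr_ge0.
rewrite (_ : _ `&` _ = exits `&` \bigcap_l \bigcup_M \bigcap_(m in [set m | (M <= m)%N])
   \bigcup_k ([set w | ((g m k)%:E <= tau w < (g m k.+1)%:E)%E] `&`
       (Z (g m k.+1) @^-1` enlarge C l))).
  apply: sigma_algebra_setI => //; apply: sigma_algebra_bigcapT => // l.
  apply: sigma_algebra_bigcupT => // M; apply: sigma_algebra_bigcap_cond => // m _.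
  apply: sigma_algebra_bigcupT => // k; apply: sigma_algebra_setI => //.
    apply: (fmeas_exit_time (B := [set x | ((g m k)%:E <= x < (g m k.+1)%:E)%E])).
    rewrite (_ : [set _ | _] = `[(g m k)%:E, (g m k.+1)%:E[%classic)//.
    exact: emeasurable_itv.
  by apply: FZ => //; apply: open_borel; exact: enlarge_open.
apply/seteqP; split => w [ew].
  move=> Cw; split => // l _.
  have s0 : 0 <= fine (tau w) by rewrite fine_ge0// exit_time_ge0.
  have sE : tau w = (fine (tau w))%:E.
    by rewrite fineK// ge0_fin_numE// exit_time_ge0.
  have l0 : 0 < l.+1%:R^-1 :> R by rewrite invr_gt0.
  have [del del0 Hd] := within_continuousP (@cZ w) s0 l0.
  have [M Md] := eps_nat del0.
  exists M => // m /= Mm; set s := fine (tau w) in s0 sE Cw Hd *.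
  have m0 : 0 < m.+1%:R :> R by [].
  have sm0 : 0 <= s * m.+1%:R by rewrite mulr_ge0.
  have ks : g m (Num.truncn (s * m.+1%:R)) <= s.
    by rewrite ler_pdivrMr// truncn_le.
  have sk : s < g m (Num.truncn (s * m.+1%:R)).+1.
    by rewrite ltr_pdivlMr// truncnS_gt.
  exists (Num.truncn (s * m.+1%:R)) => //; split.
    by rewrite /= sE lee_fin lte_fin ks sk.
  exists (Z s w) => //; rewrite distrC; apply: Hd => //.
  rewrite distrC ger0_norm ?subr_ge0 ?(ltW sk)//.
  apply: le_lt_trans Md.
  apply: (@le_trans _ _ (g m (Num.truncn (s * m.+1%:R)).+1 - g m (Num.truncn (s * m.+1%:R)))).
    by rewrite lerD2l lerN2.
  rewrite /g -mulrBl -natrB ?leqnSn// subSnn mul1r.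
  by rewrite lef_pV2 ?posrE// ler_nat.
move=> H; split => //=.
have s0 : 0 <= fine (tau w) by rewrite fine_ge0// exit_time_ge0.
have sE : tau w = (fine (tau w))%:E.
  by rewrite fineK// ge0_fin_numE// exit_time_ge0.
apply: enlargeP => // e e0.
have [del del0 Hd] := within_continuousP (@cZ w) s0 e0.
have [l le] := eps_nat e0.
have [M' M'd] := eps_nat del0.
have [M _ HM] := H l I.
(* This grid is fine enough both for the position to lie in the enlargement and for its step to be
   below the modulus of continuity [del]. *)
have [k _ [/= ktau Zk]] := HM (maxn M M') (leq_maxl M M').
exists (Z (g (maxn M M') k.+1) w); split; last by exists l.
apply: Hd => //; move: ktau; rewrite sE lee_fin lte_fin => /andP[ks sk].
rewrite distrC ger0_norm ?subr_ge0 ?(ltW sk)//.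
apply: le_lt_trans M'd.
apply: (@le_trans _ _ (g (maxn M M') k.+1 - g (maxn M M') k)).
  by rewrite lerD2l lerN2.
rewrite /g -mulrBl -natrB ?leqnSn// subSnn mul1r.
by rewrite lef_pV2 ?posrE// ler_nat ltnS leq_maxr.
Qed.

(** The sets [B] with this property form a sigma-algebra, complements being taken inside [exits]; an
    open set is reached through its closed complement. *)
Let Flocation B : borel B -> F (exits `&` [set w | B (Z (fine (tau w)) w)]).
Proof.
suff : @borel R d.+1 `<=` [set B | F (exits `&` [set w | B (Z (fine (tau w)) w)])].
  by apply.
move=> {B}; apply: smallest_sub => [|U oU].
  split.
  - by rewrite /= (_ : _ `&` _ = set0); [case: sF|apply/seteqP; split => // x []].
  - move=> B /= FB.
    rewrite (_ : _ `&` _ = exits `&` ~` (exits `&` [set w | B (Z (fine (tau w)) w)])).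
      by apply: sigma_algebra_setI => //; exact: sigma_algebra_setC.
    apply/seteqP; split => [w [ew [_ nB]]|w [ew nB]]; split => //.
      by move=> [_]; exact: nB.
    by split => // Bw; apply: nB.
  - move=> B FB /=.
    rewrite (_ : _ `&` _ = \bigcup_n (exits `&` [set w | B n (Z (fine (tau w)) w)])).
      exact: sigma_algebra_bigcupT.
    by apply/seteqP; split => [w [ew [n _ Bn]]|w [n _ [ew Bn]]];
      [exists n|split => //; exists n].
rewrite /= (_ : _ `&` _ = exits `&` ~` (exits `&` [set w | (~` U) (Z (fine (tau w)) w)])).
  apply: sigma_algebra_setI => //; apply: sigma_algebra_setC => //.
  by apply: Flocation_closed; exact: open_closedC.
apply/seteqP; split => [w [ew Uw]|w [ew nU]]; split => //.
  by move=> [_]; apply.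
by apply: contrapT => nUw; apply: nU.
Qed.

Lemma fmeas_exit_mark : fmeas F (fun w => exit_mark (Z ^~ w)).
Proof.
move=> B mB.
pose V := exits `&` [set w | D (Z (fine (tau w)) w)].
have FV : F V by exact: Flocation.
rewrite (_ : _ @^-1` B = (V `&` tau @^-1` B) `|` [set w | B +oo%E /\ (~` V) w]).
  apply: sigma_algebra_setU => //.
    by apply: sigma_algebra_setI => //; exact: fmeas_exit_time.
  by apply: sigma_algebra_if => //; exact: sigma_algebra_setC.
apply/seteqP; split => w; rewrite /= /exit_mark -/(tau w).
  case: ifPn => [/andP[ew /asboolP Dw] Bw|/negP nV Bw]; first by left.
  by right; split => // -[ew Dw]; apply: nV; rewrite ew; exact/asboolP.
move=> [[[ew Dw] Bw]|[By nV]].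
  by rewrite [X in X && _]ew/=; case: asboolP.
by case: ifPn => // /andP[ew /asboolP Dw]; exfalso; apply: nV.
Qed.

End measurability.
End exit_mark.

(** * Convergence of the Euler scheme *)

Section local_lipschitz.
Context (R : realType) (d : nat).
Implicit Types x y : 'rV[R]_d.+1.

Lemma coord_le_norm x i : `|x 0 i| <= `|x|.
Proof. by rewrite [leRHS]/Num.norm /= mx_normrE; apply/bigmax_geP; right => /=; exists (0, i). Qed.

Lemma norm_le_coord x (M : R) : 0 <= M -> (forall i, `|x 0 i| <= M) -> `|x| <= M.
Proof.
move=> M0 H; rewrite [leLHS]/Num.norm /= mx_normrE; apply/bigmax_leP; split => // -[i j] _ /=.
by rewrite ord1.
Qed.

Lemma compact_norm_ball (M : R) : compact [set x : 'rV[R]_d.+1 | `|x| <= M].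
Proof.
apply: bounded_closed_compact.
  exists M; split; first exact: num_real.
  by move=> N MN x /= xM; rewrite (le_trans xM)// ltW.
rewrite (_ : [set _ | _] = Num.norm @^-1` [set t | t <= M])//.
by apply: preimage_closed => [x _|]; [exact: norm_continuous|exact: closed_le].
Qed.

Lemma continuous_bounded_ball (f : 'rV[R]_d.+1 -> R) (M : R) :
  continuous f -> exists2 L, 0 <= L & forall x, `|x| <= M -> `|f x| <= L.
Proof.
move=> cf; have [M0|M0] := leP 0 M; last first.
  by exists 0 => // x xM; have := le_lt_trans xM M0; rewrite ltNge normr_ge0.
have [||c _ Hc] := @EVT_max_rV R d.+1 (fun x => `|f x|) _ _ (@compact_norm_ball M).
- by exists 0; rewrite /= normr0.
- apply: continuous_subspaceT => x.
  by apply: continuous_comp; [exact: cf|exact: norm_continuous].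
- by exists `|f c| => // x xM; apply: Hc; rewrite inE.
Qed.

Variable f : 'rV[R]_d.+1 -> R.
Hypotheses (df : forall i x, derivable f x (delta_mx 0 i))
  (cf : forall i, continuous (partial i f)).

Lemma is_derive_line (p : 'rV[R]_d.+1) (i : 'I_d.+1) (s : R) :
  is_derive s 1 (fun s => f (p + s *: delta_mx 0 i))
    (partial i f (p + s *: delta_mx 0 i)).
Proof.
have E : (fun h : R => h^-1 *: (((fun s => f (p + s *: delta_mx 0 i)) \o shift s)
    (h *: (1 : R)) - f (p + s *: delta_mx 0 i))) =
  (fun h : R => h^-1 *: ((f \o shift (p + s *: delta_mx 0 i)) (h *: delta_mx 0 i) -
    f (p + s *: delta_mx 0 i))).
  apply/funext => h /=; congr (_ *: (f _ - _)).
  by rewrite [h *: 1]mulr1 scalerDl addrC -addrA; congr (_ + _); rewrite addrC.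
split; first by rewrite /derivable E; exact: df.
by rewrite /derive E.
Qed.

(** Mean value theorem along a coordinate. The two conditions on [s] describe the segment between 0
    and [a] for either sign of [a]. *)
Lemma line_lipschitz (p : 'rV[R]_d.+1) (i : 'I_d.+1) (a L : R) :
  (forall s, `|s| <= `|a| -> 0 <= s * a ->
     `|partial i f (p + s *: delta_mx 0 i)| <= L) ->
  `|f (p + a *: delta_mx 0 i) - f p| <= L * `|a|.
Proof.
move=> H; pose g (s : R) : R := f (p + s *: delta_mx 0 i).
have g0 : f p = g 0 by rewrite /g scale0r addr0.
have dg (s : R) : is_derive s 1 g (partial i f (p + s *: delta_mx 0 i)).
  exact: is_derive_line.
have cg : continuous g.
  by move=> s; apply/differentiable_continuous/derivable1_diffP; case: (dg s).
rewrite g0 -/(g a); have [a0|a0] := leP 0 a.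
  have [|c] := MVT_segment a0 (fun s _ => dg s); first exact: continuous_subspaceT.
  rewrite in_itv/= => /andP[c0 ca] ->; rewrite subr0 normrM ler_wpM2r//.
  by apply: H; rewrite ?mulr_ge0// !ger0_norm// (le_trans c0).
have [|c] := MVT_segment (ltW a0) (fun s _ => dg s); first exact: continuous_subspaceT.
rewrite in_itv/= => /andP[ac c0] E; rewrite distrC E sub0r normrM normrN ler_wpM2r//.
by apply: H; rewrite ?mulr_le0 ?(ltW a0)// !ler0_norm ?lerN2// (ltW a0).
Qed.

(** Only partial derivatives are at hand, so [y] is joined to [x] by segments parallel to the axes.
    The norm being the sup norm, these stay in the ball of radius [M]. *)
Lemma local_lipschitz (M : R) : exists2 L, 0 <= L &
  forall x y, `|x| <= M -> `|y| <= M -> `|f x - f y| <= L * `|x - y|.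
Proof.
have /choice[L HL] : forall i, exists L, 0 <= L /\
    forall x, `|x| <= M -> `|partial i f x| <= L.
  by move=> i; have [L L0 HL] := continuous_bounded_ball M (@cf i); exists L.
have L0 i : 0 <= L i by have [] := HL i.
exists (\sum_i L i); first exact: sumr_ge0.
move=> x y xM yM.
have M0 : 0 <= M by exact: le_trans xM.
(* replace the coordinates of [y] by those of [x] one after the other *)
pose w (k : nat) : 'rV[R]_d.+1 := \row_i (if (i < k)%N then x 0 i else y 0 i).
have w0 : w 0%N = y by apply/rowP => i; rewrite mxE.
have wd : w d.+1 = x by apply/rowP => i; rewrite mxE ltn_ord.
rewrite -{1}wd -{1}w0 -(telescope_sumr (f \o w))//.
rewrite (le_trans (ler_norm_sum _ _ _))// mulr_suml big_mkord.
apply: ler_sum => i _ /=.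
have -> : w i.+1 = w i + (x 0 i - y 0 i) *: delta_mx 0 i.
  apply/rowP => j; rewrite !mxE eqxx/= ltnS leq_eqVlt.
  have [/val_inj ->|ji] := eqVneq (val j) (val i).
    by rewrite ltnn eqxx mulr1 subrKC.
  have -> : (j == i) = false by apply/negbTE; apply: contra ji => /eqP ->.
  by rewrite mulr0 addr0.
apply: le_trans (_ : L i * `|x 0 i - y 0 i| <= _); last first.
  rewrite ler_wpM2l//; have := coord_le_norm (x - y) i.
  by rewrite !mxE.
apply: line_lipschitz => s sa sa0; apply: (HL i).2; apply: norm_le_coord => // j.
rewrite !mxE eqxx/=; have [->|ji] := eqVneq j i; last first.
  rewrite mulr0 addr0; case: ifP => _.
    exact: le_trans (coord_le_norm x j) xM.
  exact: le_trans (coord_le_norm y j) yM.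
rewrite ltnn mulr1.
have xi := le_trans (coord_le_norm x i) xM.
have yi := le_trans (coord_le_norm y i) yM.
move: xi yi sa sa0; rewrite !ler_norml => /andP[x1 x2] /andP[y1 y2].
have [xy|xy] := leP 0 (x 0 i - y 0 i).
  rewrite (ger0_norm xy) => /andP[s1 s2] sxy.
  have [s0|s0] := leP 0 s; first by apply/andP; split; lra.
  have [xy0|xy0] := eqVneq (x 0 i - y 0 i) 0.
    by apply/andP; split; lra.
  have : s * (x 0 i - y 0 i) < 0 by rewrite nmulr_rlt0// lt_neqAle eq_sym xy0.
  by rewrite ltNge sxy.
rewrite (ltr0_norm xy) => /andP[s1 s2] sxy.
have [s0|s0] := leP s 0; first by apply/andP; split; lra.
have : s * (x 0 i - y 0 i) < 0 by rewrite pmulr_rlt0.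
by rewrite ltNge sxy.
Qed.

End local_lipschitz.

(** * Error estimate for the Euler scheme along one path *)

Section euler_scheme.
Context (R : realType) (d : nat).
Variable b : 'rV[R]_d.+1 -> 'rV[R]_d.+1.

Fixpoint euler (h : R) (x0 : 'rV[R]_d.+1) (dw : nat -> 'rV[R]_d.+1) (k : nat) :
    'rV[R]_d.+1 :=
  if k is k'.+1 then
    let e := euler h x0 dw k' in e + h *: b e + dw k'
  else x0.

(** Halving the step nests the grids: an increment of one level is the sum of two increments of the
    next, so the generated sigma-algebras increase. *)
Definition mesh (m : nat) : R := (2 ^+ m)^-1.

Lemma mesh_gt0 m : 0 < mesh m.
Proof. by rewrite invr_gt0 exprn_gt0. Qed.

Lemma mesh_small (e : R) : 0 < e -> exists M, forall m, (M <= m)%N -> mesh m < e.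
Proof.
move=> e0; have [M Me] := eps_nat e0; exists M.+1 => m Mm.
apply: le_lt_trans Me; rewrite lef_pV2 ?posrE ?exprn_gt0// -natrX ler_nat.
by rewrite (leq_trans Mm)// ltnW// ltn_expl.
Qed.

Lemma mesh_half m : mesh m = mesh m.+1 + mesh m.+1.
Proof. by rewrite /mesh exprSr invfM -splitr. Qed.

Definition dyadic (m k : nat) : R := k%:R * mesh m.

Lemma dyadic_ge0 m k : 0 <= dyadic m k.
Proof. by rewrite mulr_ge0// ltW// mesh_gt0. Qed.

Lemma dyadicS m k : dyadic m k.+1 = dyadic m k + mesh m.
Proof. by rewrite /dyadic -natr1 mulrDl mul1r. Qed.

Lemma dyadic_le m k : dyadic m k <= dyadic m k.+1.
Proof. by rewrite dyadicS lerDl ltW// mesh_gt0. Qed.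

Lemma dyadic_double m k : dyadic m.+1 k.*2 = dyadic m k.
Proof. by rewrite /dyadic -muln2 natrM (mesh_half m) -mulrA [2%:R * _]mulr_natl mulr2n. Qed.

Variables (z beta : R -> 'rV[R]_d.+1).
Hypothesis cz : {within `[0, +oo[, continuous z}.
Hypothesis lip : forall M : R, exists2 L, 0 <= L &
  forall x y, `|x| <= M -> `|y| <= M -> `|b x - b y| <= L * `|x - y|.
(* The integral equation [z v - z u = \int_u^v b (z s) ds + beta v - beta u],
   in the form of an estimate when [b (z s)] is nearly constant on [u, v]. *)
Hypothesis int_eq : forall u v i y e, 0 <= u -> u <= v ->
  (forall s, u <= s <= v -> `|b (z s) 0 i - y| <= e) ->
  `|z v 0 i - z u 0 i - (v - u) * y - (beta v 0 i - beta u 0 i)| <= (v - u) * e.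

Lemma path_bounded (t : R) : 0 <= t -> exists M, forall s, 0 <= s <= t -> `|z s| <= M.
Proof.
move=> t0; have [|c _ Hc] := @EVT_max R (fun s => `|z s|) 0 t t0.
  have sub : `[0, t] `<=` `[0, +oo[%classic.
    by move=> s; rewrite /= !in_itv/= => /andP[->].
  move=> s; apply: (@continuous_comp (subspace `[0, t]) _ _ z Num.norm);
    last exact: norm_continuous.
  exact: (continuous_subspaceW sub cz).
by exists `|z c| => s st; apply: Hc; rewrite in_itv.
Qed.

(** Heine's theorem: otherwise pairs of nearby times with distant positions would accumulate at a
    point where [z] is not continuous. *)
Lemma path_unif_continuous (t e : R) : 0 < e -> exists2 del, 0 < del &
  forall u v, 0 <= u <= t -> 0 <= v <= t -> `|u - v| < del -> `|z u - z v| < e.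
Proof.
move=> e0; apply: contrapT => H.
have /choice[uv Huv] : forall n : nat, exists uv : R * R,
    [/\ 0 <= uv.1 <= t, 0 <= uv.2 <= t, `|uv.1 - uv.2| < n.+1%:R^-1 &
        e <= `|z uv.1 - z uv.2|].
  move=> n; apply: contrapT => Hn; apply: H; exists n.+1%:R^-1.
    by rewrite invr_gt0.
  move=> u v ut vt uvn; rewrite ltNge; apply/negP => euv.
  by apply: Hn; exists (u, v).
have [|x /andP[x0 _] clx] := @segment_cluster R 0 t (fun n => (uv n).1).
  by move=> n; have [] := Huv n.
have e20 : 0 < e / 2 by rewrite divr_gt0.
have [del del0 Hd] := within_continuousP cz x0 e20.
have del20 : 0 < del / 2 by rewrite divr_gt0.
have [N Nd] := eps_nat del20.
have [n Nn xn] := clx _ del20 N.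
have [/andP[u0 _] /andP[v0 _] uvn] := Huv n; rewrite leNgt => /negP; apply.
rewrite (splitr e) -(subrKA (z x)) (le_lt_trans (ler_normD _ _))// ltrD//.
  by rewrite distrC; apply: Hd => //; rewrite (lt_trans xn)// ltr_pdivrMr// ltr_pMr// ltr1n.
apply: Hd => //; rewrite (splitr del) -(subrKA (uv n).1).
rewrite (le_lt_trans (ler_normD _ _))// ltrD// (lt_trans uvn)//.
by rewrite (le_lt_trans _ Nd)// lef_pV2 ?posrE// ler_nat.
Qed.

Let e m := euler (mesh m) (z 0) (fun k => beta (dyadic m k.+1) - beta (dyadic m k)).

(** The drift is Lipschitz only on balls: an error of at most 1 keeps the scheme in the ball of
    radius [M + 1]. The term in [om] comes from freezing the drift along the true path during one
    step. *)
Lemma euler_step (m k : nat) (M L om : R) : 0 <= L ->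
  (forall x y, `|x| <= M + 1 -> `|y| <= M + 1 -> `|b x - b y| <= L * `|x - y|) ->
  `|z (dyadic m k)| <= M ->
  (forall s, dyadic m k <= s <= dyadic m k.+1 ->
     `|b (z s) - b (z (dyadic m k))| <= om) ->
  `|e m k - z (dyadic m k)| <= 1 ->
  `|e m k.+1 - z (dyadic m k.+1)| <=
    (1 + mesh m * L) * `|e m k - z (dyadic m k)| + mesh m * om.
Proof.
move=> L0 HL zM Hom ez1.
have h0 := ltW (mesh_gt0 m).
have om0 : 0 <= om.
  by apply: le_trans (Hom (dyadic m k) _); rewrite ?normr_ge0// lexx dyadic_le.
apply: norm_le_coord => [|i].
  by rewrite addr_ge0 ?mulr_ge0// addr_ge0 ?mulr_ge0.
set zk := z (dyadic m k); set zk1 := z _.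
have -> : (e m k.+1 - zk1) 0 i = (e m k - zk) 0 i +
   mesh m * (b (e m k) - b zk) 0 i -
   (zk1 0 i - zk 0 i - mesh m * b zk 0 i -
     (beta (dyadic m k.+1) 0 i - beta (dyadic m k) 0 i)).
  by rewrite /e /= !mxE; ring.
rewrite (le_trans (ler_normB _ _))// lerD//; last first.
  have := @int_eq (dyadic m k) (dyadic m k.+1) i (b zk 0 i) om (dyadic_ge0 _ _)
    (dyadic_le _ _).
  have -> : dyadic m k.+1 - dyadic m k = mesh m by rewrite dyadicS addrAC subrr add0r.
  apply => s ks; apply: le_trans (Hom s ks).
  by have := coord_le_norm (b (z s) - b (z (dyadic m k))) i; rewrite !mxE.
rewrite (le_trans (ler_normD _ _))// mulrDl mul1r lerD ?coord_le_norm//.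
rewrite normrM (ger0_norm h0) -mulrA ler_wpM2l//.
rewrite (le_trans (coord_le_norm _ _))// HL//.
  by rewrite -(subrK zk (e m k)) (le_trans (ler_normD _ _))// addrC lerD.
by rewrite (le_trans zM)// lerDl.
Qed.

Lemma euler_cvg (t eps : R) : 0 <= t -> 0 < eps -> exists N, forall m, (N <= m)%N ->
  `|e m (Num.truncn (t / mesh m)) - z t| < eps.
Proof.
move=> t0 eps0.
have [M HM] := path_bounded t0.
have [L L0 HL] := lip (M + 1).
have M0 : 0 <= M by apply: le_trans (HM 0 _); rewrite ?lexx.
pose e' := Num.min (eps / 2) 1.
have e'0 : 0 < e' by rewrite lt_min divr_gt0//=.
have e'1 : e' <= 1 by rewrite ge_min lexx orbT.
have e'e : e' <= eps / 2 by rewrite ge_min lexx.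
(* Makes the accumulated error [t * om * expR (L * t)] at most [e'], hence at most 1 and at most
   [eps / 2]; [t + 1] avoids a division by 0. *)
pose om := e' / ((t + 1) * expR (L * t)).
have t1 : 0 < t + 1 by rewrite ltr_wpDl.
have om0 : 0 < om by rewrite divr_gt0// mulr_gt0// expR_gt0.
have ome : t * om * expR (L * t) <= e'.
  rewrite /om [leLHS](_ : _ = e' * (t / (t + 1))); last first.
    by field; rewrite !gt_eqF ?expR_gt0.
  by rewrite ler_piMr ?(ltW e'0)// ler_pdivrMr// mul1r lerDl.
have L1 : 0 < L + 1 by rewrite ltr_wpDl.
(* An oscillation of the path below this value moves the drift by at most [om]. *)
have omL : 0 < om / (L + 1) by rewrite divr_gt0.
have [d1 d10 Hd1] := @path_unif_continuous t _ omL.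
have [d2 d20 Hd2] := @path_unif_continuous t _ e'0.
have [N HN] : exists N, forall m, (N <= m)%N -> mesh m < Num.min d1 d2.
  by apply: mesh_small; rewrite lt_min d10.
exists N => m /HN; rewrite lt_min => /andP[h1 h2].
have h0 := mesh_gt0 m.
(* Discrete Gronwall inequality. The bound at rank [k] is itself at most 1, which is what permits
   the next step with the constant [L] of the larger ball. *)
have step k : dyadic m k <= t -> `|e m k - z (dyadic m k)| <=
    dyadic m k * om * (1 + mesh m * L) ^+ k.
  elim: k => [_|k IH kt].
    by rewrite /e /dyadic !mul0r /= subrr normr0.
  have kt' : dyadic m k <= t by apply: le_trans kt; exact: dyadic_le.
  have zk : `|z (dyadic m k)| <= M by apply: HM; rewrite dyadic_ge0.
  have hL0 : 0 <= mesh m * L by rewrite mulr_ge0// ltW.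
  have ek1 : `|e m k - z (dyadic m k)| <= 1.
    apply: le_trans (IH kt') _; apply: le_trans e'1; apply: le_trans ome.
    apply: ler_pM.
    - by rewrite mulr_ge0 ?dyadic_ge0// ltW.
    - by rewrite exprn_ge0// addr_ge0.
    - by rewrite ler_wpM2r// ltW.
    rewrite (@le_trans _ _ (expR (mesh m * L) ^+ k))//.
      by apply: lerXn2r; rewrite ?nnegrE ?addr_ge0 ?expR_ge0 ?expR_ge1Dx.
    rewrite -expRM_natr ler_expR mulrC mulrA [L * t]mulrC ler_wpM2r//.
  apply: le_trans (euler_step (om := om) L0 HL zk _ ek1) _ => [s /andP[ks sk]|].
    have s0t : 0 <= s <= t by rewrite (le_trans (dyadic_ge0 m k) ks) (le_trans sk).
    apply: (@le_trans _ _ (L * `|z s - z (dyadic m k)|)).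
      apply: HL; first by rewrite (le_trans (HM _ s0t))// lerDl.
      by rewrite (le_trans zk)// lerDl.
    apply: (@le_trans _ _ (L * (om / (L + 1)))).
      rewrite ler_wpM2l// ltW// Hd1 ?dyadic_ge0//.
      rewrite ger0_norm ?subr_ge0// (le_lt_trans _ h1)// lerBlDl -dyadicS//.
    by rewrite mulrCA ler_piMr ?(ltW om0)// ler_pdivrMr// mul1r lerDl.
  rewrite [leRHS](_ : _ = (1 + mesh m * L) *
    (dyadic m k * om * (1 + mesh m * L) ^+ k) +
    mesh m * om * (1 + mesh m * L) ^+ k.+1); last by rewrite dyadicS exprS; ring.
  apply: lerD; first by rewrite ler_wpM2l ?addr_ge0// IH.
  apply: ler_peMr; first by rewrite mulr_ge0// ltW.
  by rewrite exprn_ege1// lerDl.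
set k := Num.truncn _.
have tm0 : 0 <= t / mesh m by rewrite divr_ge0// ltW.
have kt : dyadic m k <= t.
  by rewrite /dyadic -ler_pdivlMr// truncn_le.
have tk : t < dyadic m k.+1.
  by rewrite /dyadic -ltr_pdivrMr// truncnS_gt.
rewrite -(subrKA (z (dyadic m k))) (splitr eps) (le_lt_trans (ler_normD _ _))//.
rewrite ler_ltD//.
  apply: le_trans (step k kt) _; apply: le_trans e'e; apply: le_trans ome.
  apply: ler_pM.
  - by rewrite mulr_ge0 ?dyadic_ge0// ltW.
  - by rewrite exprn_ge0// addr_ge0// mulr_ge0// ltW.
  - by rewrite ler_wpM2r// ltW.
  rewrite (@le_trans _ _ (expR (mesh m * L) ^+ k))//.
    by apply: lerXn2r; rewrite ?nnegrE ?addr_ge0 ?expR_ge0 ?expR_ge1Dx ?mulr_ge0 ?(ltW h0).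
  by rewrite -expRM_natr ler_expR mulrC mulrA [L * t]mulrC ler_wpM2r.
apply: lt_le_trans e'e; apply: Hd2; rewrite ?dyadic_ge0 ?t0 ?lexx//.
by rewrite distrC ger0_norm ?subr_ge0// (lt_trans _ h2)// ltrBlDl -dyadicS.
Qed.

End euler_scheme.

(** * The integral equation on the clock of the particle *)

Section integral_equation.
Context (R : realType) (d : nat).
Variables (b : 'rV[R]_d.+1 -> 'rV[R]_d.+1) (c T0 : R)
  (x w : R -> 'rV[R]_d.+1).
Local Notation mu := (@lebesgue_measure R).
Hypothesis cb : forall i, continuous (fun y => b y 0 i).
Hypothesis cx : {within `[T0, +oo[, continuous x}.
Hypothesis xE : forall t, T0 <= t -> forall i,
  x t 0 i = x T0 0 i + \int[mu]_(s in `[T0, t]) b (x s) 0 i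
    + c * (w t 0 i - w T0 0 i).

Lemma displaced_continuous : {within `[0, +oo[, continuous (fun t => x (T0 + t))}.
Proof.
apply/subspace_continuousP => t; rewrite /= in_itv/= andbT => t0.
have /subspace_continuousP/(_ (T0 + t)) := cx.
rewrite /= in_itv/= lerDl andbT => /(_ t0)/cvgrPdist_lt H.
apply/cvgrPdist_lt => e e0; have := H e e0.
rewrite /prop_near1 /within/= => /nbhs_ballP[del /= del0 Hd].
apply/nbhs_ballP; exists del => //= s ts s0; apply: Hd.
  by move: ts; rewrite /ball/= opprD addrACA subrr add0r.
by rewrite in_itv/= andbT lerDl; move: s0; rewrite in_itv/= andbT.
Qed.

(** Subtracting the equations at the two times cancels the initial value and the noise and leaves
    the integral of the drift, which lies between the integrals of the constants [y - e] and
    [y + e]. *)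
Lemma integral_equation_estimate (u v : R) (i : 'I_d.+1) (y e : R) :
  0 <= u -> u <= v ->
  (forall s, u <= s <= v -> `|b (x (T0 + s)) 0 i - y| <= e) ->
  `|x (T0 + v) 0 i - x (T0 + u) 0 i - (v - u) * y -
    ((c *: (w (T0 + v) - w T0)) 0 i - (c *: (w (T0 + u) - w T0)) 0 i)|
  <= (v - u) * e.
Proof.
move=> u0 uv H; have v0 := le_trans u0 uv.
pose g s := b (x s) 0 i.
have cg p q : T0 <= p -> {within `[p, q], continuous g}.
  move=> p0; have sub : `[p, q] `<=` `[T0, +oo[%classic.
    by move=> s; rewrite /= !in_itv/= andbT => /andP[+ _]; exact: le_trans.
  move=> s; apply: (@continuous_comp (subspace `[p, q]) _ _ x (fun y => b y 0 i));
    last exact: cb.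
  exact: (continuous_subspaceW sub cx).
have ig p q : T0 <= p -> mu.-integrable `[p, q] (EFin \o g).
  by move=> p0; apply: continuous_compact_integrable; [exact: segment_compact|exact: cg].
have Tu : T0 <= T0 + u by rewrite lerDl.
have Tv : T0 <= T0 + v by rewrite lerDl.
have Tuv : T0 + u <= T0 + v by rewrite lerD2l.
have iuv : mu.-integrable `]T0 + u, T0 + v] (EFin \o g).
  apply: (integrableS _ _ _ (ig (T0 + u) (T0 + v) Tu)) => //.
  by apply: subset_itvr; rewrite bnd_simp.
have itvB : \int[mu]_(s in `[T0, T0 + v]) g s - \int[mu]_(s in `[T0, T0 + u]) g s =
    \int[mu]_(s in `]T0 + u, T0 + v]) g s.
  by apply: Rintegral_itvB; [exact: ig|rewrite bnd_simp|rewrite bnd_simp].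
have -> : x (T0 + v) 0 i - x (T0 + u) 0 i - (v - u) * y -
    ((c *: (w (T0 + v) - w T0)) 0 i - (c *: (w (T0 + u) - w T0)) 0 i) =
    \int[mu]_(s in `]T0 + u, T0 + v]) g s - (v - u) * y.
  by rewrite -itvB (xE Tv) (xE Tu) !mxE /g; ring.
have cst_int (r : R) : \int[mu]_(s in `]T0 + u, T0 + v]) r = r * (v - u).
  rewrite Rintegral_cst//= lebesgue_measure_itv/= lte_fin ltrD2l.
  have [uv'|vu] := ltP u v; first by rewrite -EFinD opprD addrACA subrr add0r.
  by rewrite (@le_anti _ _ u v) ?uv ?vu// subrr !mulr0.
have int_cst (r : R) : mu.-integrable `]T0 + u, T0 + v] (EFin \o cst r).
  apply: (@integrableS _ _ _ mu `[T0 + u, T0 + v]) => //.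
    by apply: subset_itvr; rewrite bnd_simp.
  apply: continuous_compact_integrable; first exact: segment_compact.
  by apply: continuous_subspaceT => s; exact: cvg_cst.
have gH s : `]T0 + u, T0 + v]%classic s -> y - e <= g s <= y + e.
  rewrite /= in_itv/= => /andP[us sv].
  have := H (s - T0); rewrite lerBrDl (ltW us) lerBlDl sv subrKC => /(_ isT).
  by rewrite ler_distl.
rewrite ler_distl; apply/andP; split.
- rewrite -mulrBr mulrC -cst_int; apply: le_Rintegral => //.
    exact: int_cst.
  by move=> s /gH /andP[].
- rewrite -mulrDr mulrC -cst_int; apply: le_Rintegral => //.
    exact: int_cst.
  by move=> s /gH /andP[].
Qed.
End integral_equation.

Lemma sigma_processS (T K E1 E2 : Type) (I : set K) (Z1 : K -> T -> E1)
    (Z2 : K -> T -> E2) (G1 : set (set E1)) (G2 : set (set E2)) :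
  (forall t, I t -> forall B, G1 B -> sigma_process I Z2 G2 (Z1 t @^-1` B)) ->
  sigma_process I Z1 G1 `<=` sigma_process I Z2 G2.
Proof.
move=> H; apply: smallest_sub; first exact: smallest_sigma_algebra.
by move=> _ [t It [B GB <-]]; rewrite setTI; exact: H.
Qed.

Lemma sigma_process_gen (T K E : Type) (I : set K) (Z : K -> T -> E)
    (G : set (set E)) t B : I t -> G B -> sigma_process I Z G (Z t @^-1` B).
Proof.
move=> It GB; apply: sub_sigma_algebra; exists t => //; exists B => //.
by rewrite setTI.
Qed.

(** * Law of the exit mark *)

Section brownian_increments.
Context (R : realType) (d : nat) (dT : measure_display) (T : measurableType dT)
  (P : probability T R).
Variables (Z0 : T -> 'rV[R]_d.+1) (W : R -> T -> 'rV[R]_d.+1).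
Hypotheses (bmW : brownian_motion P W)
  (indW : independent2 P (preimage_set_system setT Z0 (@borel R d.+1))
     (sigma_process `[0, +oo[ W (@borel R d.+1))).

Definition increment (m k : nat) (i : 'I_d.+1) (w : T) : R :=
  W (dyadic R m k.+1) w 0 i - W (dyadic R m k) w 0 i.

Let Gi (i : 'I_d.+1) := sigma_process `[0, +oo[ (fun t w => W t w 0 i) measurable.

Let sGi i : sigma_algebra setT (Gi i).
Proof. exact: smallest_sigma_algebra. Qed.

Lemma fmeas_increment m k i : fmeas (Gi i) (increment m k i).
Proof.
have H t : 0 <= t -> measurable_fun (setT : set (g_sigma_algebraType (Gi i)))
    (fun w => W t w 0 i).
  move=> t0; apply/(fmeasP _ (sGi i)) => B mB.
  by apply: (sigma_process_gen (Z := fun t w => W t w 0 i)) => //=; rewrite in_itv/= t0.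
by apply/(fmeasP _ (sGi i)); apply: measurable_funB; apply: H; exact: dyadic_ge0.
Qed.

Lemma measurable_increment m k i : measurable_fun setT (increment m k i).
Proof.
by apply: measurable_funB; apply: (bm_measurable (bmW.1 i)); exact: dyadic_ge0.
Qed.

Lemma coord_sigma_process i : Gi i `<=` sigma_process `[0, +oo[ W (@borel R d.+1).
Proof.
apply: sigma_processS => t It B mB.
have -> : (fun w => W t w 0 i) @^-1` B = W t @^-1` ((fun y => y 0 i) @^-1` B) by [].
apply: sigma_process_gen => //.
have sb : sigma_algebra setT (@borel R d.+1) by exact: smallest_sigma_algebra.
apply: (@fmeas_continuous_borel R d.+1 _ _ sb id (fun y => y 0 i)) => //.
by move=> y; exact: coord_continuous.
Qed.

(** Independence enters three times: initial value and noise, coordinates of the noise, increments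
    of one coordinate. The result depends only on the initial law, so it is the same for two
    particles on different spaces. *)
Lemma increment_rectangle (m K : nat) (B : set 'rV[R]_d.+1)
    (C : nat -> 'I_d.+1 -> set R) :
  borel B -> (forall k i, measurable (C k i)) ->
  P (Z0 @^-1` B `&`
     [set w | forall k i, (k < K)%N -> C k i (increment m k i w)]) =
  (P (Z0 @^-1` B) * \prod_(i < d.+1) \prod_(k < K)
     normal_prob 0 (Num.sqrt (mesh R m)) (C k i))%E.
Proof.
move=> bB mC.
pose Ai (i : 'I_d.+1) := \bigcap_(k in [set` index_enum 'I_K]) (increment m k i @^-1` C k i).
have GiA i : Gi i (Ai i).
  rewrite /Ai bigcap_seq; elim/big_ind: _ => //.
  - exact: sigma_algebra_setT (sGi i).
  - exact: sigma_algebra_setI (sGi i).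
  - by move=> k _; exact: fmeas_increment.
have AE : [set w | forall k i, (k < K)%N -> C k i (increment m k i w)] =
    \bigcap_(i in [set` index_enum 'I_d.+1]) Ai i.
  apply/seteqP; split => [w H i _ k _|w H k i kK] /=; first exact: H.
  by apply: (H i (mem_index_enum _) (Ordinal kK)); exact: mem_index_enum.
rewrite AE indW; last 2 first.
- by exists B => //; rewrite setTI.
- rewrite bigcap_seq; have sW : sigma_algebra setT (sigma_process `[0, +oo[ W (@borel R d.+1)).
    exact: smallest_sigma_algebra.
  elim/big_ind: _ => //.
  + exact: sigma_algebra_setT sW.
  + exact: sigma_algebra_setI sW.
  + by move=> i _; exact: coord_sigma_process (GiA i).
congr (_ * _)%E.
rewrite bmW.2 ?index_enum_uniq//; last by move=> i _; exact: GiA.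
apply: eq_bigr => i _.
have bi := bmW.1 i.
have := bm_independent bi (k := K) (t := dyadic R m) (dyadic_ge0 R m 0)
  (@dyadic_le R m).
move=> /(_ (index_enum 'I_K) (fun k => increment m k i @^-1` C k i)).
rewrite index_enum_uniq => /(_ isT) ->; last first.
  by move=> k _; exists (C k i) => //; rewrite setTI.
apply: eq_bigr => k _.
have := bm_normal bi (dyadic_ge0 R m k) (t := dyadic R m k.+1).
rewrite dyadicS ltrDl mesh_gt0 => /(_ isT (C k i) (mC _ _)).
rewrite -dyadicS [X in Num.sqrt X](_ : _ = mesh R m)//.
by rewrite dyadicS addrAC subrr add0r.
Qed.

End brownian_increments.

(* required by [g_sigma_algebraType] on the disjoint union of two spaces *)
HB.instance Definition _ (T S : pointedType) :=
  isPointed.Build (T + S)%type (inl point).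

(** * Equality of laws through the disjoint union of the sample spaces *)

Section comparison.
Context (R : realType) (d : nat) (dT : measure_display) (T : measurableType dT)
  (P : probability T R) (dS : measure_display) (S : measurableType dS)
  (Q : probability S R).

(* Events of the disjoint union of the two sample spaces; such an event
   represents the same property of the two families of random variables. *)
Let Om := (T + S)%type.

Definition join_fun (E : Type) (f : T -> E) (g : S -> E) (p : Om) : E :=
  match p with inl w => f w | inr v => g v end.

Definition agree : set (set Om) := [set A | [/\ measurable (inl @^-1` A : set T),
  measurable (inr @^-1` A : set S) & P (inl @^-1` A) = Q (inr @^-1` A)]].

(** Equality of two probabilities passes to complements and disjoint unions but not to
    intersections, so agreement has to start from pi-systems. *)
Lemma agree_dynkin : dynkin agree.
Proof.
split.
- by split; rewrite ?preimage_setT// !probability_setT.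
- move=> A [mA mA' PQ]; split; rewrite preimage_setC; [exact: measurableC..|].
  by rewrite preimage_setC !probability_setC// PQ.
- move=> A tA agA.
  have mT n : measurable (inl @^-1` A n : set T) by have [] := agA n.
  have mS n : measurable (inr @^-1` A n : set S) by have [] := agA n.
  split; rewrite preimage_bigcup; [exact: bigcupT_measurable..|].
  rewrite preimage_bigcup measure_bigcup//; last first.
    by move=> i j _ _ [w [/= Ai Aj]]; apply: tA => //; exists (inl w).
  rewrite measure_bigcup//; last first.
    by move=> i j _ _ [w [/= Ai Aj]]; apply: tA => //; exists (inr w).
  by apply: eq_eseriesr => n _; have [] := agA n.
Qed.

Lemma agree_generated (G : set (set Om)) : setI_closed G -> G `<=` agree ->
  <<s G >> `<=` agree.
Proof.
move=> GI Ga; rewrite -setI_closed_g_dynkin_g_sigma_algebra//.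
by apply: smallest_sub => //; exact: agree_dynkin.
Qed.

Variables (Z0 : T -> 'rV[R]_d.+1) (W : R -> T -> 'rV[R]_d.+1)
  (Z0' : S -> 'rV[R]_d.+1) (W' : R -> S -> 'rV[R]_d.+1).
Hypotheses (bmW : brownian_motion P W)
  (indW : independent2 P (preimage_set_system setT Z0 (@borel R d.+1))
     (sigma_process `[0, +oo[ W (@borel R d.+1)))
  (bmW' : brownian_motion Q W')
  (indW' : independent2 Q (preimage_set_system setT Z0' (@borel R d.+1))
     (sigma_process `[0, +oo[ W' (@borel R d.+1))).
Hypotheses (mZ0 : forall B, borel B -> measurable (Z0 @^-1` B))
  (mZ0' : forall B, borel B -> measurable (Z0' @^-1` B))
  (lawZ0 : forall B, borel B -> P (Z0 @^-1` B) = Q (Z0' @^-1` B)).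

Let x0 := join_fun Z0 Z0'.
Let V t := join_fun (W t) (W' t).
Let incr m k (i : 'I_d.+1) (p : Om) : R :=
  V (dyadic R m k.+1) p 0 i - V (dyadic R m k) p 0 i.

Let rect m : set (set Om) := [set A | exists (B : set 'rV[R]_d.+1) (K : nat)
    (C : nat -> 'I_d.+1 -> set R),
  [/\ borel B, forall k i, measurable (C k i) &
    A = x0 @^-1` B `&` [set p | forall k i, (k < K)%N -> C k i (incr m k i p)]]].

Let sb : sigma_algebra setT (@borel R d.+1).
Proof. exact: smallest_sigma_algebra. Qed.

Let rectI m : setI_closed (rect m).
Proof.
move=> _ _ [B [K [C [bB mC ->]]]] [B' [K' [C' [bB' mC' ->]]]].
exists (B `&` B'), (maxn K K'), (fun k i =>
  (if (k < K)%N then C k i else setT) `&` (if (k < K')%N then C' k i else setT)).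
split; first exact: (sigma_algebra_setI sb).
  by move=> k i; apply: measurableI; case: ifP.
apply/seteqP; split => [p [[/= Bo Co] [B'o C'o]]|p [/= [Bo B'o] H]].
  split => // k i _; split; first by case: ifP => // /Co.
  by case: ifP => // /C'o.
split; split => // k i kK.
  by have := H k i; rewrite leq_max kK => /(_ isT)[].
by have := H k i; rewrite leq_max kK orbT => /(_ isT)[_].
Qed.

Let measurable_rect dX (X : measurableType dX) (U : R -> X -> 'rV[R]_d.+1)
    m K (C : nat -> 'I_d.+1 -> set R) :
  (forall k i, measurable_fun setT (increment U m k i)) ->
  (forall k i, measurable (C k i)) ->
  measurable [set w | forall k i, (k < K)%N -> C k i (increment U m k i w)].
Proof.
move=> mU mC.
rewrite (_ : [set _ | _] = \bigcap_(k in [set k | (k < K)%N])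
   \bigcap_(i in [set: 'I_d.+1]) (increment U m k i @^-1` C k i)).
  apply: bigcap_measurableType => k _.
  apply: fin_bigcap_measurable => [|i _]; first exact: finite_finset.
  by rewrite -[_ @^-1` _]setTI; exact: mU.
by apply/seteqP; split => [w H k kK i _|w H k i kK]; exact: H.
Qed.

Let rect_agree m : rect m `<=` agree.
Proof.
move=> _ [B [K [C [bB mC ->]]]].
have mT := measurable_rect (m := m) K (measurable_increment bmW m) mC.
have mS := measurable_rect (m := m) K (measurable_increment bmW' m) mC.
split; [by apply: measurableI => //; exact: mZ0|
  by apply: measurableI => //; exact: mZ0'|].
have := increment_rectangle bmW indW m K bB mC.
rewrite lawZ0// -(increment_rectangle bmW' indW' m K bB mC).
by [].
Qed.

Let Gm m := <<s rect m >>.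

Let sGm m : sigma_algebra setT (Gm m).
Proof. exact: smallest_sigma_algebra. Qed.

Let Gm_agree m : Gm m `<=` agree.
Proof. by apply: agree_generated; [exact: rectI|exact: rect_agree]. Qed.

Let Gm_x0 m B : borel B -> Gm m (x0 @^-1` B).
Proof.
move=> bB; apply: sub_sigma_algebra; exists B, 0%N, (fun _ _ => setT); split => //.
by apply/seteqP; split => [p ?|p []].
Qed.

Let Gm_incr m k i : fmeas (Gm m) (incr m k i).
Proof.
move=> C mC; apply: sub_sigma_algebra.
exists setT, k.+1, (fun k' i' => if (k' == k) && (i' == i) then C else setT); split.
- exact: (sigma_algebra_setT sb).
- by move=> k' i'; case: ifP.
apply/seteqP; split => [p Co|p [_ /(_ k i (ltnSn k))]]; last by rewrite !eqxx.
by split => // k' i' _; case: ifP => // /andP[/eqP-> /eqP->].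
Qed.

Let Gm_sub m : Gm m `<=` Gm m.+1.
Proof.
apply: smallest_sub; first exact: sGm.
move=> _ [B [K [C [bB mC ->]]]]; apply: (sigma_algebra_setI (@sGm _)).
  exact: Gm_x0.
rewrite (_ : [set _ | _] = \bigcap_(k in [set k | (k < K)%N])
   ~` \bigcup_(i : 'I_d.+1) ~` (incr m k i @^-1` C k i)).
  apply: (sigma_algebra_bigcap_cond (@sGm m.+1)) => k _; apply: (sigma_algebra_setC (@sGm m.+1)).
  apply: (sigma_algebra_bigcup_countable (@sGm m.+1)) => i; apply: (sigma_algebra_setC (@sGm m.+1)).
  have -> : incr m k i = fun p => incr m.+1 k.*2.+1 i p + incr m.+1 k.*2 i p.
    apply/funext => p; rewrite /incr -doubleS !dyadic_double.
    by rewrite addrA subrK.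
  move: (C k i) (mC k i); apply/(fmeasP _ (sGm m.+1)); apply: measurable_funD;
    by apply/(fmeasP _ (sGm m.+1)); exact: Gm_incr.
apply/seteqP; split => [p H k kK [i _]|p H k i kK]; first by apply; exact: H.
by apply: contrapT => nC; apply: (H k kK); exists i.
Qed.

Let Gm_mono m n : (m <= n)%N -> Gm m `<=` Gm n.
Proof.
move=> mn; rewrite -(subnKC mn); elim: (n - m)%N => [|k IH]; first by rewrite addn0.
by rewrite addnS; apply: subset_trans IH _; exact: Gm_sub.
Qed.

Let Goo := <<s \bigcup_m Gm m >>.

Let sGoo : sigma_algebra setT Goo.
Proof. exact: smallest_sigma_algebra. Qed.

(** The sigma-algebras of the levels increase, so their union is stable under intersection although
    it need not be a sigma-algebra. *)
Let Goo_agree : Goo `<=` agree.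
Proof.
apply: agree_generated => [A B [m _ GA] [n _ GB]|A [m _]]; last exact: Gm_agree.
exists (maxn m n) => //; apply: (sigma_algebra_setI (@sGm _)).
  exact: (Gm_mono (leq_maxl m n)).
exact: (Gm_mono (leq_maxr m n)).
Qed.

Variables (b : 'rV[R]_d.+1 -> 'rV[R]_d.+1) (c : R).
Hypothesis cb : forall i, continuous (fun y => b y 0 i).

Let scheme m k (p : Om) := euler b (mesh R m) (x0 p)
  (fun k => c *: (V (dyadic R m k.+1) p - V (dyadic R m k) p)) k.

Let Gm_scheme m k B : borel B -> Gm m (scheme m k @^-1` B).
Proof.
move: B; elim: k => [|k IH] B; first exact: Gm_x0.
move: B; apply: (borel_coord (sGm m)) => i.
have -> : (fun p => scheme m k.+1 p 0 i) = fun p =>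
    scheme m k p 0 i + mesh R m * b (scheme m k p) 0 i + c * incr m k i p.
  by apply/funext => p; rewrite /scheme /= !mxE.
have H f : fmeas (Gm m) f <-> measurable_fun (setT : set (g_sigma_algebraType (Gm m))) f.
  exact: fmeasP.
apply/H; apply: measurable_funD; first apply: measurable_funD.
- apply/H; apply: (fmeas_continuous_borel (sGm m) (g := fun y => y 0 i)) => //.
  by move=> y; exact: coord_continuous.
- apply: measurable_funM => //; apply/H.
  exact: (fmeas_continuous_borel (sGm m) (g := fun y => b y 0 i)).
- by apply: measurable_funM => //; apply/H; exact: Gm_incr.
Qed.

(* Almost sure limits of the Euler schemes are only measurable up to events
   negligible on both sides of the disjoint union. *)
Let null_modification : set (set Om) := [set A | exists2 C, Goo C &
  {ae P, forall w, A (inl w) <-> C (inl w)} /\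
  {ae Q, forall v, A (inr v) <-> C (inr v)}].

Let snull : sigma_algebra setT null_modification.
Proof.
split.
- by exists set0; [case: sGoo|split; apply: aeW].
- move=> A [C GC [AP AQ]]; exists (~` C); first exact: (sigma_algebra_setC sGoo).
  by split; [apply: filterS AP|apply: filterS AQ] => w ACw; rewrite setTD;
    split => nA h; apply: nA; exact/ACw.
- move=> A HA.
  have /choice[C HC] : forall n, exists C, [/\ Goo C,
      {ae P, forall w, A n (inl w) <-> C (inl w)} &
      {ae Q, forall v, A n (inr v) <-> C (inr v)}].
    by move=> n; have [C GC [AP AQ]] := HA n; exists C.
  exists (\bigcup_n C n).
    by apply: (sigma_algebra_bigcupT sGoo) => n; have [] := HC n.
  have AP : {ae P, forall w, forall n, A n (inl w) <-> C n (inl w)}.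
    by apply/ae_foralln => n; have [] := HC n.
  have AQ : {ae Q, forall w, forall n, A n (inr w) <-> C n (inr w)}.
    by apply/ae_foralln => n; have [] := HC n.
  split; [apply: filterS AP|apply: filterS AQ] => w ACw;
    by split => -[n _ /ACw Cn]; exists n.
Qed.

Variables (Z : R -> T -> 'rV[R]_d.+1) (Z' : R -> S -> 'rV[R]_d.+1).
Hypotheses (cZ : forall w, {within `[0, +oo[, continuous (Z ^~ w)})
  (cZ' : forall w, {within `[0, +oo[, continuous (Z' ^~ w)})
  (mZ : forall t B, 0 <= t -> borel B -> measurable (Z t @^-1` B))
  (mZ' : forall t B, 0 <= t -> borel B -> measurable (Z' t @^-1` B)).

Definition euler_path (X : Type) (x : X -> 'rV[R]_d.+1)
    (U : R -> X -> 'rV[R]_d.+1) (m : nat) (t : R) (p : X) :=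
  euler b (mesh R m) (x p)
    (fun k => c *: U (dyadic R m k.+1) p - c *: U (dyadic R m k) p)
    (Num.truncn (t / mesh R m)).

Hypotheses
  (eulerZ : {ae P, forall w, forall t e, 0 <= t -> 0 < e -> exists N, forall m,
     (N <= m)%N -> `|euler_path Z0 W m t w - Z t w| < e})
  (eulerZ' : {ae Q, forall w, forall t e, 0 <= t -> 0 < e -> exists N, forall m,
     (N <= m)%N -> `|euler_path Z0' W' m t w - Z' t w| < e}).

Let ZZ t := join_fun (Z t) (Z' t).

(** Expresses where the limit lies by countable operations on the approximations, which keeps the
    resulting event in [Goo]. *)
Let euler_limP (x : nat -> 'rV[R]_d.+1) (y : 'rV[R]_d.+1) (D : set 'rV[R]_d.+1) :
  closed D ->
  (forall e, 0 < e -> exists N, forall m, (N <= m)%N -> `|x m - y| < e) ->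
  D y <-> forall l, exists N, forall m, (N <= m)%N -> enlarge D l (x m).
Proof.
move=> cD xy; split=> [Dy l|H].
  have [N HN] := xy (l.+1%:R^-1) ltac:(by rewrite invr_gt0).
  by exists N => m /HN xm; exists y.
apply: enlargeP => // e e0; have [N HN] := xy e e0.
have [l le] := eps_nat e0; have [N' HN'] := H l.
exists (x (maxn N N')); split; first by rewrite distrC HN// leq_maxl.
by exists l; split => //; apply: HN'; exact: leq_maxr.
Qed.

Let null_ZZ t B : 0 <= t -> borel B -> null_modification (ZZ t @^-1` B).
Proof.
move=> t0; move: B; apply: (borel_sub snull) => U oU.
rewrite -(setCK U) preimage_setC; apply: (sigma_algebra_setC snull).
have cU : closed (~` U) by exact: open_closedC.
exists (\bigcap_l \bigcup_N \bigcap_(m in [set m | (N <= m)%N])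
   (scheme m (Num.truncn (t / mesh R m)) @^-1` enlarge (~` U) l)).
  apply: (sigma_algebra_bigcapT sGoo) => l; apply: (sigma_algebra_bigcupT sGoo) => N.
  apply: (sigma_algebra_bigcap_cond sGoo) => m _; apply: sub_sigma_algebra.
  by exists m => //; apply: Gm_scheme; apply: open_borel; exact: enlarge_open.
have key (p : Om) : (forall e, 0 < e -> exists N, forall m, (N <= m)%N ->
    `|scheme m (Num.truncn (t / mesh R m)) p - ZZ t p| < e) ->
    (ZZ t @^-1` (~` U)) p <-> (\bigcap_l \bigcup_N \bigcap_(m in [set m | (N <= m)%N])
   (scheme m (Num.truncn (t / mesh R m)) @^-1` enlarge (~` U) l)) p.
  move=> /(euler_limP cU) H; split=> [/H Hl l _|Hl].
    by have [N HN] := Hl l; exists N.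
  by apply/H => l; have [N _ HN] := Hl l I; exists N.
have schemeE m k : scheme m k = fun p => euler b (mesh R m) (x0 p)
  (fun k => c *: V (dyadic R m k.+1) p - c *: V (dyadic R m k) p) k.
  by apply/funext => p; rewrite /scheme; congr euler; apply/funext => j;
    rewrite scalerBr.
split.
- apply: filterS eulerZ => w Hw; apply: key => e e0.
  have [N HN] := Hw t e t0 e0; exists N => m /HN.
  by rewrite /euler_path schemeE.
- apply: filterS eulerZ' => w Hw; apply: key => e e0.
  have [N HN] := Hw t e t0 e0; exists N => m /HN.
  by rewrite /euler_path schemeE.
Qed.

Variables (O D : set 'rV[R]_d.+1).
Hypotheses (oO : open O) (bD : borel D).

(** Measurability of the exit mark, applied to the joined path and to [null_modification], yields
    one event of [Goo] that represents the exit event on both spaces up to null sets; events of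
    [Goo] have equal probabilities on the two sides. *)
Lemma exit_mark_same_law (B : set (\bar R)) : measurable B ->
  P ((fun w => exit_mark O D (Z ^~ w)) @^-1` B) =
  Q ((fun v => exit_mark O D (Z' ^~ v)) @^-1` B).
Proof.
move=> mB.
have cZZ p : {within `[0, +oo[, continuous (ZZ ^~ p)}.
  by case: p => w; [exact: cZ|exact: cZ'].
have [C GC [CP CQ]] := fmeas_exit_mark snull oO bD cZZ null_ZZ mB.
have [mC mC' PQ] := Goo_agree GC.
transitivity (P (inl @^-1` C)).
  apply: ae_eq_measure => //.
  exact: (fmeas_exit_mark (sigma_algebra_measurable T) oO bD cZ mZ mB).
transitivity (Q (inr @^-1` C)) => //; apply/esym.
apply: ae_eq_measure => //.
exact: (fmeas_exit_mark (sigma_algebra_measurable S) oO bD cZ' mZ' mB).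
Qed.

End comparison.

(** * Application to solutions of the stochastic equation *)

Section diffusions.
Context (R : realType) (d : nat).
Variables (b : 'rV[R]_d.+1 -> 'rV[R]_d.+1) (eta : R).
Hypothesis b2 : forall i, Ck 2 (fun x => b x 0 i).

Lemma drift_continuous i : continuous (fun x => b x 0 i).
Proof. by have [] := b2 i. Qed.

Lemma drift_lipschitz (M : R) : exists2 L, 0 <= L &
  forall x y, `|x| <= M -> `|y| <= M -> `|b x - b y| <= L * `|x - y|.
Proof.
have /choice[L HL] : forall i, exists L, 0 <= L /\ forall x y, `|x| <= M ->
    `|y| <= M -> `|b x 0 i - b y 0 i| <= L * `|x - y|.
  move=> i; have [_ df pf] := b2 i.
  have cpf k : continuous (partial k (fun x => b x 0 i)) by have [] := pf k.
  by have [L L0 H] := local_lipschitz df cpf M; exists L.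
exists (\sum_i L i); first by apply: sumr_ge0 => i _; have [] := HL i.
move=> x y xM yM; apply: norm_le_coord => [|i].
  by rewrite mulr_ge0// sumr_ge0// => i _; have [] := HL i.
rewrite !mxE; apply: le_trans ((HL i).2 x y xM yM) _; rewrite ler_wpM2r//.
rewrite (bigD1 i)//= lerDl sumr_ge0// => j _; by have [] := HL j.
Qed.

Lemma ito_displaced_continuous dT (T : measurableType dT) (P : probability T R)
    (T0 : T -> R) X w :
  ito_diffusion P b eta T0 X -> {within `[0, +oo[, continuous (displaced T0 X ^~ w)}.
Proof. by move=> [_ cX _]; exact: (displaced_continuous (x := X ^~ w) (cX w)). Qed.

(* The Euler scheme driven by the Brownian motion of the equation recovers the
   path: the solution is a measurable functional of its initial value and of
   the increments of its noise, hence has a determined law. *)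
Lemma ito_euler dT (T : measurableType dT) (P : probability T R)
    (T0 : T -> R) X :
  ito_diffusion P b eta T0 X -> exists W : R -> T -> 'rV[R]_d.+1,
  [/\ brownian_motion P W,
      independent2 P (preimage_set_system setT (displaced T0 X 0) (@borel R d.+1))
        (sigma_process `[0, +oo[ W (@borel R d.+1)) &
      {ae P, forall w, forall t e, 0 <= t -> 0 < e -> exists N, forall m,
        (N <= m)%N ->
        `|euler_path b (Num.sqrt (2 * eta)) (displaced T0 X 0) W m t w
          - displaced T0 X t w| < e}].
Proof.
move=> itoX; have [_ cX [W [bmW indW XE]]] := itoX.
exists (fun t w => W (T0 w + t) w - W (T0 w) w); split => //.
apply: filterS XE => w XE t e t0 e0.
pose beta t := Num.sqrt (2 * eta) *: (W (T0 w + t) w - W (T0 w) w).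
apply: (euler_cvg (z := displaced T0 X ^~ w) (beta := beta)) => //.
- exact: ito_displaced_continuous itoX.
- exact: drift_lipschitz.
move=> u v i y r u0 uv H.
exact: (integral_equation_estimate (x := X ^~ w) (w := W ^~ w) drift_continuous (cX w) XE u0 uv H).
Qed.

Lemma ito_exit_mark_law dT (T : measurableType dT) (P : probability T R)
    dS (S : measurableType dS) (Q : probability S R) (T0 : T -> R) (S0 : S -> R)
    X Y (phi : 'rV[R]_d.+1 -> R) (O D : set 'rV[R]_d.+1) (B : set (\bar R)) :
  ito_diffusion P b eta T0 X -> ito_diffusion Q b eta S0 Y ->
  has_density P (displaced T0 X 0) phi -> has_density Q (displaced S0 Y 0) phi ->
  open O -> borel D -> measurable B ->
  P ((fun w => exit_mark O D (displaced T0 X ^~ w)) @^-1` B) =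
  Q ((fun v => exit_mark O D (displaced S0 Y ^~ v)) @^-1` B).
Proof.
move=> itoX itoY phiX phiY oO bD mB.
have [W [bmW indW eX]] := ito_euler itoX.
have [W' [bmW' indW' eY]] := ito_euler itoY.
have [mX _ _] := itoX; have [mY _ _] := itoY.
apply: (exit_mark_same_law bmW indW bmW' indW' _ _ _ drift_continuous _ _ mX mY eX eY oO bD mB).
- by move=> C; exact: mX.
- by move=> C; exact: mY.
- by move=> C bC; rewrite phiX// phiY.
- by move=> w; exact: ito_displaced_continuous itoX.
- by move=> w; exact: ito_displaced_continuous itoY.
Qed.

End diffusions.

Unset Implicit Arguments.

Theorem theorem3p2 (R : realType) (d J : nat) (lambda eta : R)
    (O : set 'rV[R]_d.+1) (D : 'I_J -> set 'rV[R]_d.+1)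
    (phi : 'rV[R]_d.+1 -> R) (b : 'rV[R]_d.+1 -> 'rV[R]_d.+1)
    (* the fountain *)
    (dT : measure_display) (T : measurableType dT) (P : probability T R)
    (A : T -> set R) (birth : nat -> T -> R)
    (X : nat -> R -> T -> 'rV[R]_d.+1)
    (* a single particle started at time 0 *)
    (dS : measure_display) (S : measurableType dS) (Pphi : probability S R)
    (Y : R -> S -> 'rV[R]_d.+1) :
  0 < lambda -> 0 < eta ->
  smooth_bounded_domain O ->
  detectors O D ->
  admissible_source O phi ->
  (forall i, Ck 2 (fun x => b x 0 i)) ->
  bounded_mean_exit_time b eta O ->
  stochastic_fountain P lambda b eta phi A birth X ->
  ito_diffusion Pphi b eta (fun=> 0) Y ->
  has_density Pphi (Y 0) phi ->
  forall j : 'I_J,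
    poisson_process P (lambda * exit_probability Pphi O (D j) Y)
      (exit_process O (D j) birth X).
Proof.
move=> lambda0 _ dom det _ b2 _ fountain itoY phiY j.
have oO := domain_open dom.
have bD := detectors_borel det j.
pose mark n w := exit_mark O (D j) (displaced (birth n) (X n) ^~ w).
(* The single particle is put in displaced form, with starting time 0, so that both marks are the
   same functional of a displaced path. *)
pose Y' := displaced (fun=> 0) Y.
have Y'E : Y' = Y by apply/funext => t; apply/funext => v; rewrite /Y' /displaced add0r.
pose mark0 v := exit_mark O (D j) (Y' ^~ v).
pose F (o : option nat) := if o is Some n
  then sigma_process `[0, +oo[ (displaced (birth n) (X n)) (@borel R d.+1)
  else sigma_process [set: nat] birth measurable.
have sF o : sigma_algebra setT (F o).
  by case: o => [n|]; exact: smallest_sigma_algebra.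
have Fm o : F o `<=` measurable.
  case: o => [n|]; apply: smallest_sub; try exact: sigma_algebra_measurable.
    move=> _ [t /= + [B bB <-]]; rewrite in_itv/= andbT setTI => t0.
    by have [+ _ _] := fountain_diffusion fountain n; apply.
  move=> _ [n _ [B mB <-]]; exact: (fountain_birth_measurable fountain n).
have mbirth n : fmeas (F None) (birth n).
  by move=> B mB; exact: sigma_process_gen.
have cX n w : {within `[0, +oo[, continuous (displaced (birth n) (X n) ^~ w)}.
  exact: ito_displaced_continuous (fountain_diffusion fountain n).
have mmark n : fmeas (F (Some n)) (mark n).
  apply: fmeas_exit_mark => // t B t0 bB.
  by apply: sigma_process_gen; rewrite //= in_itv/= t0.
have mmark0 : measurable_fun setT mark0.
  apply/fmeas_measurable; apply: fmeas_exit_mark => //.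
  - exact: sigma_algebra_measurable.
  - by move=> v; exact: ito_displaced_continuous itoY.
  - by have [] := itoY.
have law n B : measurable B -> P (mark n @^-1` B) = Pphi (mark0 @^-1` B).
  move=> mB; apply: (ito_exit_mark_law b2 (fountain_diffusion fountain n) itoY
    (fountain_initial fountain n) _ oO bD mB).
  by rewrite -/Y' Y'E.
(* Term by term: both indicators of the exit process merge into one indicator of birth time plus
   mark. *)
have -> : exit_process O (D j) birth X = exit_count birth mark.
  apply/funext => t; apply/funext => w; apply: eq_eseriesr => n _.
  by congr (_%:E); exact: exit_mark_indic.
have -> : exit_probability Pphi O (D j) Y = mark_prob Pphi mark0.
  congr fine; congr (Pphi _); apply/seteqP; split => v /=;
    rewrite /mark0 exit_mark_fin Y'E.
    by move=> [-> Dv]; exact/asboolP.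
  by move=> /andP[-> /asboolP].
exact: (poisson_process_exit_count lambda0 (fountain_births fountain)
  (fountain_enumeration fountain) (fountain_independent fountain) sF Fm
  mbirth mmark mmark0 law).
Qed.
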